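(* Let $0<w<1$ be a real number. Let $L>0$ be the real number with $$w=\sqrt{\frac{L(18+L)}{6(64+3L)}},\qquad\text{and set}\qquad M=\frac{18+L}{64+3L},$$ and let $x>0$ be determined by $$\frac{w^{1/2}}{x^{1/2}}=\frac{1}{2}\sqrt{4+\frac{2}{3}\left(\frac{L^{1/6}}{M^{1/6}}-4\frac{M^{1/6}}{L^{1/6}}\right)^2}+\frac{1}{2}\sqrt{\frac{2}{3}}\left(\frac{L^{1/6}}{M^{1/6}}-4\frac{M^{1/6}}{L^{1/6}}\right).$$ Assume $0<x<1$ (so that $k^{(-1)}(x)$ is defined), put $r=k^{(-1)}(x)$ and $w'=\sqrt{\sqrt{1-x^2}\,\sqrt{1-w^4/x^2}}$, and assume that the denominator $x^4-6x^3w-20xw^3+15w^2x^2-6xw+15w^4+w^2$ is nonzero. Then $$R\left(e^{-\pi\sqrt{k^{(-1)}(x)}}\right)^{-5}-11-R\left(e^{-\pi\sqrt{k^{(-1)}(x)}}\right)^{5}=a_r$$ $$=\frac{16x^6-26x^4-wx^3+10x^2+wx}{x^4-6x^3w-20xw^3+15w^2x^2-6xw+15w^4+w^2}\left(\frac{w}{x}+\frac{w'}{\sqrt{1-x^2}}-\frac{ww'}{x\sqrt{1-x^2}}\right)^{3}.$$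
   Context: For $0<x<1$ let $K(x)=\int_0^{\pi/2}\frac{dt}{\sqrt{1-x^2\sin^2 t}}$ be the complete elliptic integral of the first kind (argument is the modulus). For real $r>0$, $k_r\in(0,1)$ denotes the unique solution $k$ of $\frac{K(\sqrt{1-k^2})}{K(k)}=\sqrt r$, and $k'_r=\sqrt{1-k_r^2}$. For $0<x<1$, $k^{(-1)}(x)$ denotes the unique $r>0$ with $k_r=x$. For $r>0$, $a_r=\left(\frac{k'_r}{k'_{25r}}\right)^2\sqrt{\frac{k_r}{k_{25r}}}\,M_5(r)^{-3}$, where $M_5(r)=K(k_{25r})/K(k_r)$. The Rogers–Ramanujan continued fraction is, for $0<q<1$, $R(q)=\cfrac{q^{1/5}}{1+\cfrac{q}{1+\cfrac{q^2}{1+\cfrac{q^3}{1+\cdots}}}}$ (limit of the convergents, with $q^{1/5}$ the positive real root). All fractional powers of positive reals are positive. *)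

(* Defs.v *)
From Stdlib Require Import Reals ClassicalEpsilon.
From Coquelicot Require Import Coquelicot.
Open Scope R_scope.

(* The argument is the modulus, not the parameter. *)
Definition ellipticK (x : R) : R :=
  RInt (fun t => 1 / sqrt (1 - x ^ 2 * sin t ^ 2)) 0 (PI / 2).

(* For r > 0 the defining equation has exactly one solution in (0,1), so the
   choice made by [epsilon] is that solution; unspecified for r <= 0. *)
Definition singular_modulus (r : R) : R :=
  epsilon (inhabits 0)
    (fun k => 0 < k < 1 /\
       ellipticK (sqrt (1 - k ^ 2)) / ellipticK k = sqrt r).

Definition compl_singular_modulus (r : R) : R :=
  sqrt (1 - singular_modulus r ^ 2).

(* k^(-1)(x); for 0 < x < 1 there is exactly one such r. *)
Definition inv_singular_modulus (x : R) : R :=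
  epsilon (inhabits 0) (fun r => 0 < r /\ singular_modulus r = x).

Definition multiplier5 (r : R) : R :=
  ellipticK (singular_modulus (25 * r)) / ellipticK (singular_modulus r).

Definition a_ (r : R) : R :=
  (compl_singular_modulus r / compl_singular_modulus (25 * r)) ^ 2
  * sqrt (singular_modulus r / singular_modulus (25 * r))
  * / multiplier5 r ^ 3.

(* rr_denom q m n = 1 + q^m/(1 + q^(m+1)/(1 + ... + q^(m+n-1)/1)). *)
Fixpoint rr_denom (q : R) (m n : nat) : R :=
  match n with
  | O => 1
  | S n' => 1 + q ^ m / rr_denom q (S m) n'
  end.

Definition rr_convergent (q : R) (n : nat) : R :=
  Rpower q (1 / 5) / rr_denom q 1 n.

(* For 0 < q < 1 the convergents have a finite limit. *)
Definition rogers_ramanujan (q : R) : R :=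
  real (Lim_seq (rr_convergent q)).

(* Main.v *)
Require Import Defs.
From Stdlib Require Import Reals ClassicalEpsilon Lra Lia Psatz ZArith List Permutation.
From Coquelicot Require Import Coquelicot.
Import ListNotations.
Open Scope R_scope.

(** Write q = exp (- y) with y = pi sqrt r, and let t2, t3, t4 be the Jacobi
    theta constants of nome q.  Everything is read off from theta functions.

    Elliptic integrals.  The doubling formulas say that (t3^2, t4^2) passes
    from y to 2 y by one step of the arithmetic-geometric mean, so Gauss's
    integral of this pair is pi / 2 ([agmI_t34]); for (t3^2, t2^2) the
    integral doubles with y, and its logarithmic growth gives y / 2
    ([agmI_t32]).
    Hence k_r = t2^2 / t3^2 and K (k_r) = (pi / 2) t3^2
    ([singular_modulus_kmod], [ellipticK_kmod]), and since q becomes q^5 when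
    r becomes 25 r, the number a_r is a quotient of theta constants, which the
    triple product turns into (q; q)^6 / (q (q^5; q^5)^6) ([t4_eta]).

    The continued fraction.  Rogers' functions satisfy the recurrence of the
    fraction, so R (q) is q^(1/5) times a quotient of two theta series of level
    5 ([rogers_ramanujan_theta]).  The quintuple product identifies the
    5-dissection of (u; u), u^5 = q, as (q^5; q^5) (u / R - u - u R); its
    product over the five values of u is, on one side, the eta quotient, and
    on the other R^(-5) - 11 - R^5 ([rr_quintic]).

    The modular equation.  The theta series of the Gaussian integers splits
    over the ideal of norm 5, which makes t^2 (q) - t^2 (q^5) a product for each
    theta constant t ([stheta_split5], [degree5_sextic]).  The imaginary
    transformation y -> pi^2 / y, itself a consequence of the uniqueness of the
    singular modulus ([kmod_imaginary]), gives the same for 5 t^2 (q^5) - t^2 (q).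
    Dividing, one gets two quadratic equations between the multiplier
    m = K (k) / K (l), rho = sqrt (l / k) and sigma = sqrt (l' / k'), where
    k = k_r and l = k_(25 r).  They give m = rho + sigma - rho sigma
    ([mult_eq]) and, with k^2 rho^4 + k'^2 sigma^4 = 1, the modular equation
    ([modular_equation]).

    Conclusion.  The parametrisation by L solves that equation by Cardano's
    formula ([parametrisation]), and for given x its root is unique
    ([modular_injective]); so w = x rho is the geometric mean of k and l, and
    w' that of k' and l'.  Then a_r = m^3 / (rho sigma^4), and the rational
    function of the theorem equals 1 / (rho sigma^4) modulo the modular
    equation. *)

(** * Unconditional sums *)

Definition lsum {T : Type} (f : T -> R) (l : list T) : R :=
  fold_right (fun a s => f a + s) 0 l.

(** Convergence along the finite subsets ordered by inclusion; lists without
    repetition stand for the subsets. *)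
Definition has_sum {T : Type} (f : T -> R) (s : R) : Prop :=
  forall eps, 0 < eps -> exists l0, forall l, NoDup l -> incl l0 l ->
    Rabs (lsum f l - s) < eps.

Definition eq_dec_cl {T : Type} (a b : T) : {a = b} + {a <> b} :=
  excluded_middle_informative (a = b).

Definition lundup {T : Type} (l : list T) : list T := nodup eq_dec_cl l.

Lemma lundup_NoDup {T} (l : list T) : NoDup (lundup l).
Proof. apply NoDup_nodup. Qed.

Lemma lundup_incl {T} (l : list T) : incl l (lundup l).
Proof. intros a Ha. apply nodup_In. exact Ha. Qed.

Lemma lsum_app {T} (f : T -> R) l1 l2 :
  lsum f (l1 ++ l2) = lsum f l1 + lsum f l2.
Proof. induction l1 as [|a l1 IH]; simpl; [ring|rewrite IH; ring]. Qed.

Lemma lsum_perm {T} (f : T -> R) l1 l2 :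
  Permutation l1 l2 -> lsum f l1 = lsum f l2.
Proof. induction 1; simpl; lra. Qed.

Lemma lsum_map {S T} (e : S -> T) (f : T -> R) l :
  lsum f (map e l) = lsum (fun a => f (e a)) l.
Proof. induction l as [|a l IH]; simpl; [reflexivity|rewrite IH; reflexivity]. Qed.

Lemma lsum_ext {T} (f g : T -> R) l :
  (forall a, f a = g a) -> lsum f l = lsum g l.
Proof. intros H; induction l as [|a l IH]; simpl; [reflexivity|rewrite IH, H; reflexivity]. Qed.

Lemma lsum_plus {T} (f g : T -> R) l :
  lsum (fun a => f a + g a) l = lsum f l + lsum g l.
Proof. induction l as [|a l IH]; simpl; [ring|rewrite IH; ring]. Qed.

Lemma lsum_scal {T} c (f : T -> R) l :
  lsum (fun a => c * f a) l = c * lsum f l.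
Proof. induction l as [|a l IH]; simpl; [ring|rewrite IH; ring]. Qed.

Lemma lsum_le {T} (f g : T -> R) l :
  (forall a, f a <= g a) -> lsum f l <= lsum g l.
Proof. intros H; induction l as [|a l IH]; simpl; [lra|specialize (H a); lra]. Qed.

Lemma lsum_ge0 {T} (f : T -> R) l : (forall a, 0 <= f a) -> 0 <= lsum f l.
Proof. intros H; induction l as [|a l IH]; simpl; [lra|specialize (H a); lra]. Qed.

Lemma lsum_Rabs {T} (f : T -> R) l :
  Rabs (lsum f l) <= lsum (fun a => Rabs (f a)) l.
Proof.
  induction l as [|a l IH]; simpl; [rewrite Rabs_R0; lra|].
  eapply Rle_trans; [apply Rabs_triang|lra].
Qed.

Lemma NoDup_incl_split {T} (l l' : list T) :
  NoDup l -> incl l l' -> exists r, Permutation l' (l ++ r).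
Proof.
  revert l'; induction l as [|a l IH]; intros l' Hn Hi.
  - exists l'; reflexivity.
  - inversion Hn as [|? ? Ha Hl]; subst.
    destruct (in_split a l') as [l1 [l2 E]]; [apply Hi; left; reflexivity|subst].
    destruct (IH (l1 ++ l2)) as [r Hr]; [exact Hl| |].
    + intros b Hb. assert (Hb' : In b (l1 ++ a :: l2)) by (apply Hi; right; exact Hb).
      apply in_app_or in Hb'. apply in_or_app.
      destruct Hb' as [Hb'|[Hb'|Hb']]; [left; exact Hb'| |right; exact Hb'].
      subst; contradiction.
    + exists r. simpl. rewrite <- Hr. symmetry. apply Permutation_middle.
Qed.

Lemma lsum_incl {T} (f : T -> R) l l' :
  (forall a, 0 <= f a) -> NoDup l -> incl l l' -> lsum f l <= lsum f l'.
Proof.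
  intros Hf Hn Hi. destruct (NoDup_incl_split l l' Hn Hi) as [r Hr].
  rewrite (lsum_perm f _ _ Hr), lsum_app.
  assert (H := lsum_ge0 f r Hf); lra.
Qed.

Lemma has_sum_unique {T} (f : T -> R) s t : has_sum f s -> has_sum f t -> s = t.
Proof.
  intros Hs Ht. apply Rminus_diag_uniq.
  destruct (Req_dec (s - t) 0) as [E|E]; [exact E|exfalso].
  assert (He : 0 < Rabs (s - t) / 2) by (assert (H := Rabs_pos_lt _ E); lra).
  destruct (Hs _ He) as [l0 H0]. destruct (Ht _ He) as [l1 H1].
  set (l := lundup (l0 ++ l1)).
  specialize (H0 l (lundup_NoDup _)). specialize (H1 l (lundup_NoDup _)).
  assert (Hi : incl (l0 ++ l1) l) by apply lundup_incl.
  specialize (H0 (fun a Ha => Hi a (in_or_app _ _ _ (or_introl Ha)))).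
  specialize (H1 (fun a Ha => Hi a (in_or_app _ _ _ (or_intror Ha)))).
  assert (Rabs (s - t) <= Rabs (lsum f l - t) + Rabs (lsum f l - s)).
  { replace (s - t) with ((lsum f l - t) + - (lsum f l - s)) by ring.
    eapply Rle_trans; [apply Rabs_triang|]. rewrite Rabs_Ropp. lra. }
  lra.
Qed.

Lemma has_sum_ext {T} (f g : T -> R) s :
  (forall a, f a = g a) -> has_sum f s -> has_sum g s.
Proof.
  intros E H eps He. destruct (H eps He) as [l0 H0]. exists l0. intros l Hn Hi.
  rewrite <- (lsum_ext f g l E). apply H0; assumption.
Qed.

Lemma has_sum_plus {T} (f g : T -> R) s t :
  has_sum f s -> has_sum g t -> has_sum (fun a => f a + g a) (s + t).
Proof.
  intros Hs Ht eps He.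
  destruct (Hs (eps / 2)) as [l0 H0]; [lra|]. destruct (Ht (eps / 2)) as [l1 H1]; [lra|].
  exists (l0 ++ l1). intros l Hn Hi. rewrite lsum_plus.
  specialize (H0 l Hn (fun a Ha => Hi a (in_or_app _ _ _ (or_introl Ha)))).
  specialize (H1 l Hn (fun a Ha => Hi a (in_or_app _ _ _ (or_intror Ha)))).
  replace (lsum f l + lsum g l - (s + t)) with ((lsum f l - s) + (lsum g l - t)) by ring.
  eapply Rle_lt_trans; [apply Rabs_triang|lra].
Qed.

Lemma has_sum_scal {T} c (f : T -> R) s :
  has_sum f s -> has_sum (fun a => c * f a) (c * s).
Proof.
  intros Hs eps He.
  assert (Hc : 0 < Rabs c + 1) by (assert (H := Rabs_pos c); lra).
  destruct (Hs (eps / (Rabs c + 1))) as [l0 H0]; [apply Rdiv_lt_0_compat; lra|].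
  exists l0. intros l Hn Hi. rewrite lsum_scal, <- Rmult_minus_distr_l, Rabs_mult.
  specialize (H0 l Hn Hi).
  apply Rle_lt_trans with ((Rabs c + 1) * Rabs (lsum f l - s)).
  - assert (H := Rabs_pos (lsum f l - s)). nra.
  - replace eps with ((Rabs c + 1) * (eps / (Rabs c + 1))) by (field; lra).
    apply Rmult_lt_compat_l; assumption.
Qed.

Lemma has_sum_opp {T} (f : T -> R) s :
  has_sum f s -> has_sum (fun a => - f a) (- s).
Proof.
  intros H. replace (- s) with ((-1) * s) by ring.
  apply has_sum_ext with (fun a => (-1) * f a); [intros a; ring|].
  apply has_sum_scal; exact H.
Qed.

Lemma has_sum_minus {T} (f g : T -> R) s t :
  has_sum f s -> has_sum g t -> has_sum (fun a => f a - g a) (s - t).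
Proof. intros Hs Ht. apply has_sum_plus; [exact Hs|apply has_sum_opp; exact Ht]. Qed.

Lemma has_sum_nonneg_bounded {T} (f : T -> R) M :
  (forall a, 0 <= f a) -> (forall l, NoDup l -> lsum f l <= M) ->
  exists s, has_sum f s.
Proof.
  intros Hf HM.
  destruct (completeness (fun v => exists l, NoDup l /\ v = lsum f l)) as [s [Hub Hlub]].
  - exists M. intros v [l [Hn ->]]. apply HM, Hn.
  - exists 0, nil. split; [constructor|reflexivity].
  - exists s. intros eps He.
    destruct (classic (exists l, NoDup l /\ s - eps < lsum f l)) as [[l0 [Hn0 H0]]|Hno].
    + exists l0. intros l Hn Hi.
      assert (lsum f l0 <= lsum f l) by (apply lsum_incl; assumption).
      assert (lsum f l <= s) by (apply Hub; exists l; auto).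
      apply Rabs_def1; lra.
    + exfalso. assert (s <= s - eps); [|lra].
      apply Hlub. intros v [l [Hn ->]].
      destruct (Rle_dec (lsum f l) (s - eps)) as [H|H]; [exact H|].
      exfalso; apply Hno; exists l; split; [exact Hn|lra].
Qed.

Lemma has_sum_ge_lsum {T} (f : T -> R) s l :
  (forall a, 0 <= f a) -> has_sum f s -> NoDup l -> lsum f l <= s.
Proof.
  intros Hf Hs Hn. apply Rnot_lt_le. intros Hlt.
  destruct (Hs (lsum f l - s)) as [l0 H0]; [lra|].
  specialize (H0 (lundup (l ++ l0)) (lundup_NoDup _)).
  assert (Hi : incl (l ++ l0) (lundup (l ++ l0))) by apply lundup_incl.
  specialize (H0 (fun a Ha => Hi a (in_or_app _ _ _ (or_intror Ha)))).
  assert (lsum f l <= lsum f (lundup (l ++ l0))).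
  { apply lsum_incl; [assumption|assumption|].
    intros a Ha. apply Hi, in_or_app. left; exact Ha. }
  apply Rabs_def2 in H0. lra.
Qed.

Lemma has_sum_dominated {T} (f g : T -> R) G :
  (forall a, Rabs (f a) <= g a) -> has_sum g G -> exists s, has_sum f s.
Proof.
  intros Hfg HG.
  assert (Hg : forall a, 0 <= g a) by (intros a; eapply Rle_trans; [apply Rabs_pos|apply Hfg]).
  assert (Hb : forall l, NoDup l -> lsum g l <= G)
    by (intros l Hl; apply has_sum_ge_lsum; assumption).
  destruct (has_sum_nonneg_bounded (fun a => f a + g a) (2 * G)) as [s Hs].
  - intros a. specialize (Hfg a). apply Rabs_le_between in Hfg. lra.
  - intros l Hl. rewrite lsum_plus. specialize (Hb l Hl).
    assert (lsum f l <= lsum g l); [|lra].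
    apply lsum_le. intros a. eapply Rle_trans; [apply Rle_abs|apply Hfg].
  - exists (s - G). apply has_sum_ext with (fun a => (f a + g a) - g a); [intros; ring|].
    apply has_sum_minus; assumption.
Qed.

Lemma lsum_filter {T} (p : T -> bool) (f : T -> R) l :
  lsum f l = lsum f (filter p l) + lsum f (filter (fun a => negb (p a)) l).
Proof.
  induction l as [|a l IH]; simpl; [ring|].
  destruct (p a); simpl; lra.
Qed.

(** Outside a finite set all finite sums are small, in particular those of the
    positive and of the negative terms separately. *)
Lemma has_sum_abs {T} (f : T -> R) s :
  has_sum f s -> exists S, has_sum (fun a => Rabs (f a)) S.
Proof.
  intros Hs. destruct (Hs 1) as [l0' H0']; [lra|].
  set (l0 := lundup l0').
  assert (Hn0 : NoDup l0) by apply lundup_NoDup.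
  assert (H0 : forall l, NoDup l -> incl l0 l -> Rabs (lsum f l - s) < 1).
  { intros l Hn Hi. apply H0'; [exact Hn|]. intros a Ha. apply Hi, lundup_incl, Ha. }
  assert (Hd : forall l, NoDup l -> (forall a, In a l -> ~ In a l0) -> Rabs (lsum f l) < 2).
  { intros l Hn Hdis.
    assert (H1 : Rabs (lsum f (l0 ++ l) - s) < 1).
    { apply H0; [|intros a Ha; apply in_or_app; left; exact Ha].
      apply NoDup_app; [exact Hn0|exact Hn|]. intros a Ha Hb. exact (Hdis a Hb Ha). }
    assert (H2 : Rabs (lsum f l0 - s) < 1) by (apply H0; [exact Hn0|intros a Ha; exact Ha]).
    rewrite lsum_app in H1. apply Rabs_def2 in H1. apply Rabs_def2 in H2.
    apply Rabs_def1; lra. }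
  set (pos := fun a => if Rle_dec 0 (f a) then true else false).
  assert (Hd2 : forall l, NoDup l -> (forall a, In a l -> ~ In a l0) ->
                lsum (fun a => Rabs (f a)) l <= 4).
  { intros l Hn Hdis. rewrite (lsum_filter pos).
    assert (E1 : lsum (fun a => Rabs (f a)) (filter pos l) = lsum f (filter pos l)).
    { clear. induction l as [|a l IH]; simpl; [reflexivity|].
      destruct (pos a) eqn:Ea; [|exact IH]. unfold pos in Ea.
      destruct (Rle_dec 0 (f a)); [|discriminate].
      simpl. rewrite IH, Rabs_right; lra. }
    assert (E2 : lsum (fun a => Rabs (f a)) (filter (fun a => negb (pos a)) l)
                 = - lsum f (filter (fun a => negb (pos a)) l)).
    { clear. induction l as [|a l IH]; simpl; [ring|].
      destruct (pos a) eqn:Ea; simpl; [exact IH|]. unfold pos in Ea.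
      destruct (Rle_dec 0 (f a)); [discriminate|].
      rewrite IH, Rabs_left; lra. }
    assert (B1 : Rabs (lsum f (filter pos l)) < 2).
    { apply Hd; [apply NoDup_filter, Hn|].
      intros a Ha. apply filter_In in Ha. apply Hdis, Ha. }
    assert (B2 : Rabs (lsum f (filter (fun a => negb (pos a)) l)) < 2).
    { apply Hd; [apply NoDup_filter, Hn|].
      intros a Ha. apply filter_In in Ha. apply Hdis, Ha. }
    apply Rabs_def2 in B1. apply Rabs_def2 in B2. lra. }
  apply has_sum_nonneg_bounded with (lsum (fun a => Rabs (f a)) l0 + 4);
    [intros; apply Rabs_pos|].
  intros l Hn.
  set (inb := fun a => if excluded_middle_informative (In a l0) then true else false).
  rewrite (lsum_filter inb). apply Rplus_le_compat.
  - apply lsum_incl; [intros; apply Rabs_pos|apply NoDup_filter, Hn|].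
    intros a Ha. apply filter_In in Ha. destruct Ha as [_ Ha]. unfold inb in Ha.
    destruct (excluded_middle_informative (In a l0)); [assumption|discriminate].
  - apply Hd2; [apply NoDup_filter, Hn|].
    intros a Ha. apply filter_In in Ha. destruct Ha as [_ Ha]. unfold inb in Ha.
    destruct (excluded_middle_informative (In a l0)); [discriminate|assumption].
Qed.

Lemma has_sum_zero {T} : has_sum (fun _ : T => 0) 0.
Proof.
  intros eps He. exists nil. intros l _ _.
  replace (lsum (fun _ : T => 0) l) with 0; [rewrite Rminus_0_r, Rabs_R0; exact He|].
  induction l as [|a l IH]; simpl; lra.
Qed.

Lemma has_sum_reindex {A B} (e : A -> B) (f : B -> R) s :
  (forall a a', e a = e a' -> a = a') -> (forall b, exists a, e a = b) ->
  has_sum (fun a => f (e a)) s -> has_sum f s.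
Proof.
  intros Hinj Hsur Hs eps He. destruct (Hs eps He) as [l0 H0].
  destruct (classic (inhabited A)) as [HA|HA].
  - set (d := fun b => epsilon HA (fun a => e a = b)).
    assert (Hd : forall b, e (d b) = b) by (intros b; apply (epsilon_spec HA), Hsur).
    exists (map e l0). intros l Hn Hi.
    assert (E : l = map e (map d l)).
    { rewrite map_map, <- (map_id l) at 1. apply map_ext. intros b; symmetry; apply Hd. }
    rewrite E, lsum_map. apply H0.
    + apply (NoDup_map_inv e). rewrite <- E. exact Hn.
    + intros a Ha. assert (Hb : In (e a) l) by (apply Hi, in_map, Ha).
      rewrite (Hinj a (d (e a))); [apply in_map; exact Hb|symmetry; apply Hd].
  - exists nil. intros l Hn Hi. destruct l as [|b l].
    + specialize (H0 nil (NoDup_nil _)). simpl in *. apply H0.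
      intros a. exfalso; apply HA; constructor; exact a.
    + exfalso. destruct (Hsur b) as [a _]. apply HA; constructor; exact a.
Qed.

Lemma has_sum_reindex_inv {A B} (e : A -> B) (f : B -> R) s :
  (forall a a', e a = e a' -> a = a') -> (forall b, exists a, e a = b) ->
  has_sum f s -> has_sum (fun a => f (e a)) s.
Proof.
  intros Hinj Hsur Hs.
  set (d := fun b => proj1_sig (constructive_indefinite_description _ (Hsur b))).
  assert (Hd : forall b, e (d b) = b).
  { intros b. unfold d. destruct (constructive_indefinite_description _ (Hsur b)); assumption. }
  apply (has_sum_reindex d).
  - intros b b' H. rewrite <- (Hd b), <- (Hd b'), H. reflexivity.
  - intros a. exists (e a). apply Hinj, Hd.
  - apply has_sum_ext with f; [|exact Hs]. intros b. rewrite Hd. reflexivity.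
Qed.

Fixpoint lefts {A B} (l : list (A + B)) : list A :=
  match l with
  | nil => nil
  | inl a :: l => a :: lefts l
  | inr _ :: l => lefts l
  end.

Fixpoint rights {A B} (l : list (A + B)) : list B :=
  match l with
  | nil => nil
  | inl _ :: l => rights l
  | inr b :: l => b :: rights l
  end.

Lemma in_lefts {A B} (l : list (A + B)) a : In a (lefts l) <-> In (inl a) l.
Proof.
  induction l as [|[x|x] l IH]; simpl; [tauto| |].
  - rewrite IH. split; intros [H|H]; auto; [left; congruence|left; congruence].
  - rewrite IH. split; intros H; [auto|destruct H; [discriminate|auto]].
Qed.

Lemma in_rights {A B} (l : list (A + B)) b : In b (rights l) <-> In (inr b) l.
Proof.
  induction l as [|[x|x] l IH]; simpl; [tauto| |].
  - rewrite IH. split; intros H; [auto|destruct H; [discriminate|auto]].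
  - rewrite IH. split; intros [H|H]; auto; [left; congruence|left; congruence].
Qed.

Lemma NoDup_lefts_rights {A B} (l : list (A + B)) :
  NoDup l -> NoDup (lefts l) /\ NoDup (rights l).
Proof.
  induction 1 as [|[x|x] l Hx Hn [IH1 IH2]]; simpl; [split; constructor| |];
    (split; [|]); try assumption; constructor; try assumption.
  - rewrite in_lefts; exact Hx.
  - rewrite in_rights; exact Hx.
Qed.

Lemma lsum_lefts_rights {A B} (f : A + B -> R) l :
  lsum f l = lsum (fun a => f (inl a)) (lefts l) + lsum (fun b => f (inr b)) (rights l).
Proof. induction l as [|[x|x] l IH]; simpl; lra. Qed.

Lemma has_sum_disjoint {A B} (f : A + B -> R) s t :
  has_sum (fun a => f (inl a)) s -> has_sum (fun b => f (inr b)) t -> has_sum f (s + t).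
Proof.
  intros Hs Ht eps He.
  destruct (Hs (eps / 2)) as [l0 H0]; [lra|]. destruct (Ht (eps / 2)) as [l1 H1]; [lra|].
  exists (map inl l0 ++ map inr l1). intros l Hn Hi.
  rewrite lsum_lefts_rights. destruct (NoDup_lefts_rights l Hn) as [N1 N2].
  assert (I1 : incl l0 (lefts l)).
  { intros a Ha. apply in_lefts, Hi, in_or_app. left. apply in_map, Ha. }
  assert (I2 : incl l1 (rights l)).
  { intros a Ha. apply in_rights, Hi, in_or_app. right. apply in_map, Ha. }
  specialize (H0 _ N1 I1). specialize (H1 _ N2 I2).
  apply Rabs_def2 in H0. apply Rabs_def2 in H1. apply Rabs_def1; lra.
Qed.

Lemma NoDup_list_prod {A B} (l : list A) (l' : list B) :
  NoDup l -> NoDup l' -> NoDup (list_prod l l').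
Proof.
  intros Hl Hl'. induction Hl as [|a l Ha Hl IH]; simpl; [constructor|].
  apply NoDup_app; [|exact IH|].
  - apply FinFun.Injective_map_NoDup; [|exact Hl']. intros x y H. congruence.
  - intros [x y] H1 H2. apply in_map_iff in H1. destruct H1 as [z [E _]].
    injection E as -> ->. apply in_prod_iff in H2. tauto.
Qed.

Lemma lsum_prod {A B} (f : A -> R) (g : B -> R) l l' :
  lsum (fun p => f (fst p) * g (snd p)) (list_prod l l') = lsum f l * lsum g l'.
Proof.
  induction l as [|a l IH]; simpl; [ring|].
  rewrite lsum_app, IH, lsum_map. simpl. rewrite lsum_scal. ring.
Qed.

Lemma has_sum_prod {A B} (f : A -> R) (g : B -> R) s t :
  has_sum f s -> has_sum g t ->
  has_sum (fun p => f (fst p) * g (snd p)) (s * t).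
Proof.
  intros Hs Ht.
  destruct (has_sum_abs f s Hs) as [S HS]. destruct (has_sum_abs g t Ht) as [T HT].
  assert (HS0 : forall l, NoDup l -> lsum (fun a => Rabs (f a)) l <= S)
    by (intros l Hl; apply has_sum_ge_lsum; [intros; apply Rabs_pos|exact HS|exact Hl]).
  assert (HT0 : forall l, NoDup l -> lsum (fun a => Rabs (g a)) l <= T)
    by (intros l Hl; apply has_sum_ge_lsum; [intros; apply Rabs_pos|exact HT|exact Hl]).
  destruct (has_sum_nonneg_bounded
    (fun p : A * B => Rabs (f (fst p)) * Rabs (g (snd p))) (S * T)) as [U HU].
  - intros p. apply Rmult_le_pos; apply Rabs_pos.
  - intros l Hl.
    apply Rle_trans with (lsum (fun p : A * B => Rabs (f (fst p)) * Rabs (g (snd p)))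
      (list_prod (lundup (map fst l)) (lundup (map snd l)))).
    + apply lsum_incl; [intros; apply Rmult_le_pos; apply Rabs_pos|exact Hl|].
      intros [a b] H. apply in_prod; apply lundup_incl.
      * apply (in_map fst _ _ H).
      * apply (in_map snd _ _ H).
    + rewrite (lsum_prod (fun a => Rabs (f a)) (fun b => Rabs (g b))).
      apply Rmult_le_compat; try (apply lsum_ge0; intros; apply Rabs_pos).
      * apply HS0, lundup_NoDup.
      * apply HT0, lundup_NoDup.
  - destruct (has_sum_dominated (fun p : A * B => f (fst p) * g (snd p))
      (fun p : A * B => Rabs (f (fst p)) * Rabs (g (snd p))) U) as [u Hu]; [|exact HU|].
    + intros p. simpl. rewrite Rabs_mult. lra.
    + replace (s * t) with u; [exact Hu|].
      apply Rminus_diag_uniq. destruct (Req_dec (u - s * t) 0) as [E|E]; [exact E|exfalso].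
      assert (Hpos := Rabs_pos_lt _ E).
      set (K := Rabs s + Rabs t + 2).
      assert (HK : 0 < K) by (unfold K; assert (h1 := Rabs_pos s); assert (h2 := Rabs_pos t); lra).
      set (eps := Rmin 1 (Rabs (u - s * t) / K)).
      assert (He : 0 < eps).
      { unfold eps. apply Rmin_glb_lt; [lra|]. apply Rdiv_lt_0_compat; assumption. }
      destruct (Hs eps He) as [l0 H0]. destruct (Ht eps He) as [l1 H1].
      destruct (Hu eps He) as [l2 H2].
      (* rectangles are cofinal among the finite sets of pairs *)
      set (la := lundup (l0 ++ map fst l2)). set (lb := lundup (l1 ++ map snd l2)).
      assert (B0 : Rabs (lsum f la - s) < eps).
      { apply H0; [apply lundup_NoDup|]. intros a Ha. apply lundup_incl, in_or_app; auto. }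
      assert (B1 : Rabs (lsum g lb - t) < eps).
      { apply H1; [apply lundup_NoDup|]. intros a Ha. apply lundup_incl, in_or_app; auto. }
      assert (B2 : Rabs (lsum f la * lsum g lb - u) < eps).
      { rewrite <- lsum_prod. apply H2; [apply NoDup_list_prod; apply lundup_NoDup|].
        intros [a b] H. apply in_prod; apply lundup_incl, in_or_app; right.
        - apply (in_map fst _ _ H).
        - apply (in_map snd _ _ H). }
      set (x := lsum f la - s) in *. set (y := lsum g lb - t) in *.
      assert (E1 : u - s * t = - (lsum f la * lsum g lb - u) + (x * y + x * t + s * y))
        by (unfold x, y; ring).
      assert (Hb : Rabs (u - s * t) < K * eps).
      { rewrite E1. eapply Rle_lt_trans; [apply Rabs_triang|]. rewrite Rabs_Ropp.
        assert (Rabs (x * y + x * t + s * y) <= eps * 1 + eps * Rabs t + Rabs s * eps).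
        { eapply Rle_trans; [apply Rabs_triang|]. apply Rplus_le_compat.
          - eapply Rle_trans; [apply Rabs_triang|]. rewrite !Rabs_mult.
            assert (eps <= 1) by apply Rmin_l.
            assert (h1 := Rabs_pos x). assert (h2 := Rabs_pos y). assert (h3 := Rabs_pos t).
            apply Rplus_le_compat; [|nra]. apply Rmult_le_compat; lra.
          - rewrite Rabs_mult. assert (h1 := Rabs_pos s). nra. }
        unfold K. lra. }
      assert (K * eps <= Rabs (u - s * t)).
      { replace (Rabs (u - s * t)) with (K * (Rabs (u - s * t) / K)) by (field; lra).
        apply Rmult_le_compat_l; [lra|apply Rmin_r]. }
      lra.
Qed.

Definition tsum {T : Type} (f : T -> R) : R := epsilon (inhabits 0) (has_sum f).

Lemma tsum_has_sum {T} (f : T -> R) : (exists s, has_sum f s) -> has_sum f (tsum f).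
Proof. intros H. unfold tsum. apply epsilon_spec, H. Qed.

Lemma tsum_eq {T} (f : T -> R) s : has_sum f s -> tsum f = s.
Proof.
  intros H. apply (has_sum_unique f); [|exact H].
  apply tsum_has_sum. exists s; exact H.
Qed.

(** Enlarging the finite set moves the partial sum of h by at most as much as
    that of its majorant. *)
Lemma has_sum_tail {T} (h g : T -> R) v G l :
  (forall a, Rabs (h a) <= g a) -> has_sum h v -> has_sum g G -> NoDup l ->
  Rabs (v - lsum h l) <= G - lsum g l.
Proof.
  intros Hhg Hv HG Hl. apply Rnot_lt_le. intros Hlt.
  set (d := Rabs (v - lsum h l) - (G - lsum g l)) in *.
  destruct (Hv (d / 2)) as [l0 H0]; [unfold d; lra|].
  destruct (HG (d / 2)) as [l1 H1]; [unfold d; lra|].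
  set (m := lundup (l ++ l0 ++ l1)).
  assert (Hm : incl (l ++ l0 ++ l1) m) by apply lundup_incl.
  assert (Nm : NoDup m) by apply lundup_NoDup.
  assert (B0 : Rabs (lsum h m - v) < d / 2).
  { apply H0; [exact Nm|]. intros a Ha. apply Hm, in_or_app; right; apply in_or_app; auto. }
  assert (B1 : Rabs (lsum g m - G) < d / 2).
  { apply H1; [exact Nm|]. intros a Ha. apply Hm, in_or_app; right; apply in_or_app; auto. }
  destruct (NoDup_incl_split l m Hl) as [r Hr].
  { intros a Ha. apply Hm, in_or_app; auto. }
  rewrite (lsum_perm h _ _ Hr), lsum_app in B0. rewrite (lsum_perm g _ _ Hr), lsum_app in B1.
  assert (B2 : Rabs (lsum h r) <= lsum g r).
  { eapply Rle_trans; [apply lsum_Rabs|apply lsum_le, Hhg]. }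
  assert (Rabs (v - lsum h l) <= d / 2 + Rabs (lsum h r)).
  { replace (v - lsum h l) with (- (lsum h l + lsum h r - v) + lsum h r) by ring.
    eapply Rle_trans; [apply Rabs_triang|]. rewrite Rabs_Ropp. lra. }
  apply Rabs_def2 in B1. unfold d in *. lra.
Qed.

Lemma is_lim_seq_lsum {T} (f : nat -> T -> R) (g : T -> R) l :
  (forall a, is_lim_seq (fun n => f n a) (g a)) ->
  is_lim_seq (fun n => lsum (f n) l) (lsum g l).
Proof.
  intros H. induction l as [|a l IH]; simpl; [apply is_lim_seq_const|].
  apply (is_lim_seq_plus' (fun n => f n a) (fun n => lsum (f n) l)); auto.
Qed.

(** Dominated convergence for sums (Tannery's theorem). *)
Lemma has_sum_tannery {T} (f : nat -> T -> R) (f0 g : T -> R) (s : nat -> R) s0 G :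
  (forall n a, Rabs (f n a) <= g a) -> has_sum g G ->
  (forall a, is_lim_seq (fun n => f n a) (f0 a)) ->
  (forall n, has_sum (f n) (s n)) -> has_sum f0 s0 -> is_lim_seq s s0.
Proof.
  intros Hb HG Hl Hs Hs0.
  assert (Hb0 : forall a, Rabs (f0 a) <= g a).
  { intros a. apply (is_lim_seq_le (fun n => Rabs (f n a)) (fun _ => g a)
      (Rabs (f0 a)) (g a)); [intros; apply Hb| |apply is_lim_seq_const].
    apply (is_lim_seq_abs _ (f0 a)), Hl. }
  apply is_lim_seq_spec. intros [eps He]. simpl.
  destruct (HG (eps / 3)) as [l0 H0]; [lra|].
  assert (H1 := H0 (lundup l0) (lundup_NoDup _) (lundup_incl _)).
  set (l := lundup l0) in *. assert (Nl : NoDup l) by apply lundup_NoDup.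
  assert (Hll := is_lim_seq_lsum f f0 l Hl).
  apply is_lim_seq_spec in Hll. destruct (Hll (mkposreal (eps / 3) ltac:(lra))) as [N HN].
  exists N. intros n Hn. specialize (HN n Hn). simpl in HN.
  assert (T1 := has_sum_tail (f n) g (s n) G l (Hb n) (Hs n) HG Nl).
  assert (T2 := has_sum_tail f0 g s0 G l Hb0 Hs0 HG Nl).
  apply Rabs_def2 in H1.
  replace (s n - s0) with ((s n - lsum (f n) l) + (lsum (f n) l - lsum f0 l) - (s0 - lsum f0 l)) by ring.
  apply Rabs_le_between in T1. apply Rabs_le_between in T2. apply Rabs_def2 in HN.
  apply Rabs_def1; lra.
Qed.

Lemma has_sum_exhaust {T} (f : T -> R) s (l : nat -> list T) :
  has_sum f s -> (forall n, NoDup (l n)) ->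
  (forall a, exists N, forall n, (N <= n)%nat -> In a (l n)) ->
  is_lim_seq (fun n => lsum f (l n)) s.
Proof.
  intros Hs Hn Hex. apply is_lim_seq_spec. intros [eps He]. simpl.
  destruct (Hs eps He) as [l0 H0].
  assert (HN : exists N, forall n, (N <= n)%nat -> incl l0 (l n)).
  { clear H0. induction l0 as [|a l0 [N IH]]; [exists O; intros n _ a Ha; destruct Ha|].
    destruct (Hex a) as [M HM]. exists (Nat.max N M). intros n Hn' b [<-|Hb].
    - apply HM; lia.
    - apply IH; [lia|exact Hb]. }
  destruct HN as [N HN]. exists N. intros n Hn'. apply H0; [apply Hn|apply HN, Hn'].
Qed.

Lemma has_sum_geom r : 0 <= r < 1 -> exists s, has_sum (fun n : nat => r ^ n) s.
Proof.
  intros Hr. apply has_sum_nonneg_bounded with (/ (1 - r)).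
  - intros n. apply pow_le; lra.
  - intros l Hl. set (N := S (list_max l)).
    apply Rle_trans with (lsum (fun n : nat => r ^ n) (seq 0 N)).
    + apply lsum_incl; [intros; apply pow_le; lra|exact Hl|].
      intros n Hin. apply in_seq. split; [lia|]. unfold N.
      assert (H := proj1 (list_max_le l (list_max l)) (le_n _)).
      rewrite Forall_forall in H. specialize (H n Hin). lia.
    + assert (E : lsum (fun n : nat => r ^ n) (seq 0 N) * (1 - r) = 1 - r ^ N).
      { clearbody N. induction N as [|N IH]; [simpl; ring|].
        rewrite seq_S, lsum_app, Rmult_plus_distr_r, IH. simpl. ring. }
      assert (0 <= r ^ N) by (apply pow_le; lra).
      apply Rmult_le_reg_r with (1 - r); [lra|]. rewrite E, Rinv_l; lra.
Qed.

Definition zhalves (x : nat + nat) : Z :=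
  match x with
  | inl n => Z.of_nat n
  | inr n => (- Z.of_nat n - 1)%Z
  end.

Lemma zhalves_inj x x' : zhalves x = zhalves x' -> x = x'.
Proof. destruct x, x'; simpl; intros H; try lia; f_equal; lia. Qed.

Lemma zhalves_surj z : exists x, zhalves x = z.
Proof.
  destruct (Z_le_dec 0 z).
  - exists (inl (Z.to_nat z)). simpl. lia.
  - exists (inr (Z.to_nat (- z - 1))). simpl. lia.
Qed.

Lemma has_sum_halves (f : Z -> R) s t :
  has_sum (fun n => f (Z.of_nat n)) s -> has_sum (fun n => f (- Z.of_nat n - 1)%Z) t ->
  has_sum f (s + t).
Proof.
  intros Hs Ht. apply (has_sum_reindex zhalves); [apply zhalves_inj|apply zhalves_surj|].
  apply has_sum_disjoint; assumption.
Qed.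

Definition zrange (n : nat) : list Z :=
  map (fun i => (Z.of_nat i - Z.of_nat n)%Z) (seq 0 (2 * n + 1)).

Lemma in_zrange n z : In z (zrange n) <-> (- Z.of_nat n <= z <= Z.of_nat n)%Z.
Proof.
  unfold zrange. rewrite in_map_iff. split.
  - intros [i [<- Hi]]. apply in_seq in Hi. lia.
  - intros H. exists (Z.to_nat (z + Z.of_nat n)). split; [lia|]. apply in_seq. lia.
Qed.

Lemma zrange_NoDup n : NoDup (zrange n).
Proof.
  apply FinFun.Injective_map_NoDup; [|apply seq_NoDup]. intros a b H. lia.
Qed.

Lemma has_sum_zrange (f : Z -> R) s :
  has_sum f s -> is_lim_seq (fun n => lsum f (zrange n)) s.
Proof.
  intros H. apply has_sum_exhaust; [exact H|apply zrange_NoDup|].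
  intros z. exists (Z.abs_nat z). intros n Hn. apply in_zrange. lia.
Qed.

(** * Infinite products *)

(** The q-Pochhammer symbol (c; q)_n with q = exp (- y); with y as parameter
    the nome may be raised to real powers without roots. *)
Fixpoint fprod (c y : R) (n : nat) : R :=
  match n with
  | O => 1
  | S m => fprod c y m * (1 - c * exp (- y) ^ m)
  end.

Definition qprod (c y : R) : R := real (Lim_seq (fprod c y)).

Lemma exp_le x y : x <= y -> exp x <= exp y.
Proof. intros [H| ->]; [left; apply exp_increasing, H|right; reflexivity]. Qed.

Lemma exp_neg_bounds y : 0 < y -> 0 < exp (- y) < 1.
Proof.
  intros Hy. split; [apply exp_pos|]. rewrite <- exp_0. apply exp_increasing. lra.
Qed.

Lemma exp_pow a n : exp a ^ n = exp (INR n * a).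
Proof.
  induction n as [|n IH].
  - simpl. rewrite Rmult_0_l, exp_0. reflexivity.
  - rewrite S_INR. simpl pow. rewrite IH, <- exp_plus. f_equal. ring.
Qed.

Lemma pow_bounds x n : 0 < x < 1 -> 0 < x ^ n <= 1.
Proof.
  intros Hx. split; [apply pow_lt; lra|].
  rewrite <- (pow1 n). apply pow_incr. lra.
Qed.

Fixpoint geomsum (x : R) (n : nat) : R :=
  match n with O => 0 | S m => geomsum x m + x ^ m end.

Lemma geomsum_le x n : 0 < x < 1 -> 0 <= geomsum x n <= / (1 - x).
Proof.
  intros Hx.
  assert (E : geomsum x n * (1 - x) = 1 - x ^ n).
  { induction n as [|n IH]; simpl; [ring|]. rewrite Rmult_plus_distr_r, IH. ring. }
  assert (H := pow_bounds x n Hx). split.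
  - clear E H. induction n as [|n IH]; simpl; [lra|].
    assert (H := pow_bounds x n Hx). lra.
  - apply Rmult_le_reg_r with (1 - x); [lra|]. rewrite E, Rinv_l; lra.
Qed.

Lemma fprod_pos c y n : 0 < y -> c < 1 -> 0 < fprod c y n.
Proof.
  intros Hy Hc. induction n as [|n IH]; simpl; [lra|].
  apply Rmult_lt_0_compat; [exact IH|].
  assert (H := pow_bounds _ n (exp_neg_bounds y Hy)). nra.
Qed.

(** From 1 / (1 - c t) <= 1 + c t / (1 - c) <= exp (c t / (1 - c)); this keeps
    the infinite product away from 0. *)
Lemma fprod_lower c y n : 0 < y -> 0 <= c < 1 ->
  exp (- (c / (1 - c) * geomsum (exp (- y)) n)) <= fprod c y n.
Proof.
  intros Hy Hc. induction n as [|n IH]; simpl.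
  - rewrite Rmult_0_r, Ropp_0, exp_0. lra.
  - assert (H := pow_bounds _ n (exp_neg_bounds y Hy)).
    set (t := exp (- y) ^ n) in *.
    replace (- (c / (1 - c) * (geomsum (exp (- y)) n + t)))
      with (- (c / (1 - c) * geomsum (exp (- y)) n) + - (c * t / (1 - c))) by (field; lra).
    rewrite exp_plus. apply Rmult_le_compat; try (left; apply exp_pos); [exact IH|].
    rewrite exp_Ropp.
    assert (H1 : 1 + c * t / (1 - c) <= exp (c * t / (1 - c))).
    { apply exp_ineq1_le. }
    assert (H2 : 0 < 1 - c * t) by nra.
    assert (H3 : 1 <= (1 - c * t) * (1 + c * t / (1 - c))).
    { replace ((1 - c * t) * (1 + c * t / (1 - c)))
        with (1 + c * t * c * (1 - t) / (1 - c)) by (field; lra).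
      assert (0 <= c * t * c * (1 - t) / (1 - c)); [|lra].
      apply Rdiv_le_0_compat; [|lra]. assert (0 <= c * t) by nra.
      assert (0 <= c * t * c) by nra. nra. }
    assert (H4 := exp_pos (c * t / (1 - c))).
    apply Rmult_le_reg_l with (exp (c * t / (1 - c))); [exact H4|].
    rewrite Rinv_r by lra. nra.
Qed.

Lemma fprod_upper c y n : 0 < y -> c <= 0 ->
  fprod c y n <= exp (- c * geomsum (exp (- y)) n).
Proof.
  intros Hy Hc. induction n as [|n IH]; simpl.
  - rewrite Rmult_0_r, exp_0. lra.
  - assert (H := pow_bounds _ n (exp_neg_bounds y Hy)).
    rewrite Rmult_plus_distr_l, exp_plus. apply Rmult_le_compat.
    + left. apply fprod_pos; lra.
    + nra.
    + exact IH.
    + set (t := exp (- y) ^ n) in *.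
      apply Rle_trans with (1 + - c * t); [lra|apply exp_ineq1_le].
Qed.

Lemma qprod_lim_pos c y : 0 < y -> c < 1 ->
  is_lim_seq (fprod c y) (qprod c y) /\ 0 < qprod c y.
Proof.
  intros Hy Hc. assert (Hx := exp_neg_bounds y Hy).
  destruct (Rle_dec 0 c) as [H0|H0].
  - set (m := exp (- (c / (1 - c) * / (1 - exp (- y))))).
    assert (Hm : forall n, m <= fprod c y n).
    { intros n. eapply Rle_trans; [|apply fprod_lower; lra].
      apply exp_le. apply Ropp_le_contravar, Rmult_le_compat_l.
      - apply Rdiv_le_0_compat; lra.
      - apply geomsum_le, Hx. }
    assert (L : is_lim_seq (fprod c y) (qprod c y)).
    { apply Lim_seq_correct'. apply ex_finite_lim_seq_decr with m; [|exact Hm].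
      intros n. simpl. assert (H := pow_bounds _ n Hx).
      assert (H1 := fprod_pos c y n Hy Hc). assert (0 <= c * exp (- y) ^ n) by nra. nra. }
    split; [exact L|]. apply Rlt_le_trans with m; [apply exp_pos|].
    apply (is_lim_seq_le (fun _ => m) (fprod c y) m (qprod c y) Hm);
      [apply is_lim_seq_const|exact L].
  - assert (L : is_lim_seq (fprod c y) (qprod c y)).
    { apply Lim_seq_correct'.
      apply ex_finite_lim_seq_incr with (exp (- c * / (1 - exp (- y)))).
      - intros n. simpl. assert (H := pow_bounds _ n Hx).
        assert (H1 := fprod_pos c y n Hy Hc). assert (c * exp (- y) ^ n <= 0) by nra. nra.
      - intros n. eapply Rle_trans; [apply fprod_upper; lra|].
        apply exp_le. apply Rmult_le_compat_l; [lra|apply geomsum_le, Hx]. }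
    split; [exact L|]. apply Rlt_le_trans with 1; [lra|].
    apply (is_lim_seq_le (fun _ => 1) (fprod c y) 1 (qprod c y));
      [|apply is_lim_seq_const|exact L].
    intros n. induction n as [|n IH]; simpl; [lra|].
    assert (H := pow_bounds _ n Hx). assert (c * exp (- y) ^ n <= 0) by nra. nra.
Qed.

Lemma qprod_lim c y : 0 < y -> c < 1 -> is_lim_seq (fprod c y) (qprod c y).
Proof. intros; apply qprod_lim_pos; assumption. Qed.

Lemma qprod_pos c y : 0 < y -> c < 1 -> 0 < qprod c y.
Proof. intros; apply qprod_lim_pos; assumption. Qed.

Lemma qprod_eq c y l : is_lim_seq (fprod c y) (Finite l) -> qprod c y = l.
Proof. intros H. unfold qprod. rewrite (is_lim_seq_unique _ _ H). reflexivity. Qed.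

Lemma fprod_S c y n : fprod c y (S n) = (1 - c) * fprod (c * exp (- y)) y n.
Proof.
  induction n as [|n IH]; [simpl; ring|].
  change (fprod c y (S (S n))) with (fprod c y (S n) * (1 - c * exp (- y) ^ S n)).
  rewrite IH. simpl. ring.
Qed.

Lemma qprod_head c y : 0 < y -> c * exp (- y) < 1 ->
  qprod c y = (1 - c) * qprod (c * exp (- y)) y.
Proof.
  intros Hy Hc. apply qprod_eq, is_lim_seq_incr_1.
  apply is_lim_seq_ext with (fun n => (1 - c) * fprod (c * exp (- y)) y n).
  - intros n. symmetry. apply fprod_S.
  - apply (is_lim_seq_scal_l _ (1 - c) (qprod (c * exp (- y)) y)), qprod_lim; assumption.
Qed.

Lemma exp_mult_pow k y : exp (- (INR k * y)) = exp (- y) ^ k.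
Proof. rewrite exp_pow. f_equal. ring. Qed.

Lemma is_lim_seq_mul_index u (l : Rbar) k : (0 < k)%nat ->
  is_lim_seq u l -> is_lim_seq (fun n => u (k * n)%nat) l.
Proof.
  intros Hk H. apply (is_lim_seq_subseq u l (fun n => (k * n)%nat)); [|exact H].
  apply eventually_subseq. intros n. nia.
Qed.

Lemma is_lim_seq_eq u (a b : R) : is_lim_seq u a -> is_lim_seq u b -> a = b.
Proof.
  intros Ha Hb. apply is_lim_seq_unique in Ha. apply is_lim_seq_unique in Hb.
  rewrite Ha in Hb. injection Hb. auto.
Qed.

Lemma qprod_section2 c y : 0 < y -> c < 1 ->
  qprod c y = qprod c (2 * y) * qprod (c * exp (- y)) (2 * y).
Proof.
  intros Hy Hc. assert (Hx := exp_neg_bounds y Hy).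
  apply (is_lim_seq_eq (fun n => fprod c y (2 * n))).
  - apply is_lim_seq_mul_index; [lia|apply qprod_lim; assumption].
  - apply is_lim_seq_ext with (fun n => fprod c (2 * y) n * fprod (c * exp (- y)) (2 * y) n).
    + assert (E : exp (- (2 * y)) = exp (- y) ^ 2) by exact (exp_mult_pow 2 y).
      induction n as [|n IH]; [simpl; ring|].
      replace (2 * S n)%nat with (S (S (2 * n))) by lia. simpl fprod.
      simpl in IH. rewrite <- IH, E, <- !pow_mult. simpl. ring.
    + apply (is_lim_seq_mult' (fprod c (2 * y)) (fprod (c * exp (- y)) (2 * y)));
        apply qprod_lim; try lra; nra.
Qed.

Lemma mult_lt_1 c t : c < 1 -> 0 < t <= 1 -> c * t < 1.
Proof. intros; nra. Qed.

Lemma qprod_section5 c y : 0 < y -> c < 1 ->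
  qprod c y = qprod c (5 * y) * qprod (c * exp (- y)) (5 * y)
    * qprod (c * exp (- y) ^ 2) (5 * y) * qprod (c * exp (- y) ^ 3) (5 * y)
    * qprod (c * exp (- y) ^ 4) (5 * y).
Proof.
  intros Hy Hc. assert (Hx := exp_neg_bounds y Hy).
  assert (Hx2 := pow_bounds _ 2 Hx). assert (Hx3 := pow_bounds _ 3 Hx).
  assert (Hx4 := pow_bounds _ 4 Hx).
  apply (is_lim_seq_eq (fun n => fprod c y (5 * n))).
  - apply is_lim_seq_mul_index; [lia|apply qprod_lim; assumption].
  - apply is_lim_seq_ext with (fun n => fprod c (5 * y) n * fprod (c * exp (- y)) (5 * y) n
      * fprod (c * exp (- y) ^ 2) (5 * y) n * fprod (c * exp (- y) ^ 3) (5 * y) n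
      * fprod (c * exp (- y) ^ 4) (5 * y) n).
    + assert (E : exp (- (5 * y)) = exp (- y) ^ 5)
        by (rewrite <- exp_mult_pow; f_equal; simpl; ring).
      induction n as [|n IH]; [simpl; ring|].
      replace (5 * S n)%nat with (5 + 5 * n)%nat by lia. simpl fprod.
      simpl Nat.add. change (n + (n + (n + (n + (n + 0)))))%nat with (5 * n)%nat.
      rewrite <- IH, E, <- !pow_mult. simpl. ring.
    + do 4 (apply is_lim_seq_mult'; [|apply qprod_lim; [lra|apply mult_lt_1; lra]]).
      apply qprod_lim; lra.
Qed.

Lemma qprod_square c y : 0 < y -> -1 < c < 1 ->
  qprod c y * qprod (- c) y = qprod (c ^ 2) (2 * y).
Proof.
  intros Hy Hc. apply (is_lim_seq_eq (fun n => fprod c y n * fprod (- c) y n)).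
  - apply is_lim_seq_mult'; apply qprod_lim; lra.
  - apply is_lim_seq_ext with (fprod (c ^ 2) (2 * y)); [|apply qprod_lim; try lra; nra].
    assert (E : exp (- (2 * y)) = exp (- y) ^ 2) by exact (exp_mult_pow 2 y).
    induction n as [|n IH]; [simpl; ring|].
    cbn [fprod]. rewrite IH, E, <- !pow_mult.
    replace (exp (- y) ^ (2 * n)) with (exp (- y) ^ n * exp (- y) ^ n)
      by (rewrite <- pow_add; f_equal; lia). ring.
Qed.

(** * One-dimensional theta series *)

(** The trivial or the alternating character of Z, so that one family of theta
    series covers both f (a, b) and f (- a, - b) in Ramanujan's notation. *)
Definition sg (e : bool) (n : Z) : R := if (e && Z.odd n)%bool then -1 else 1.

Lemma sg_add e m n : sg e (m + n) = sg e m * sg e n.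
Proof.
  unfold sg. destruct e; simpl; [|ring]. rewrite Z.odd_add.
  destruct (Z.odd m), (Z.odd n); simpl; ring.
Qed.

Lemma sg_opp e n : sg e (- n) = sg e n.
Proof. unfold sg. rewrite Z.odd_opp. reflexivity. Qed.

Lemma sg_sq e n : sg e n * sg e n = 1.
Proof. unfold sg. destruct (e && Z.odd n)%bool; ring. Qed.

Lemma sg_double e n : sg e (2 * n) = 1.
Proof. unfold sg. rewrite Z.odd_mul. simpl. destruct e; reflexivity. Qed.

Lemma Rabs_sg e n : Rabs (sg e n) = 1.
Proof.
  unfold sg. destruct (e && Z.odd n)%bool.
  - rewrite Rabs_left; lra.
  - apply Rabs_R1.
Qed.

Definition gterm (e : bool) (A B : R) (n : Z) : R :=
  sg e n * exp (- (A * IZR n ^ 2 + B * IZR n)).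

Definition theta (e : bool) (A B : R) : R := tsum (gterm e A B).

(** Completing the square, A n^2 + B n >= |n| up to a constant. *)
Lemma gterm_summable e A B : 0 < A -> exists s, has_sum (gterm e A B) s.
Proof.
  intros HA.
  assert (H1 : 0 <= exp (-1) < 1).
  { assert (H := exp_neg_bounds 1 ltac:(lra)). replace (- (1)) with (-1) in H by ring. lra. }
  destruct (has_sum_geom _ H1) as [G HG].
  set (K := (Rabs B + 1) ^ 2 / (4 * A)).
  destruct (has_sum_dominated (gterm e A B)
    (fun n => exp K * exp (- IZR (Z.abs n))) (exp K * (G + exp (-1) * G))) as [s Hs];
    [| |exists s; exact Hs].
  - intros n. unfold gterm. rewrite Rabs_mult, Rabs_sg, Rmult_1_l, Rabs_pos_eq, <- exp_plus
      by (left; apply exp_pos).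
    apply exp_le. rewrite abs_IZR. set (z := IZR n).
    assert (h1 : - (B * z) <= Rabs B * Rabs z).
    { rewrite <- Rabs_mult, <- Rabs_Ropp. apply Rle_abs. }
    assert (h2 : z ^ 2 = Rabs z ^ 2) by (rewrite pow2_abs; reflexivity).
    set (b := Rabs B) in *. set (t := Rabs z) in *. rewrite h2.
    assert (h3 : 0 <= A * (t - (b + 1) / (2 * A)) ^ 2).
    { apply Rmult_le_pos; [lra|apply pow2_ge_0]. }
    replace (A * (t - (b + 1) / (2 * A)) ^ 2)
      with (A * t ^ 2 - (b + 1) * t + (b + 1) ^ 2 / (4 * A)) in h3 by (field; lra).
    fold K in h3. lra.
  - apply has_sum_scal. apply has_sum_halves.
    + apply has_sum_ext with (2 := HG). intros n. rewrite exp_pow. f_equal.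
      rewrite Z.abs_eq, <- INR_IZR_INZ by lia. ring.
    + apply has_sum_ext with (2 := has_sum_scal (exp (-1)) _ _ HG). intros n.
      rewrite exp_pow, <- exp_plus. f_equal.
      replace (Z.abs (- Z.of_nat n - 1)) with (Z.of_nat n + 1)%Z by lia.
      rewrite plus_IZR, <- INR_IZR_INZ. ring.
Qed.

Lemma theta_has_sum e A B : 0 < A -> has_sum (gterm e A B) (theta e A B).
Proof. intros HA. apply tsum_has_sum, gterm_summable, HA. Qed.

Lemma theta_opp e A B : 0 < A -> theta e A (- B) = theta e A B.
Proof.
  intros HA. apply tsum_eq. apply (has_sum_reindex Z.opp).
  - intros a b; lia.
  - intros b; exists (- b)%Z; lia.
  - apply has_sum_ext with (gterm e A B); [|apply theta_has_sum, HA].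
    intros n. unfold gterm. rewrite sg_opp, opp_IZR. f_equal. f_equal. ring.
Qed.

Lemma theta_shift e A B k : 0 < A ->
  theta e A (B + 2 * A * IZR k) = sg e k * exp (A * IZR k ^ 2 + B * IZR k) * theta e A B.
Proof.
  intros HA. apply tsum_eq.
  assert (H := theta_has_sum e A B HA).
  apply (has_sum_reindex_inv (fun n => n + k)%Z) in H;
    [|intros a b; lia|intros b; exists (b - k)%Z; lia].
  apply has_sum_ext with (2 := has_sum_scal (sg e k * exp (A * IZR k ^ 2 + B * IZR k)) _ _ H).
  intros n. unfold gterm. rewrite sg_add, plus_IZR.
  replace (sg e k * exp (A * IZR k ^ 2 + B * IZR k) * (sg e n * sg e k *
    exp (- (A * (IZR n + IZR k) ^ 2 + B * (IZR n + IZR k)))))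
    with (sg e k * sg e k * sg e n * (exp (A * IZR k ^ 2 + B * IZR k) *
    exp (- (A * (IZR n + IZR k) ^ 2 + B * (IZR n + IZR k))))) by ring.
  rewrite sg_sq, <- exp_plus, Rmult_1_l. f_equal. f_equal. ring.
Qed.

(** * The Jacobi triple product *)

Lemma has_sum_single {T} (f : T -> R) a :
  (forall b, b <> a -> f b = 0) -> has_sum f (f a).
Proof.
  intros Hf eps He. exists [a]. intros l Hn Hi.
  destruct (NoDup_incl_split [a] l) as [r Hr]; [constructor; [intros []|constructor]|exact Hi|].
  assert (Hnr : NoDup ([a] ++ r)) by (apply (Permutation_NoDup Hr), Hn).
  rewrite (lsum_perm f _ _ Hr). simpl.
  assert (E : lsum f r = 0).
  { simpl in Hnr. inversion Hnr as [|? ? Ha _]; subst. clear - Ha Hf.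
    induction r as [|b r IH]; simpl; [reflexivity|].
    rewrite Hf, IH; [ring| |]; intros H; apply Ha; [right; exact H|left; congruence]. }
  rewrite E. replace (f a + 0 - f a) with 0 by ring. rewrite Rabs_R0. exact He.
Qed.

(** The reciprocal of (q; q)_k, extended by 0 to negative k so that the
    recurrence below holds for every integer. *)
Definition rqfact (y : R) (k : Z) : R :=
  if Z_lt_dec k 0 then 0 else / fprod (exp (- y)) y (Z.to_nat k).

Lemma rqfact_pred y k : 0 < y ->
  rqfact y (k - 1) = (1 - exp (- (y * IZR k))) * rqfact y k.
Proof.
  intros Hy. unfold rqfact. assert (Hx := exp_neg_bounds y Hy).
  destruct (Z_lt_dec k 0); destruct (Z_lt_dec (k - 1) 0); try lia; try ring.
  - replace k with 0%Z by lia. rewrite Rmult_0_r, Ropp_0, exp_0. ring.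
  - set (m := Z.to_nat (k - 1)).
    replace (Z.to_nat k) with (S m) by lia.
    replace k with (Z.of_nat (S m)) by lia. rewrite <- INR_IZR_INZ.
    replace (exp (- (y * INR (S m)))) with (exp (- y) * exp (- y) ^ m).
    2:{ change (exp (- y) * exp (- y) ^ m) with (exp (- y) ^ S m). rewrite exp_pow. f_equal. ring. }
    simpl fprod.
    assert (H1 := fprod_pos (exp (- y)) y m Hy ltac:(lra)).
    assert (H2 := pow_bounds _ m Hx).
    field. split; [nra|lra].
Qed.

Lemma fprod_ge_lim c y n : 0 < y -> 0 <= c < 1 -> qprod c y <= fprod c y n <= 1.
Proof.
  intros Hy Hc. assert (Hx := exp_neg_bounds y Hy).
  assert (D : forall m, fprod c y (S m) <= fprod c y m).
  { intros m. simpl. assert (H := pow_bounds _ m Hx).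
    assert (H1 := fprod_pos c y m Hy ltac:(lra)). assert (0 <= c * exp (- y) ^ m) by nra. nra. }
  split.
  - apply (is_lim_seq_le_loc (fprod c y) (fun _ => fprod c y n) (qprod c y) (fprod c y n)).
    + exists n. intros m Hm. induction Hm as [|m Hm IH]; [lra|].
      eapply Rle_trans; [apply D|exact IH].
    + apply qprod_lim; lra.
    + apply is_lim_seq_const.
  - induction n as [|n IH]; [simpl; lra|]. eapply Rle_trans; [apply D|exact IH].
Qed.

Lemma rqfact_bounds y k : 0 < y -> 0 <= rqfact y k <= / qprod (exp (- y)) y.
Proof.
  intros Hy. assert (Hx := exp_neg_bounds y Hy).
  assert (HE := qprod_pos (exp (- y)) y Hy ltac:(lra)).
  unfold rqfact. destruct (Z_lt_dec k 0).
  - assert (H := Rinv_0_lt_compat _ HE). lra.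
  - assert (H := fprod_ge_lim (exp (- y)) y (Z.to_nat k) Hy ltac:(lra)). split.
    + left. apply Rinv_0_lt_compat. lra.
    + apply Rinv_le_contravar; lra.
Qed.

Lemma rqfact_lim y (s : Z) (k : Z) : 0 < y -> s = 1%Z \/ s = (-1)%Z ->
  is_lim_seq (fun n => rqfact y (Z.of_nat n + s * k)) (/ qprod (exp (- y)) y).
Proof.
  intros Hy Hs. assert (Hx := exp_neg_bounds y Hy).
  assert (HE := qprod_pos (exp (- y)) y Hy ltac:(lra)).
  apply is_lim_seq_ext_loc with (fun n => / fprod (exp (- y)) y (Z.to_nat (Z.of_nat n + s * k))).
  - exists (Z.abs_nat k). intros n Hn. unfold rqfact.
    destruct (Z_lt_dec (Z.of_nat n + s * k) 0); [|reflexivity]. exfalso. nia.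
  - apply (is_lim_seq_inv _ (qprod (exp (- y)) y)); [|intros E; injection E; lra].
    apply (is_lim_seq_subseq (fprod (exp (- y)) y) _
      (fun n => Z.to_nat (Z.of_nat n + s * k))); [|apply qprod_lim; lra].
    intros P [N HN]. exists (N + Z.abs_nat k)%nat. intros n Hn. apply HN. nia.
Qed.

Definition esign (e : bool) : R := if e then -1 else 1.

Lemma esign_sq e : esign e * esign e = 1.
Proof. destruct e; unfold esign; ring. Qed.

Lemma sg_1 e : sg e 1 = esign e.
Proof. destruct e; reflexivity. Qed.

Lemma gterm_succ e A B k :
  gterm e A B (k + 1) = esign e * exp (- (A * (2 * IZR k + 1) + B)) * gterm e A B k.
Proof.
  unfold gterm. rewrite sg_add, sg_1, plus_IZR.
  transitivity (esign e * sg e k * (exp (- (A * (2 * IZR k + 1) + B))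
    * exp (- (A * IZR k ^ 2 + B * IZR k)))); [|ring].
  rewrite <- exp_plus, (Rmult_comm (sg e k)). f_equal. f_equal. ring.
Qed.

(** The coefficients are the q-binomials (q; q)_2n / ((q; q)_(n+k) (q; q)_(n-k)).
    As [rqfact] satisfies its recurrence on all of Z, the induction multiplies
    by the two new factors without treating the ends of the sum apart. *)
Lemma finite_triple_product e A B n : 0 < A ->
  has_sum (fun k => fprod (exp (- (2 * A))) (2 * A) (2 * n)
      * rqfact (2 * A) (Z.of_nat n + 1 * k) * rqfact (2 * A) (Z.of_nat n + (-1) * k)
      * gterm e A B k)
    (fprod (- (esign e * exp (- (A + B)))) (2 * A) n
     * fprod (- (esign e * exp (- (A - B)))) (2 * A) n).
Proof.
  intros HA. assert (Hy : 0 < 2 * A) by lra. assert (Hx := exp_neg_bounds _ Hy).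
  set (y := 2 * A) in *. set (q := exp (- y)) in *.
  set (a := esign e * exp (- (A + B))). set (b := esign e * exp (- (A - B))).
  induction n as [|n IH].
  - set (F := fun k => fprod q y (2 * 0) * rqfact y (Z.of_nat 0 + 1 * k)
        * rqfact y (Z.of_nat 0 + (-1) * k) * gterm e A B k).
    replace (fprod (- a) y 0 * fprod (- b) y 0) with (F 0%Z); unfold F.
    + apply (has_sum_single F 0%Z). unfold F. intros k Hk. unfold rqfact.
      destruct (Z_lt_dec (Z.of_nat 0 + 1 * k) 0); [ring|].
      destruct (Z_lt_dec (Z.of_nat 0 + (-1) * k) 0); [ring|lia].
    + unfold gterm, rqfact, sg. simpl. rewrite Bool.andb_false_r.
      replace (- (A * (0 * (0 * 1)) + B * 0)) with 0 by ring. rewrite exp_0. field.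
  - set (F := fun k => fprod q y (2 * n) * rqfact y (Z.of_nat n + 1 * k)
        * rqfact y (Z.of_nat n + (-1) * k) * gterm e A B k) in *.
    set (s := fprod (- a) y n * fprod (- b) y n) in *.
    assert (H1 : has_sum (fun k => F (k - 1)%Z) s).
    { apply (has_sum_reindex_inv (fun k => k - 1)%Z); [intros; lia| |exact IH].
      intros k; exists (k + 1)%Z; lia. }
    assert (H2 : has_sum (fun k => F (k + 1)%Z) s).
    { apply (has_sum_reindex_inv (fun k => k + 1)%Z); [intros; lia| |exact IH].
      intros k; exists (k - 1)%Z; lia. }
    replace (fprod (- a) y (S n) * fprod (- b) y (S n))
      with ((1 + q * (q ^ n) ^ 2) * s + a * q ^ n * s + b * q ^ n * s).
    + assert (H := has_sum_plus _ _ _ _ (has_sum_plus _ _ _ _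
        (has_sum_scal (1 + q * (q ^ n) ^ 2) _ _ IH)
        (has_sum_scal (a * q ^ n) _ _ H1)) (has_sum_scal (b * q ^ n) _ _ H2)).
      apply has_sum_ext with (2 := H). clear H H1 H2 IH s. intros k. unfold F.
      set (N := q ^ n). set (K := exp (- (y * IZR k))). set (K' := exp (y * IZR k)).
      assert (HK : K * K' = 1).
      { unfold K, K'. rewrite <- exp_plus. rewrite <- exp_0. f_equal. ring. }
      assert (EN : N = exp (- (y * IZR (Z.of_nat n)))).
      { unfold N, q. rewrite exp_pow, <- INR_IZR_INZ. f_equal. ring. }
      assert (Eq1 : exp (- (y * IZR 1)) = q) by (unfold q; f_equal; ring).
      set (X := rqfact y (Z.of_nat n + 1 + k)). set (Y := rqfact y (Z.of_nat n + 1 - k)).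
      assert (eA : forall u v, exp (- (y * IZR (u + v))) = exp (- (y * IZR u)) * exp (- (y * IZR v))).
      { intros u v. rewrite <- exp_plus, plus_IZR. f_equal. ring. }
      assert (eB : exp (- (y * IZR (- k))) = K').
      { unfold K'. rewrite opp_IZR. f_equal. ring. }
      assert (R1 : rqfact y (Z.of_nat n + 1 * k) = (1 - N * q * K) * X).
      { replace (Z.of_nat n + 1 * k)%Z with (Z.of_nat n + 1 + k - 1)%Z by lia.
        rewrite rqfact_pred by exact Hy. rewrite !eA, Eq1, <- EN. reflexivity. }
      assert (R2 : rqfact y (Z.of_nat n + 1 * (k - 1)) = (1 - N * K) * (1 - N * q * K) * X).
      { rewrite <- (Rmult_comm X), <- (Rmult_comm (1 - N * q * K)).
        replace (Z.of_nat n + 1 * (k - 1))%Z with (Z.of_nat n + k - 1)%Z by lia.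
        rewrite rqfact_pred by exact Hy. rewrite eA, <- EN. fold K.
        replace (Z.of_nat n + k)%Z with (Z.of_nat n + 1 * k)%Z by lia. rewrite R1. ring. }
      assert (R3 : rqfact y (Z.of_nat n + 1 * (k + 1)) = X) by (unfold X; f_equal; lia).
      assert (S1 : rqfact y (Z.of_nat n + (-1) * k) = (1 - N * q * K') * Y).
      { replace (Z.of_nat n + (-1) * k)%Z with (Z.of_nat n + 1 - k - 1)%Z by lia.
        rewrite rqfact_pred by exact Hy. unfold Z.sub at 1. rewrite !eA, Eq1, <- EN, eB. reflexivity. }
      assert (S2 : rqfact y (Z.of_nat n + (-1) * (k + 1)) = (1 - N * K') * (1 - N * q * K') * Y).
      { replace (Z.of_nat n + (-1) * (k + 1))%Z with (Z.of_nat n + - k - 1)%Z by lia.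
        rewrite rqfact_pred by exact Hy. rewrite eA, <- EN, eB.
        replace (Z.of_nat n + - k)%Z with (Z.of_nat n + (-1) * k)%Z by lia. rewrite S1. ring. }
      assert (S3 : rqfact y (Z.of_nat n + (-1) * (k - 1)) = Y) by (unfold Y; f_equal; lia).
      assert (T1 : a * gterm e A B (k - 1) = q * K' * gterm e A B k).
      { replace (gterm e A B k) with (gterm e A B (k - 1 + 1)) by (f_equal; lia).
        rewrite gterm_succ, minus_IZR. unfold a. rewrite <- !Rmult_assoc. f_equal.
        rewrite (Rmult_comm _ (esign e)), Rmult_assoc. f_equal.
        unfold q, K'. rewrite <- !exp_plus. f_equal. unfold y. ring. }
      assert (T2 : b * gterm e A B (k + 1) = q * K * gterm e A B k).
      { rewrite gterm_succ. unfold b. rewrite <- !Rmult_assoc. f_equal.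
        transitivity (esign e * esign e * (exp (- (A - B)) * exp (- (A * (2 * IZR k + 1) + B)))); [ring|].
        rewrite esign_sq, Rmult_1_l. unfold q, K. rewrite <- !exp_plus. f_equal. unfold y. ring. }
      rewrite R1, R2, R3, S1, S2, S3.
      replace (rqfact y (Z.of_nat (S n) + 1 * k)) with X by (unfold X; f_equal; lia).
      replace (rqfact y (Z.of_nat (S n) + (-1) * k)) with Y by (unfold Y; f_equal; lia).
      replace (2 * S n)%nat with (S (S (2 * n))) by lia. simpl fprod.
      replace (n + (n + 0))%nat with (2 * n)%nat by lia.
      change (exp (- y)) with q.
      replace (q ^ (2 * n)) with (N * N) by (unfold N; rewrite <- pow_add; f_equal; lia).
      set (Q := fprod q y (2 * n)). set (T := gterm e A B k) in *.
      set (Tm := gterm e A B (k - 1)) in *. set (Tp := gterm e A B (k + 1)) in *.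
      replace (a * N * (Q * ((1 - N * K) * (1 - N * q * K) * X) * Y * Tm))
        with (N * Q * ((1 - N * K) * (1 - N * q * K) * X) * Y * (a * Tm)) by ring.
      replace (b * N * (Q * X * ((1 - N * K') * (1 - N * q * K') * Y) * Tp))
        with (N * Q * X * ((1 - N * K') * (1 - N * q * K') * Y) * (b * Tp)) by ring.
      rewrite T1, T2. simpl pow.
      assert (EK : K' = / K) by (apply Rmult_eq_reg_l with K; [rewrite HK; field|]; intros H0; rewrite H0 in HK; lra).
      rewrite EK. field. intros H0; rewrite H0 in HK; lra.
    + unfold s. simpl fprod. change (exp (- y)) with q.
      assert (Eab : a * b = q).
      { unfold a, b, q, y.
        replace (esign e * exp (- (A + B)) * (esign e * exp (- (A - B))))
          with (esign e * esign e * (exp (- (A + B)) * exp (- (A - B)))) by ring.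
        rewrite <- exp_plus. rewrite esign_sq.
        rewrite Rmult_1_l. f_equal. ring. }
      rewrite <- Eab. ring.
Qed.

(** Tannery's theorem as n tends to infinity: every coefficient of the finite
    form tends to 1 / (q; q) and all are bounded by 1 / (q; q)^2. *)
Theorem triple_product e A B : 0 < A -> e = false \/ Rabs B < A ->
  theta e A B = qprod (exp (- (2 * A))) (2 * A)
    * qprod (- (esign e * exp (- (A + B)))) (2 * A)
    * qprod (- (esign e * exp (- (A - B)))) (2 * A).
Proof.
  intros HA He. assert (Hy : 0 < 2 * A) by lra. assert (Hx := exp_neg_bounds _ Hy).
  assert (Ha : - (esign e * exp (- (A + B))) < 1).
  { destruct He as [->|HB]; simpl.
    - assert (H := exp_pos (- (A + B))). lra.
    - apply Rabs_def2 in HB. assert (H := exp_neg_bounds (A + B) ltac:(lra)).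
      destruct e; simpl; lra. }
  assert (Hb : - (esign e * exp (- (A - B))) < 1).
  { destruct He as [->|HB]; simpl.
    - assert (H := exp_pos (- (A - B))). lra.
    - apply Rabs_def2 in HB. assert (H := exp_neg_bounds (A - B) ltac:(lra)).
      destruct e; simpl; lra. }
  set (y := 2 * A) in *. set (E := qprod (exp (- y)) y).
  assert (HE : 0 < E) by (apply qprod_pos; lra).
  assert (HT := theta_has_sum e A B HA).
  destruct (has_sum_abs _ _ HT) as [G HG].
  assert (L := has_sum_tannery
    (fun n k => fprod (exp (- y)) y (2 * n) * rqfact y (Z.of_nat n + 1 * k)
       * rqfact y (Z.of_nat n + (-1) * k) * gterm e A B k)
    (fun k => E * / E * / E * gterm e A B k)
    (fun k => / E * / E * Rabs (gterm e A B k))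
    (fun n => fprod (- (esign e * exp (- (A + B)))) y n
              * fprod (- (esign e * exp (- (A - B)))) y n)
    (E * / E * / E * theta e A B) (/ E * / E * G)).
  assert (L' : is_lim_seq (fun n => fprod (- (esign e * exp (- (A + B)))) y n
              * fprod (- (esign e * exp (- (A - B)))) y n) (E * / E * / E * theta e A B)).
  { apply L; clear L.
    - intros n k.
      assert (B1 := fprod_ge_lim (exp (- y)) y (2 * n) Hy ltac:(lra)).
      assert (B2 := rqfact_bounds y (Z.of_nat n + 1 * k) Hy).
      assert (B3 := rqfact_bounds y (Z.of_nat n + (-1) * k) Hy).
      fold E in B1, B2, B3. rewrite Rabs_mult. apply Rmult_le_compat_r; [apply Rabs_pos|].
      rewrite Rabs_pos_eq by (apply Rmult_le_pos; [apply Rmult_le_pos|]; lra).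
      apply Rmult_le_compat; [apply Rmult_le_pos; lra|lra| |lra].
      rewrite <- (Rmult_1_l (/ E)). apply Rmult_le_compat; lra.
    - apply has_sum_scal, HG.
    - intros k. apply is_lim_seq_mult'; [|apply is_lim_seq_const].
      apply is_lim_seq_mult'; [apply is_lim_seq_mult'|].
      + apply is_lim_seq_mul_index; [lia|apply qprod_lim; lra].
      + apply rqfact_lim; auto.
      + apply rqfact_lim; auto.
    - intros n. apply finite_triple_product, HA.
    - apply has_sum_scal, HT. }
  assert (L2 : is_lim_seq (fun n => fprod (- (esign e * exp (- (A + B)))) y n
              * fprod (- (esign e * exp (- (A - B)))) y n)
    (qprod (- (esign e * exp (- (A + B)))) y * qprod (- (esign e * exp (- (A - B)))) y)).
  { apply is_lim_seq_mult'; apply qprod_lim; lra. }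
  assert (EQ := is_lim_seq_eq _ _ _ L' L2).
  rewrite Rmult_assoc, <- EQ. field. lra.
Qed.

(** * Theta constants and their products *)

Definition t2 (y : R) : R := exp (- (y / 4)) * theta false y y.
Definition t3 (y : R) : R := theta false y 0.
Definition t4 (y : R) : R := theta true y 0.

(** (q^2; q^2), (-q; q^2), (q; q^2) and (-q^2; q^2). *)
Definition qE (y : R) : R := qprod (exp (- y) ^ 2) (2 * y).
Definition qP (y : R) : R := qprod (- exp (- y)) (2 * y).
Definition qN (y : R) : R := qprod (exp (- y)) (2 * y).
Definition qS (y : R) : R := qprod (- exp (- y) ^ 2) (2 * y).

Lemma exp_neg_sq y : exp (- (2 * y)) = exp (- y) ^ 2.
Proof. exact (exp_mult_pow 2 y). Qed.

Lemma q_pos y : 0 < y -> 0 < qE y /\ 0 < qP y /\ 0 < qN y /\ 0 < qS y.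
Proof.
  intros Hy. assert (Hx := exp_neg_bounds y Hy).
  repeat split; apply qprod_pos; nra.
Qed.

Lemma theta0_product e y : 0 < y ->
  theta e y 0 = qE y * qprod (- (esign e * exp (- y))) (2 * y) ^ 2.
Proof.
  intros Hy. rewrite triple_product by (try right; rewrite ?Rabs_R0; assumption).
  rewrite Rplus_0_r, Rminus_0_r, exp_neg_sq. unfold qE. ring.
Qed.

Lemma t3_product y : 0 < y -> t3 y = qE y * qP y ^ 2.
Proof.
  intros Hy. unfold t3, qP. rewrite theta0_product by exact Hy. unfold esign.
  rewrite Rmult_1_l. reflexivity.
Qed.

Lemma t4_product y : 0 < y -> t4 y = qE y * qN y ^ 2.
Proof.
  intros Hy. unfold t4, qN. rewrite theta0_product by exact Hy. unfold esign.
  replace (- (-1 * exp (- y))) with (exp (- y)) by ring. reflexivity.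
Qed.

Lemma t2_product y : 0 < y -> t2 y = 2 * exp (- (y / 4)) * qE y * qS y ^ 2.
Proof.
  intros Hy. unfold t2. assert (Hx := exp_neg_bounds y Hy).
  rewrite triple_product by auto.
  replace (y + y) with (2 * y) by ring.
  replace (- (y - y)) with 0 by ring. rewrite exp_0, exp_neg_sq. change (esign false) with 1.
  rewrite (qprod_head (- (1 * 1)) (2 * y)).
  - rewrite exp_neg_sq. unfold qE, qS. rewrite !Rmult_1_l.
    replace (Ropp 1 * exp (- y) ^ 2) with (- exp (- y) ^ 2) by ring. ring.
  - lra.
  - assert (H := exp_pos (- (2 * y))). lra.
Qed.

Lemma t_pos y : 0 < y -> 0 < t2 y /\ 0 < t3 y /\ 0 < t4 y.
Proof.
  intros Hy. destruct (q_pos y Hy) as [HE [HP [HN HS]]].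
  rewrite t2_product, t3_product, t4_product by exact Hy.
  assert (H := exp_pos (- (y / 4))).
  repeat split; repeat apply Rmult_lt_0_compat; try lra; apply pow_lt; lra.
Qed.

Lemma qPN y : 0 < y -> qP y * qN y = qN (2 * y).
Proof.
  intros Hy. assert (Hx := exp_neg_bounds y Hy). unfold qP, qN.
  rewrite Rmult_comm, qprod_square by lra. rewrite exp_neg_sq. reflexivity.
Qed.

Lemma qES y : 0 < y -> qE y * qS y = qE (2 * y).
Proof.
  intros Hy. assert (Hx := exp_neg_bounds y Hy). unfold qE, qS.
  rewrite qprod_square by nra. rewrite exp_neg_sq. reflexivity.
Qed.

Lemma qNE y : 0 < y -> qN (2 * y) * qE (2 * y) = qE y.
Proof.
  intros Hy. assert (Hx := exp_neg_bounds y Hy). unfold qN, qE.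
  rewrite (qprod_section2 (exp (- y) ^ 2) (2 * y)) by nra.
  rewrite exp_neg_sq. f_equal. f_equal. ring.
Qed.

Lemma qPS y : 0 < y -> qP (2 * y) * qS (2 * y) = qS y.
Proof.
  intros Hy. assert (Hx := exp_neg_bounds y Hy). unfold qP, qS.
  rewrite (qprod_section2 (- exp (- y) ^ 2) (2 * y)) by nra.
  rewrite exp_neg_sq. f_equal. f_equal. ring.
Qed.

(** Euler's argument: (q^2; q^2) = (q^2; q^4) (q^4; q^4), where the first factor
    is (q; q^2) (-q; q^2) and the second (q^2; q^2) (-q^2; q^2). *)
Lemma qPNS y : 0 < y -> qP y * qN y * qS y = 1.
Proof.
  intros Hy. destruct (q_pos y Hy) as [HE _].
  apply Rmult_eq_reg_l with (qE y); [|lra].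
  rewrite qPN by exact Hy. replace (qE y * (qN (2 * y) * qS y)) with (qN (2 * y) * (qE y * qS y)) by ring.
  rewrite qES, qNE by exact Hy. ring.
Qed.

Lemma t234_product y : 0 < y -> t2 y * t3 y * t4 y = 2 * exp (- (y / 4)) * qE y ^ 3.
Proof.
  intros Hy. rewrite t2_product, t3_product, t4_product by exact Hy.
  assert (H := qPNS y Hy).
  replace (2 * exp (- (y / 4)) * qE y * qS y ^ 2 * (qE y * qP y ^ 2) * (qE y * qN y ^ 2))
    with (2 * exp (- (y / 4)) * qE y ^ 3 * (qP y * qN y * qS y) ^ 2) by ring.
  rewrite H. ring.
Qed.

Lemma t3_t4_double y : 0 < y -> t3 y * t4 y = t4 (2 * y) ^ 2.
Proof.
  intros Hy. rewrite t3_product, t4_product, t4_product by lra.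
  rewrite <- qES, <- qPN by exact Hy.
  replace ((qE y * qS y * (qP y * qN y) ^ 2) ^ 2)
    with (qE y ^ 2 * (qP y * qN y) ^ 2 * (qP y * qN y * qS y) ^ 2) by ring.
  rewrite qPNS by exact Hy. ring.
Qed.

Lemma t2_double y : 0 < y -> t2 y ^ 2 = 2 * t2 (2 * y) * t3 (2 * y).
Proof.
  intros Hy. rewrite (t2_product y), (t2_product (2 * y)), t3_product by lra.
  rewrite <- (qPS y), <- (qES y) by exact Hy.
  assert (E : exp (- (2 * y / 4)) = exp (- (y / 4)) ^ 2).
  { rewrite exp_pow. f_equal. simpl. field. }
  rewrite E. rewrite <- (qPS y) by exact Hy. ring.
Qed.

(** * Lattice identities of index 2 *)

Definition split2 (p : (Z * Z) + (Z * Z)) : Z * Z :=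
  match p with
  | inl (a, b) => (a + b, a - b)%Z
  | inr (a, b) => (a + b + 1, a - b)%Z
  end.

Lemma split2_inj p p' : split2 p = split2 p' -> p = p'.
Proof.
  destruct p as [[a b]|[a b]], p' as [[a' b']|[a' b']]; simpl; intros H;
    injection H; intros; try lia; f_equal; f_equal; lia.
Qed.

Lemma split2_surj m : exists p, split2 p = m.
Proof.
  destruct m as [m n].
  destruct (Z.Even_or_Odd (m + n)) as [[c Hc]|[c Hc]].
  - exists (inl (c, m - c)%Z). simpl. f_equal; lia.
  - exists (inr (c, m - c - 1)%Z). simpl. f_equal; lia.
Qed.

(** Z^2 is the union of the lattice of points with even coordinate sum, which
    is Z^2 rotated and scaled by sqrt 2, and its other coset, centred at a
    point with half-integral coordinates in the rotated frame. *)
Lemma theta_sq_split e y : 0 < y ->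
  theta e y 0 ^ 2 = t3 (2 * y) ^ 2 + esign e * t2 (2 * y) ^ 2.
Proof.
  intros Hy.
  assert (H := has_sum_prod _ _ _ _ (theta_has_sum e y 0 Hy) (theta_has_sum e y 0 Hy)).
  replace (theta e y 0 ^ 2) with (theta e y 0 * theta e y 0) by ring.
  apply (has_sum_unique _ _ _ H).
  apply (has_sum_reindex split2); [apply split2_inj|apply split2_surj|].
  assert (Hs : forall a b, sg e (a + b) * sg e (a - b) = 1).
  { intros a b. rewrite <- sg_add. replace (a + b + (a - b))%Z with (2 * a)%Z by lia.
    apply sg_double. }
  apply has_sum_disjoint.
  - unfold t3. assert (H2 : 0 < 2 * y) by lra.
    replace (theta false (2 * y) 0 ^ 2) with (theta false (2 * y) 0 * theta false (2 * y) 0) by ring.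
    apply has_sum_ext with
      (2 := has_sum_prod _ _ _ _ (theta_has_sum false _ 0 H2) (theta_has_sum false _ 0 H2)).
    intros [a b]. simpl. unfold gterm.
    transitivity (sg e (a + b) * sg e (a - b) * (exp (- (y * IZR (a + b) ^ 2 + 0 * IZR (a + b)))
      * exp (- (y * IZR (a - b) ^ 2 + 0 * IZR (a - b))))); [|ring].
    rewrite Hs. unfold sg. simpl andb. cbv iota. rewrite !Rmult_1_l, <- !exp_plus. f_equal.
    rewrite minus_IZR, plus_IZR. ring.
  - unfold t2. assert (H2 : 0 < 2 * y) by lra.
    replace (esign e * (exp (- (2 * y / 4)) * theta false (2 * y) (2 * y)) ^ 2)
      with (esign e * exp (- (2 * y / 4)) ^ 2 * (theta false (2 * y) (2 * y) * theta false (2 * y) (2 * y)))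
      by ring.
    apply has_sum_ext with
      (2 := has_sum_scal _ _ _ (has_sum_prod _ _ _ _ (theta_has_sum false _ (2 * y) H2)
              (theta_has_sum false _ (2 * y) H2))).
    intros [a b]. simpl fst. simpl snd. unfold split2, gterm. simpl fst. simpl snd.
    transitivity (sg e (a + b + 1) * sg e (a - b) * (exp (- (y * IZR (a + b + 1) ^ 2 + 0 * IZR (a + b + 1)))
      * exp (- (y * IZR (a - b) ^ 2 + 0 * IZR (a - b))))); [|ring].
    rewrite sg_add, sg_1.
    replace (sg e (a + b) * esign e * sg e (a - b)) with (esign e) by
      (transitivity (esign e * (sg e (a + b) * sg e (a - b))); [rewrite Hs|]; ring).
    unfold sg. simpl andb. cbv iota. rewrite !Rmult_1_l, exp_pow, <- !exp_plus.
    rewrite Rmult_assoc, <- exp_plus. f_equal. f_equal.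
    rewrite minus_IZR, !plus_IZR. simpl INR. field.
Qed.

Lemma t3_sq_double y : 0 < y -> t3 y ^ 2 = t3 (2 * y) ^ 2 + t2 (2 * y) ^ 2.
Proof. intros Hy. unfold t3 at 1. rewrite theta_sq_split by exact Hy. simpl esign. ring. Qed.

Lemma t4_sq_double y : 0 < y -> t4 y ^ 2 = t3 (2 * y) ^ 2 - t2 (2 * y) ^ 2.
Proof. intros Hy. unfold t4. rewrite theta_sq_split by exact Hy. simpl esign. ring. Qed.

Lemma jacobi_quartic y : 0 < y -> t3 y ^ 4 = t2 y ^ 4 + t4 y ^ 4.
Proof.
  intros Hy. assert (H3 := t3_sq_double y Hy). assert (H4 := t4_sq_double y Hy).
  assert (H2 := t2_double y Hy).
  replace (t3 y ^ 4) with ((t3 y ^ 2) ^ 2) by ring.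
  replace (t2 y ^ 4) with ((t2 y ^ 2) ^ 2) by ring.
  replace (t4 y ^ 4) with ((t4 y ^ 2) ^ 2) by ring.
  rewrite H2, H3, H4. ring.
Qed.

(** * Lattice identities of index 5 *)

(** Theta series over Z + h/2; with h = 0 or 1 these are the three theta
    constants and the level 10 series that occur in their 5-splitting. *)
Definition stheta (e : bool) (A B : R) (h : Z) : R :=
  exp (- (A * (IZR h / 2) ^ 2 + B * (IZR h / 2))) * theta e A (B + A * IZR h).

Definition sterm (e : bool) (A B : R) (h : Z) (n : Z) : R :=
  sg e n * exp (- (A * (IZR n + IZR h / 2) ^ 2 + B * (IZR n + IZR h / 2))).

Lemma stheta_has_sum e A B h : 0 < A -> has_sum (sterm e A B h) (stheta e A B h).
Proof.
  intros HA. unfold stheta.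
  apply has_sum_ext with (2 := has_sum_scal _ _ _ (theta_has_sum e A (B + A * IZR h) HA)).
  intros n. unfold gterm, sterm.
  transitivity (sg e n * (exp (- (A * (IZR h / 2) ^ 2 + B * (IZR h / 2)))
    * exp (- (A * IZR n ^ 2 + (B + A * IZR h) * IZR n)))); [ring|].
  rewrite <- exp_plus. f_equal. f_equal. field.
Qed.

Lemma stheta_opp e A B h : 0 < A -> sg e h = 1 -> stheta e A (- B) h = stheta e A B h.
Proof.
  intros HA Hh. apply (has_sum_unique (sterm e A (- B) h)); [apply stheta_has_sum, HA|].
  apply (has_sum_reindex (fun n => - n - h)%Z).
  - intros a b; lia.
  - intros b; exists (- b - h)%Z; lia.
  - apply has_sum_ext with (2 := stheta_has_sum e A B h HA).
    intros n. unfold sterm, Z.sub. rewrite sg_add, !sg_opp, Hh, plus_IZR, !opp_IZR.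
    rewrite Rmult_1_r. f_equal. f_equal. field.
Qed.

Definition split5 (h : Z) (p : Z * Z + Z * Z + (Z * Z + Z * Z) + Z * Z) : Z * Z :=
  match p with
  | inr (a, b) => (a + 2 * b + h, 2 * a - b)
  | inl (inl (inl (a, b))) => (a + 2 * b + h + 1, 2 * a - b)
  | inl (inl (inr (a, b))) => (a + 2 * b + h - 1, 2 * a - b)
  | inl (inr (inl (a, b))) => (a + 2 * b + h, 2 * a - b + 1)
  | inl (inr (inr (a, b))) => (a + 2 * b + h, 2 * a - b - 1)
  end%Z.

Lemma split5_inj h p p' : split5 h p = split5 h p' -> p = p'.
Proof.
  destruct p as [[[[a b]|[a b]]|[[a b]|[a b]]]|[a b]],
    p' as [[[[a' b']|[a' b']]|[[a' b']|[a' b']]]|[a' b']]; cbn [split5]; intros H;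
    assert (H1 := f_equal fst H); assert (H2 := f_equal snd H); cbn [fst snd] in H1, H2;
    try (exfalso; lia);
    assert (a = a') by lia; assert (b = b') by lia; congruence.
Qed.

Lemma split5_surj h m : exists p, split5 h p = m.
Proof.
  destruct m as [m n]. set (t := (m + 2 * n - h)%Z).
  assert (Ht := Z.div_mod t 5 ltac:(lia)). assert (Hr := Z.mod_pos_bound t 5 ltac:(lia)).
  set (c := (t / 5)%Z) in *. set (r := (t mod 5)%Z) in *.
  assert (D : (r = 0 \/ r = 1 \/ r = 2 \/ r = 3 \/ r = 4)%Z) by lia.
  destruct D as [D|[D|[D|[D|D]]]].
  - exists (inr (c, 2 * c - n)%Z). cbn [split5]. f_equal; lia.
  - exists (inl (inl (inl (c, 2 * c - n)%Z))). cbn [split5]. f_equal; lia.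
  - exists (inl (inr (inl (c, 2 * c + 1 - n)%Z))). cbn [split5]. f_equal; lia.
  - exists (inl (inr (inr (c + 1, 2 * (c + 1) - 1 - n)%Z))). cbn [split5]. f_equal; lia.
  - exists (inl (inl (inr (c + 1, 2 * (c + 1) - n)%Z))). cbn [split5]. f_equal; lia.
Qed.

(** The Gaussian integers split into the multiples of 2 - i and four further
    cosets, which the units permute; so the four contributions agree. *)
Lemma stheta_split5 e y h : 0 < y -> sg e h = 1 ->
  stheta e y 0 h ^ 2 = stheta e (5 * y) 0 h ^ 2
    + 4 * esign e * exp (- y) * stheta e (5 * y) (2 * y) h * stheta e (5 * y) (4 * y) h.
Proof.
  intros Hy Hh. assert (H5 : 0 < 5 * y) by lra.
  set (Q := stheta e (5 * y) 0 h). set (U := stheta e (5 * y) (2 * y) h).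
  set (V := stheta e (5 * y) (4 * y) h).
  assert (HQ : has_sum (sterm e (5 * y) 0 h) Q) by (apply stheta_has_sum, H5).
  assert (HU : has_sum (sterm e (5 * y) (2 * y) h) U) by (apply stheta_has_sum, H5).
  assert (HV : has_sum (sterm e (5 * y) (4 * y) h) V) by (apply stheta_has_sum, H5).
  assert (HU' : has_sum (sterm e (5 * y) (- (2 * y)) h) U)
    by (unfold U; rewrite <- stheta_opp by assumption; apply stheta_has_sum, H5).
  assert (HV' : has_sum (sterm e (5 * y) (- (4 * y)) h) V)
    by (unfold V; rewrite <- stheta_opp by assumption; apply stheta_has_sum, H5).
  assert (H := has_sum_prod _ _ _ _ (stheta_has_sum e y 0 h Hy) (stheta_has_sum e y 0 h Hy)).
  replace (stheta e y 0 h ^ 2) with (stheta e y 0 h * stheta e y 0 h) by ring.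
  replace (Q ^ 2 + 4 * esign e * exp (- y) * U * V)
    with (esign e * exp (- y) * (U * V) + esign e * exp (- y) * (U * V)
          + (esign e * exp (- y) * (V * U) + esign e * exp (- y) * (V * U)) + Q * Q) by ring.
  apply (has_sum_unique _ _ _ H).
  apply (has_sum_reindex (split5 h)); [apply split5_inj|apply split5_surj|].
  assert (K : forall c m n a b B B', sg e (m + n) = c * sg e (a + b) ->
    y * ((IZR m + IZR h / 2) ^ 2 + (IZR n + IZR h / 2) ^ 2)
    = y + 5 * y * (IZR a + IZR h / 2) ^ 2 + B * (IZR a + IZR h / 2)
      + 5 * y * (IZR b + IZR h / 2) ^ 2 + B' * (IZR b + IZR h / 2) ->
    c * exp (- y) * (sterm e (5 * y) B h a * sterm e (5 * y) B' h b)
    = sterm e y 0 h m * sterm e y 0 h n).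
  { intros c m n a b B B' E1 E2. unfold sterm.
    transitivity (c * (sg e a * sg e b) * (exp (- y) *
      exp (- (5 * y * (IZR a + IZR h / 2) ^ 2 + B * (IZR a + IZR h / 2)))
      * exp (- (5 * y * (IZR b + IZR h / 2) ^ 2 + B' * (IZR b + IZR h / 2))))); [ring|].
    transitivity (sg e m * sg e n * (exp (- (y * (IZR m + IZR h / 2) ^ 2 + 0 * (IZR m + IZR h / 2)))
      * exp (- (y * (IZR n + IZR h / 2) ^ 2 + 0 * (IZR n + IZR h / 2))))); [|ring].
    rewrite <- !sg_add, E1, <- !exp_plus. f_equal. f_equal. lra. }
  assert (S0 : forall a b, sg e (a + 2 * b + h + (2 * a - b)) = sg e (a + b)).
  { intros a b. replace (a + 2 * b + h + (2 * a - b))%Z with (2 * a + (a + b) + h)%Z by lia.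
    rewrite (sg_add e _ h), (sg_add e (2 * a)), sg_double, Hh. ring. }
  assert (Sm : sg e (-1) = esign e) by (rewrite <- sg_1; apply (sg_opp e 1)).
  repeat apply has_sum_disjoint.
  - apply has_sum_ext with (2 := has_sum_scal _ _ _ (has_sum_prod _ _ _ _ HU HV)).
    intros [a b]. apply K; cbn [fst snd split5].
    + replace (a + 2 * b + h + 1 + (2 * a - b))%Z with (a + 2 * b + h + (2 * a - b) + 1)%Z by lia.
      rewrite sg_add, S0, sg_1. ring.
    + rewrite minus_IZR, !plus_IZR, !mult_IZR. field.
  - apply has_sum_ext with (2 := has_sum_scal _ _ _ (has_sum_prod _ _ _ _ HU' HV')).
    intros [a b]. apply K; cbn [fst snd split5].
    + replace (a + 2 * b + h - 1 + (2 * a - b))%Z with (a + 2 * b + h + (2 * a - b) + (-1))%Z by lia.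
      rewrite sg_add, S0, Sm. ring.
    + rewrite !minus_IZR, !plus_IZR, !mult_IZR. field.
  - apply has_sum_ext with (2 := has_sum_scal _ _ _ (has_sum_prod _ _ _ _ HV HU')).
    intros [a b]. apply K; cbn [fst snd split5].
    + replace (a + 2 * b + h + (2 * a - b + 1))%Z with (a + 2 * b + h + (2 * a - b) + 1)%Z by lia.
      rewrite sg_add, S0, sg_1. ring.
    + rewrite !plus_IZR, minus_IZR, !mult_IZR. field.
  - apply has_sum_ext with (2 := has_sum_scal _ _ _ (has_sum_prod _ _ _ _ HV' HU)).
    intros [a b]. apply K; cbn [fst snd split5].
    + replace (a + 2 * b + h + (2 * a - b - 1))%Z with (a + 2 * b + h + (2 * a - b) + (-1))%Z by lia.
      rewrite sg_add, S0, Sm. ring.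
    + rewrite !minus_IZR, !plus_IZR, !mult_IZR. field.
  - apply has_sum_ext with (2 := has_sum_prod _ _ _ _ HQ HQ).
    intros [a b]. cbn [fst snd split5]. unfold sterm.
    transitivity (sg e a * sg e b * (exp (- (5 * y * (IZR a + IZR h / 2) ^ 2 + 0 * (IZR a + IZR h / 2)))
      * exp (- (5 * y * (IZR b + IZR h / 2) ^ 2 + 0 * (IZR b + IZR h / 2))))); [ring|].
    transitivity (sg e (a + 2 * b + h) * sg e (2 * a - b) *
      (exp (- (y * (IZR (a + 2 * b + h) + IZR h / 2) ^ 2 + 0 * (IZR (a + 2 * b + h) + IZR h / 2)))
      * exp (- (y * (IZR (2 * a - b) + IZR h / 2) ^ 2 + 0 * (IZR (2 * a - b) + IZR h / 2))))); [|ring].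
    rewrite <- !sg_add, S0, <- !exp_plus. f_equal. f_equal.
    rewrite minus_IZR, !plus_IZR, !mult_IZR. field.
Qed.

Lemma t2_stheta y : t2 y = stheta false y 0 1.
Proof. unfold t2, stheta. f_equal; [f_equal; field|f_equal; ring]. Qed.

Lemma stheta_0 e A B : stheta e A B 0 = theta e A B.
Proof.
  unfold stheta. replace (- (A * (0 / 2) ^ 2 + B * (0 / 2))) with 0 by field.
  rewrite exp_0, Rmult_1_l. f_equal. ring.
Qed.

(** By the triple product the two series of level 10 supply the residues 1, 3,
    7, 9 modulo 10 of (-e q; q^2); the last factor supplies the residue 5. *)
Lemma coset_product34 e y : 0 < y ->
  exp (- y) * stheta e (5 * y) (2 * y) 0 * stheta e (5 * y) (4 * y) 0
    * qprod (- (esign e * exp (- y) ^ 5)) (2 * (5 * y))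
  = exp (- y) * qE (5 * y) ^ 2 * qprod (- (esign e * exp (- y))) (2 * y).
Proof.
  intros Hy. assert (Hx := exp_neg_bounds y Hy).
  rewrite !stheta_0, !triple_product;
    try lra; try (right; rewrite Rabs_pos_eq; lra).
  assert (Ek : forall k, exp (- (INR k * y)) = exp (- y) ^ k) by (intros k; apply exp_mult_pow).
  replace (exp (- (5 * y + 2 * y))) with (exp (- y) ^ 7) by (rewrite <- Ek; f_equal; simpl; ring).
  replace (exp (- (5 * y - 2 * y))) with (exp (- y) ^ 3) by (rewrite <- Ek; f_equal; simpl; ring).
  replace (exp (- (5 * y + 4 * y))) with (exp (- y) ^ 9) by (rewrite <- Ek; f_equal; simpl; ring).
  replace (exp (- (5 * y - 4 * y))) with (exp (- y)) by (f_equal; ring).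
  rewrite (qprod_section5 (- (esign e * exp (- y))) (2 * y)).
  - rewrite !exp_neg_sq. unfold qE. set (x := exp (- y)) in *.
    replace (5 * (2 * y)) with (2 * (5 * y)) by ring.
    replace (- (esign e * x) * x ^ 2) with (- (esign e * x ^ 3)) by ring.
    replace (- (esign e * x) * (x ^ 2) ^ 2) with (- (esign e * x ^ 5)) by ring.
    replace (- (esign e * x) * (x ^ 2) ^ 3) with (- (esign e * x ^ 7)) by ring.
    replace (- (esign e * x) * (x ^ 2) ^ 4) with (- (esign e * x ^ 9)) by ring.
    ring.
  - lra.
  - destruct e; simpl; lra.
Qed.

(** The same with the residues 2, 4, 6, 8 modulo 10 of (-q^2; q^2); the
    arguments 2 y and 4 y are first reflected so that both series have
    exponents of the form required. *)
Lemma coset_product2 y : 0 < y ->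
  exp (- y) * stheta false (5 * y) (2 * y) 1 * stheta false (5 * y) (4 * y) 1
    * qS (5 * y)
  = exp (- (y / 4)) ^ 2 * qE (5 * y) ^ 2 * qS y.
Proof.
  intros Hy. assert (Hx := exp_neg_bounds y Hy). assert (H5 : 0 < 5 * y) by lra.
  rewrite <- (stheta_opp false (5 * y) (2 * y)), <- (stheta_opp false (5 * y) (4 * y))
    by (reflexivity || assumption).
  unfold stheta. rewrite !triple_product by auto.
  assert (Ek : forall k, exp (- (INR k * y)) = exp (- y) ^ k) by (intros k; apply exp_mult_pow).
  replace (exp (- (5 * y + (- (2 * y) + 5 * y * 1)))) with (exp (- y) ^ 8) by (rewrite <- Ek; f_equal; simpl; ring).
  replace (exp (- (5 * y - (- (2 * y) + 5 * y * 1)))) with (exp (- y) ^ 2) by (rewrite <- Ek; f_equal; simpl; ring).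
  replace (exp (- (5 * y + (- (4 * y) + 5 * y * 1)))) with (exp (- y) ^ 6) by (rewrite <- Ek; f_equal; simpl; ring).
  replace (exp (- (5 * y - (- (4 * y) + 5 * y * 1)))) with (exp (- y) ^ 4) by (rewrite <- Ek; f_equal; simpl; ring).
  unfold qS, qE. rewrite (qprod_section5 (- exp (- y) ^ 2) (2 * y)) by nra.
  rewrite !exp_neg_sq.
  replace (exp (- (5 * y))) with (exp (- y) ^ 5) by (rewrite <- Ek; f_equal; simpl; ring).
  transitivity ((exp (- y) * exp (- (5 * y * (1 / 2) ^ 2 + - (2 * y) * (1 / 2)))
    * exp (- (5 * y * (1 / 2) ^ 2 + - (4 * y) * (1 / 2)))) *
    (qprod ((exp (- y) ^ 5) ^ 2) (2 * (5 * y)) ^ 2 *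
     (qprod (- (1 * exp (- y) ^ 8)) (2 * (5 * y)) * qprod (- (1 * exp (- y) ^ 2)) (2 * (5 * y))
      * qprod (- (1 * exp (- y) ^ 6)) (2 * (5 * y)) * qprod (- (1 * exp (- y) ^ 4)) (2 * (5 * y))
      * qprod (- (exp (- y) ^ 5) ^ 2) (2 * (5 * y))))).
  { simpl esign. ring. }
  replace (exp (- y) * exp (- (5 * y * (1 / 2) ^ 2 + - (2 * y) * (1 / 2)))
    * exp (- (5 * y * (1 / 2) ^ 2 + - (4 * y) * (1 / 2)))) with (exp (- (y / 4)) ^ 2).
  2:{ rewrite exp_pow, <- !exp_plus. f_equal. simpl. field. }
  set (x := exp (- y)) in *.
  replace (5 * (2 * y)) with (2 * (5 * y)) by ring.
  replace (- x ^ 2 * x ^ 2) with (- (1 * x ^ 4)) by ring.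
  replace (- x ^ 2 * (x ^ 2) ^ 2) with (- (1 * x ^ 6)) by ring.
  replace (- x ^ 2 * (x ^ 2) ^ 3) with (- (1 * x ^ 8)) by ring.
  replace (- x ^ 2 * (x ^ 2) ^ 4) with (- (x ^ 5) ^ 2) by ring.
  replace (- (1 * x ^ 2)) with (- x ^ 2) by ring.
  ring.
Qed.

(** Eliminating the products through t2 t3 t4 = 2 q^(1/4) (q^2; q^2)^3. *)
Lemma sixth_power_elim z E E5 U t T p p5 D :
  0 < z -> 0 < E -> 0 < E5 ->
  D ^ 2 = 16 * U ^ 2 -> U ^ 2 * T * E = (z ^ 4) ^ 2 * E5 ^ 5 * t ->
  p = 2 * z * E ^ 3 -> p5 = 2 * z ^ 5 * E5 ^ 3 ->
  D ^ 6 * T ^ 3 * p = 256 * t ^ 3 * p5 ^ 5.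
Proof.
  intros Hz HE HE5 HD HU -> ->.
  replace (D ^ 6 * T ^ 3 * (2 * z * E ^ 3)) with (2 * z * (D ^ 2) ^ 3 * T ^ 3 * E ^ 3) by ring.
  rewrite HD.
  replace (2 * z * (16 * U ^ 2) ^ 3 * T ^ 3 * E ^ 3) with (8192 * z * (U ^ 2 * T * E) ^ 3) by ring.
  rewrite HU. ring.
Qed.

(** The product formula for t^2 (q) - t^2 (q^5), raised to a power at which the
    products can be expressed by theta constants. *)
Definition degree5_sextic (t : R -> R) : Prop := forall y, 0 < y ->
  (t y ^ 2 - t (5 * y) ^ 2) ^ 6 * t (5 * y) ^ 3 * (t2 y * t3 y * t4 y)
  = 256 * t y ^ 3 * (t2 (5 * y) * t3 (5 * y) * t4 (5 * y)) ^ 5.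

Lemma exp5_quarter y : exp (- (5 * y / 4)) = exp (- (y / 4)) ^ 5.
Proof. rewrite exp_pow. f_equal. simpl. field. Qed.

Lemma exp4_quarter y : exp (- y) = exp (- (y / 4)) ^ 4.
Proof. rewrite exp_pow. f_equal. simpl. field. Qed.

Lemma exp_neg5 y : exp (- (5 * y)) = exp (- y) ^ 5.
Proof. rewrite <- exp_mult_pow. f_equal. simpl. ring. Qed.

Lemma theta0_sextic e : degree5_sextic (fun y => theta e y 0).
Proof.
  intros y Hy. assert (H5 : 0 < 5 * y) by lra.
  destruct (q_pos y Hy) as [HE _]. destruct (q_pos _ H5) as [HE5 _].
  assert (S := stheta_split5 e y 0 Hy ltac:(destruct e; reflexivity)). rewrite !(stheta_0 _ _ 0) in S.
  assert (C := coset_product34 e y Hy).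
  set (U := exp (- y) * stheta e (5 * y) (2 * y) 0 * stheta e (5 * y) (4 * y) 0) in *.
  apply (sixth_power_elim (exp (- (y / 4))) (qE y) (qE (5 * y)) U); auto.
  - apply exp_pos.
  - rewrite S. transitivity (16 * (esign e * esign e) * U ^ 2); [unfold U; ring|].
    rewrite esign_sq. ring.
  - rewrite !theta0_product by assumption. rewrite exp_neg5, <- exp4_quarter.
    set (Q5 := qprod (- (esign e * exp (- y) ^ 5)) (2 * (5 * y))) in *.
    set (Q := qprod (- (esign e * exp (- y))) (2 * y)) in *.
    transitivity ((U * Q5) ^ 2 * qE (5 * y) * qE y); [ring|]. rewrite C. ring.
  - apply t234_product, Hy.
  - rewrite <- exp5_quarter. apply t234_product, H5.
Qed.

Lemma t3_sextic : degree5_sextic t3.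
Proof. exact (theta0_sextic false). Qed.

Lemma t4_sextic : degree5_sextic t4.
Proof. exact (theta0_sextic true). Qed.

Lemma t2_sextic : degree5_sextic t2.
Proof.
  intros y Hy. assert (H5 : 0 < 5 * y) by lra.
  destruct (q_pos y Hy) as [HE _]. destruct (q_pos _ H5) as [HE5 _].
  assert (S := stheta_split5 false y 1 Hy eq_refl). rewrite <- !t2_stheta in S.
  assert (C := coset_product2 y Hy). simpl esign in *.
  set (U := exp (- y) * stheta false (5 * y) (2 * y) 1 * stheta false (5 * y) (4 * y) 1) in *.
  apply (sixth_power_elim (exp (- (y / 4))) (qE y) (qE (5 * y)) U); auto.
  - apply exp_pos.
  - rewrite S. unfold U. ring.
  - rewrite !t2_product by assumption. rewrite exp5_quarter.
    set (z := exp (- (y / 4))) in *.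
    transitivity (2 * z ^ 5 * (U * qS (5 * y)) ^ 2 * qE (5 * y) * qE y); [ring|].
    rewrite C. ring.
  - apply t234_product, Hy.
  - rewrite <- exp5_quarter. apply t234_product, H5.
Qed.

Lemma theta_false_pos A B : 0 < A -> 0 < theta false A B.
Proof.
  intros HA. rewrite triple_product by auto. assert (H1 := exp_neg_bounds (2 * A) ltac:(lra)).
  assert (H2 := exp_pos (- (A + B))). assert (H3 := exp_pos (- (A - B))).
  simpl esign. repeat apply Rmult_lt_0_compat; apply qprod_pos; lra.
Qed.

Lemma theta_true_pos A B : 0 < A -> Rabs B < A -> 0 < theta true A B.
Proof.
  intros HA HB. rewrite triple_product by auto. apply Rabs_def2 in HB.
  assert (H1 := exp_neg_bounds (2 * A) ltac:(lra)).
  assert (H2 := exp_neg_bounds (A + B) ltac:(lra)).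
  assert (H3 := exp_neg_bounds (A - B) ltac:(lra)).
  simpl esign. repeat apply Rmult_lt_0_compat; apply qprod_pos; lra.
Qed.

Lemma stheta_sq_gt y h : 0 < y -> stheta false (5 * y) 0 h ^ 2 < stheta false y 0 h ^ 2.
Proof.
  intros Hy. rewrite (stheta_split5 false y h Hy eq_refl). simpl esign.
  assert (0 < 4 * 1 * exp (- y) * stheta false (5 * y) (2 * y) h * stheta false (5 * y) (4 * y) h); [|lra].
  unfold stheta. repeat apply Rmult_lt_0_compat; try lra; try apply exp_pos;
    apply theta_false_pos; lra.
Qed.

Lemma t2_sq_gt y : 0 < y -> t2 (5 * y) ^ 2 < t2 y ^ 2.
Proof. intros Hy. rewrite !t2_stheta. apply stheta_sq_gt, Hy. Qed.

Lemma t3_sq_gt y : 0 < y -> t3 (5 * y) ^ 2 < t3 y ^ 2.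
Proof. intros Hy. unfold t3. rewrite <- !stheta_0. apply stheta_sq_gt, Hy. Qed.

Lemma t4_sq_lt y : 0 < y -> t4 y ^ 2 < t4 (5 * y) ^ 2.
Proof.
  intros Hy. unfold t4. rewrite <- !stheta_0, (stheta_split5 true y 0 Hy eq_refl), !stheta_0.
  simpl esign.
  assert (0 < 4 * exp (- y) * theta true (5 * y) (2 * y) * theta true (5 * y) (4 * y)); [|lra].
  repeat apply Rmult_lt_0_compat; try lra; try apply exp_pos;
    apply theta_true_pos; try lra; rewrite Rabs_pos_eq; lra.
Qed.

(** * The arithmetic-geometric mean integral *)

Definition agmf (a b t : R) : R := / sqrt (a ^ 2 * cos t ^ 2 + b ^ 2 * sin t ^ 2).
Definition agmI (a b : R) : R := RInt (agmf a b) 0 (PI / 2).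

Lemma cos_sq t : cos t ^ 2 = 1 - sin t ^ 2.
Proof. assert (H := sin2_cos2 t). unfold Rsqr in H. lra. Qed.

Lemma quad_pos a b t : 0 < a -> 0 < b -> 0 < a * cos t ^ 2 + b * sin t ^ 2.
Proof.
  intros Ha Hb. rewrite cos_sq. assert (H := cos_sq t).
  assert (H1 := pow2_ge_0 (sin t)). assert (H2 := pow2_ge_0 (cos t)).
  set (u := sin t ^ 2) in *. destruct (Req_dec u 0); nra.
Qed.

Lemma agmf_continuous a b t : 0 < a -> 0 < b -> continuous (agmf a b) t.
Proof.
  intros Ha Hb. apply (ex_derive_continuous (agmf a b)). unfold agmf.
  assert (H := quad_pos (a ^ 2) (b ^ 2) t ltac:(nra) ltac:(nra)).
  auto_derive. repeat split; simpl in *; try lra.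
  apply Rgt_not_eq, sqrt_lt_R0. lra.
Qed.

Lemma agmf_ex_RInt a b u v : 0 < a -> 0 < b -> ex_RInt (agmf a b) u v.
Proof. intros Ha Hb. apply (ex_RInt_continuous (agmf a b)). intros; apply agmf_continuous; assumption. Qed.

(** The substitution tan (t1 - t) = (b / a) tan t of Landen, written so that
    it is smooth at t = pi / 2. *)
Definition landen (a b t : R) : R :=
  2 * t - atan ((a - b) * sin t * cos t / (a * cos t ^ 2 + b * sin t ^ 2)).

Definition landen' (a b t : R) : R :=
  1 + a * b / (a ^ 2 * cos t ^ 2 + b ^ 2 * sin t ^ 2).

Lemma landen_norm a b s c : c ^ 2 = 1 - s ^ 2 ->
  (a * c ^ 2 + b * s ^ 2) ^ 2 + ((a - b) * s * c) ^ 2 = a ^ 2 * c ^ 2 + b ^ 2 * s ^ 2.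
Proof. intros H. ring [H]. Qed.

Lemma landen_derive a b t : 0 < a -> 0 < b ->
  is_derive (landen a b) t (landen' a b t).
Proof.
  intros Ha Hb. assert (H1 := quad_pos a b t Ha Hb).
  assert (H2 := quad_pos (a ^ 2) (b ^ 2) t ltac:(nra) ltac:(nra)).
  unfold landen, landen'. auto_derive.
  - simpl in H1. lra.
  - assert (Hc := cos_sq t). set (s := sin t) in *. set (c := cos t) in *.
    assert (HN := landen_norm a b s c Hc).
    set (D := a * c ^ 2 + b * s ^ 2) in *. set (Q := a ^ 2 * c ^ 2 + b ^ 2 * s ^ 2) in *.
    replace (a * (c * (c * 1)) + b * (s * (s * 1))) with D by (unfold D; ring).
    assert (E : 1 + ((a - b) * s * c * / D) ^ 2 = Q / D ^ 2).
    { rewrite <- HN. field. lra. }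
    replace (1 + (a - b) * s * c * / D * ((a - b) * s * c * / D * 1)) with (Q / D ^ 2)
      by (rewrite <- E; ring).
    field_simplify_eq; [unfold Q, D; ring [Hc]|split; lra].
Qed.

Lemma landen'_continuous a b t : 0 < a -> 0 < b -> continuous (landen' a b) t.
Proof.
  intros Ha Hb. apply (ex_derive_continuous (landen' a b)). unfold landen'.
  assert (H2 := quad_pos (a ^ 2) (b ^ 2) t ltac:(nra) ltac:(nra)).
  auto_derive. simpl in *. lra.
Qed.

Lemma landen_sin_cos_sq a b t : 0 < a -> 0 < b ->
  sin (landen a b t) ^ 2 = ((a + b) * sin t * cos t) ^ 2 / (a ^ 2 * cos t ^ 2 + b ^ 2 * sin t ^ 2)
  /\ cos (landen a b t) ^ 2 = (a * cos t ^ 2 - b * sin t ^ 2) ^ 2 / (a ^ 2 * cos t ^ 2 + b ^ 2 * sin t ^ 2).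
Proof.
  intros Ha Hb. assert (H1 := quad_pos a b t Ha Hb).
  assert (H2 := quad_pos (a ^ 2) (b ^ 2) t ltac:(nra) ltac:(nra)).
  assert (Hs : sin (landen a b t) ^ 2
    = ((a + b) * sin t * cos t) ^ 2 / (a ^ 2 * cos t ^ 2 + b ^ 2 * sin t ^ 2)).
  { unfold landen. rewrite sin_minus, sin_2a, cos_2a, sin_atan, cos_atan.
    assert (Hc := cos_sq t). set (s := sin t) in *. set (c := cos t) in *.
    set (z := (a - b) * s * c / (a * c ^ 2 + b * s ^ 2)).
    assert (Hz : 0 < 1 + z²) by (assert (H := Rle_0_sqr z); lra).
    assert (Hr := sqrt_sqrt (1 + z²) ltac:(lra)). assert (Hr0 := sqrt_lt_R0 _ Hz).
    set (r := sqrt (1 + z²)) in *.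
    transitivity ((2 * s * c - (c * c - s * s) * z) ^ 2 / (r * r)); [field; lra|].
    rewrite Hr. unfold Rsqr.
    assert (HN := landen_norm a b s c Hc).
    assert (E : 1 + z * z = (a ^ 2 * c ^ 2 + b ^ 2 * s ^ 2) / (a * c ^ 2 + b * s ^ 2) ^ 2).
    { rewrite <- HN. unfold z. field. lra. }
    rewrite E. unfold z.
    assert (E2 : 2 * s * c - (c * c - s * s) * ((a - b) * s * c / (a * c ^ 2 + b * s ^ 2))
      = (a + b) * s * c / (a * c ^ 2 + b * s ^ 2)).
    { field_simplify_eq; [ring [Hc]|lra]. }
    rewrite E2. field. split; lra. }
  split; [exact Hs|].
  rewrite cos_sq, Hs. assert (Hc := cos_sq t).
  set (s := sin t) in *. set (c := cos t) in *.
  field_simplify_eq; [ring [Hc]|lra].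
Qed.

Lemma landen_integrand a b t : 0 < a -> 0 < b ->
  landen' a b t * agmf ((a + b) / 2) (sqrt (a * b)) (landen a b t) = 2 * agmf a b t.
Proof.
  intros Ha Hb. assert (H1 := quad_pos a b t Ha Hb).
  assert (H2 := quad_pos (a ^ 2) (b ^ 2) t ltac:(nra) ltac:(nra)).
  destruct (landen_sin_cos_sq a b t Ha Hb) as [Es Ec].
  unfold agmf. rewrite Es, Ec. unfold landen'. clear Es Ec.
  assert (Hab : sqrt (a * b) ^ 2 = a * b) by (rewrite pow2_sqrt; nra).
  rewrite Hab. assert (Hc := cos_sq t).
  set (s := sin t) in *. set (c := cos t) in *.
  set (Q := a ^ 2 * c ^ 2 + b ^ 2 * s ^ 2) in *. set (D := a * c ^ 2 + b * s ^ 2) in *.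
  assert (E : ((a + b) / 2) ^ 2 * ((a * c ^ 2 - b * s ^ 2) ^ 2 / Q) + a * b * (((a + b) * s * c) ^ 2 / Q)
    = ((a + b) / 2 * D) ^ 2 / Q).
  { unfold D. field. lra. }
  rewrite E, sqrt_div_alt by lra. rewrite sqrt_pow2 by nra.
  assert (Hq := sqrt_sqrt Q ltac:(lra)). assert (Hq0 := sqrt_lt_R0 _ H2).
  set (r := sqrt Q) in *.
  assert (EQ : 1 + a * b / Q = (a + b) * D / (r * r)).
  { rewrite Hq. unfold D, Q in *. field_simplify_eq; [ring [Hc]|lra]. }
  rewrite EQ. field. repeat split; lra.
Qed.

Lemma RInt_Rmult (f : R -> R) a b k :
  ex_RInt f a b -> RInt (fun t => k * f t) a b = k * RInt f a b.
Proof. exact (RInt_scal f a b k). Qed.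

Lemma agmI_half_period a b : 0 < a -> 0 < b -> RInt (agmf a b) 0 PI = 2 * agmI a b.
Proof.
  intros Ha Hb.
  assert (HC := RInt_Chasles (agmf a b) 0 (PI / 2) PI
    (agmf_ex_RInt a b _ _ Ha Hb) (agmf_ex_RInt a b _ _ Ha Hb)).
  rewrite <- HC. unfold plus; simpl. fold (agmI a b).
  assert (HL := RInt_comp_lin (agmf a b) (-1) PI (PI / 2) 0 (agmf_ex_RInt a b _ _ Ha Hb)).
  replace (-1 * (PI / 2) + PI) with (PI / 2) in HL by field.
  replace (-1 * 0 + PI) with PI in HL by ring.
  rewrite <- HL.
  rewrite (RInt_ext _ (fun t => -1 * agmf a b t)).
  - rewrite RInt_Rmult by (apply agmf_ex_RInt; assumption).
    rewrite <- (opp_RInt_swap (agmf a b) 0 (PI / 2)) by (apply agmf_ex_RInt; assumption).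
    unfold opp; simpl. unfold agmI. ring.
  - intros t _. unfold scal; simpl. unfold mult; simpl.
    replace (-1 * t + PI) with (PI - t) by ring.
    unfold agmf. rewrite sin_PI_x.
    replace (cos (PI - t)) with (- cos t).
    2:{ rewrite cos_minus, cos_PI, sin_PI. ring. }
    replace ((- cos t) ^ 2) with (cos t ^ 2) by ring. ring.
Qed.

(** Landen's substitution maps [0, pi/2] onto [0, pi] and turns the integrand of
    the right-hand side into twice that of the left-hand side. *)
Theorem agmI_gauss a b : 0 < a -> 0 < b ->
  agmI a b = agmI ((a + b) / 2) (sqrt (a * b)).
Proof.
  intros Ha Hb. set (a1 := (a + b) / 2). set (b1 := sqrt (a * b)).
  assert (Ha1 : 0 < a1) by (unfold a1; lra).
  assert (Hb1 : 0 < b1) by (apply sqrt_lt_R0; nra).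
  assert (HC := RInt_comp (agmf a1 b1) (landen a b) (landen' a b) 0 (PI / 2)
    (fun t _ => agmf_continuous a1 b1 _ Ha1 Hb1)
    (fun t _ => conj (landen_derive a b t Ha Hb) (landen'_continuous a b t Ha Hb))).
  assert (L0 : landen a b 0 = 0).
  { unfold landen. rewrite sin_0, cos_0. replace ((a - b) * 0 * 1 / (a * 1 ^ 2 + b * 0 ^ 2)) with 0.
    - rewrite atan_0. ring.
    - field. lra. }
  assert (L1 : landen a b (PI / 2) = PI).
  { unfold landen. rewrite sin_PI2, cos_PI2.
    replace ((a - b) * 1 * 0 / (a * 0 ^ 2 + b * 1 ^ 2)) with 0.
    - rewrite atan_0. field.
    - field. lra. }
  rewrite L0, L1, agmI_half_period in HC by assumption.
  assert (E : 2 * agmI a1 b1 = 2 * agmI a b); [|lra].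
  rewrite <- HC. transitivity (RInt (fun t => 2 * agmf a b t) 0 (PI / 2)).
  - apply RInt_ext. intros t _. apply landen_integrand; assumption.
  - apply RInt_Rmult, agmf_ex_RInt; assumption.
Qed.

Lemma agmI_scal c a b : 0 < c -> 0 < a -> 0 < b -> agmI (c * a) (c * b) = / c * agmI a b.
Proof.
  intros Hc Ha Hb. unfold agmI.
  rewrite (RInt_ext _ (fun t => / c * agmf a b t)).
  - rewrite RInt_Rmult by (apply agmf_ex_RInt; assumption). reflexivity.
  - intros t _. unfold scal; simpl. unfold mult; simpl. unfold agmf.
    replace ((c * a) ^ 2 * cos t ^ 2 + (c * b) ^ 2 * sin t ^ 2)
      with (c ^ 2 * (a ^ 2 * cos t ^ 2 + b ^ 2 * sin t ^ 2)) by ring.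
    assert (H := quad_pos (a ^ 2) (b ^ 2) t ltac:(nra) ltac:(nra)).
    rewrite sqrt_mult by nra. rewrite sqrt_pow2 by lra.
    assert (Hs := sqrt_lt_R0 _ H). rewrite Rinv_mult. reflexivity.
Qed.

Lemma agmI_bounds a b m M : 0 < m -> m <= a <= M -> m <= b <= M ->
  PI / 2 / M <= agmI a b <= PI / 2 / m.
Proof.
  intros Hm Ha Hb. assert (HP := PI_RGT_0). unfold agmI.
  assert (C : forall k, 0 < k -> RInt (fun _ => / k) 0 (PI / 2) = PI / 2 / k).
  { intros k Hk. rewrite RInt_const. unfold scal; simpl. unfold mult; simpl. field. lra. }
  assert (B : forall t, m <= sqrt (a ^ 2 * cos t ^ 2 + b ^ 2 * sin t ^ 2) <= M).
  { intros t. assert (h1 := pow2_ge_0 (sin t)). assert (h2 := pow2_ge_0 (cos t)).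
    assert (h3 := cos_sq t).
    assert (m ^ 2 <= a ^ 2) by nra. assert (m ^ 2 <= b ^ 2) by nra.
    assert (a ^ 2 <= M ^ 2) by nra. assert (b ^ 2 <= M ^ 2) by nra.
    split.
    - rewrite <- (sqrt_pow2 m) by lra. apply sqrt_le_1_alt.
      replace (m ^ 2) with (m ^ 2 * cos t ^ 2 + m ^ 2 * sin t ^ 2) by (rewrite h3; ring). nra.
    - rewrite <- (sqrt_pow2 M) by lra. apply sqrt_le_1_alt.
      replace (M ^ 2) with (M ^ 2 * cos t ^ 2 + M ^ 2 * sin t ^ 2) by (rewrite h3; ring). nra. }
  rewrite <- (C M), <- (C m) by lra. split.
  - apply RInt_le; [lra|apply ex_RInt_const|apply agmf_ex_RInt; lra|].
    intros t _. unfold agmf. apply Rinv_le_contravar; destruct (B t); lra.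
  - apply RInt_le; [lra|apply agmf_ex_RInt; lra|apply ex_RInt_const|].
    intros t _. unfold agmf. apply Rinv_le_contravar; destruct (B t); lra.
Qed.

(** Near b = 0 the integral equals log (1 / b) up to a bounded error: the
    logarithm comes from the exact integral of sin t times the integrand. *)
Lemma agmI_log_bounds b : 0 < b < 1 ->
  let B := sqrt (1 - b ^ 2) in
  (ln (1 + B) - ln b) / B <= agmI 1 b <= (ln (1 + B) - ln b) / B + PI / 2 / B.
Proof.
  intros Hb B. assert (HP := PI_RGT_0).
  assert (HB0 : 0 < B) by (apply sqrt_lt_R0; nra).
  assert (HB2 : B ^ 2 = 1 - b ^ 2) by (apply pow2_sqrt; nra).
  set (F := fun t => - ln (B * cos t + sqrt (1 ^ 2 * cos t ^ 2 + b ^ 2 * sin t ^ 2)) / B).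
  set (f := fun t => sin t * agmf 1 b t).
  assert (Hq : forall t, 0 < 1 ^ 2 * cos t ^ 2 + b ^ 2 * sin t ^ 2)
    by (intros t; apply (quad_pos (1 ^ 2) (b ^ 2)); nra).
  assert (Hqs : forall t, sqrt (1 ^ 2 * cos t ^ 2 + b ^ 2 * sin t ^ 2) ^ 2
    = b ^ 2 + (B * cos t) ^ 2).
  { intros t. rewrite pow2_sqrt by (left; apply Hq).
    rewrite Rpow_mult_distr, HB2. assert (H := cos_sq t). ring [H]. }
  assert (Hr0 : forall t, 0 < sqrt (1 ^ 2 * cos t ^ 2 + b ^ 2 * sin t ^ 2))
    by (intros t; apply sqrt_lt_R0, Hq).
  assert (Hpos : forall t, 0 < B * cos t + sqrt (1 ^ 2 * cos t ^ 2 + b ^ 2 * sin t ^ 2)).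
  { intros t. specialize (Hqs t). specialize (Hr0 t).
    set (r := sqrt (1 ^ 2 * cos t ^ 2 + b ^ 2 * sin t ^ 2)) in *. set (u := B * cos t) in *.
    assert (Hb2 : 0 < b ^ 2) by (apply pow_lt; lra). assert (Hur : u ^ 2 < r ^ 2) by lra.
    apply Rnot_le_lt. intros Hle. assert (0 <= (- u - r) * (- u + r)); [|nra].
    apply Rmult_le_pos; lra. }
  assert (Hcont : forall t, continuous f t).
  { intros t. apply (continuous_mult sin (agmf 1 b)).
    - apply (ex_derive_continuous sin). auto_derive. trivial.
    - apply agmf_continuous; lra. }
  assert (HF : is_RInt f 0 (PI / 2) (F (PI / 2) - F 0)).
  { apply (is_RInt_derive F f).
    - intros t _. specialize (Hq t). specialize (Hqs t). specialize (Hpos t). specialize (Hr0 t).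
      unfold F, f, agmf. auto_derive.
      + simpl in *. repeat split; try lra.
      + replace (1 ^ 2 * (cos t * (cos t * 1)) + b ^ 2 * (sin t * (sin t * 1)))
          with (1 ^ 2 * cos t ^ 2 + b ^ 2 * sin t ^ 2) by ring.
        replace (1 * (1 * 1) * (cos t * (cos t * 1)) + b * (b * 1) * (sin t * (sin t * 1)))
          with (1 ^ 2 * cos t ^ 2 + b ^ 2 * sin t ^ 2) by ring.
        set (r := sqrt (1 ^ 2 * cos t ^ 2 + b ^ 2 * sin t ^ 2)) in *.
        field_simplify_eq; [|repeat split; try lra].
        ring [HB2].
    - intros t _. apply Hcont. }
  assert (EF : F (PI / 2) - F 0 = (ln (1 + B) - ln b) / B).
  { unfold F. rewrite cos_PI2, sin_PI2, cos_0, sin_0.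
    replace (B * 0 + sqrt (1 ^ 2 * 0 ^ 2 + b ^ 2 * 1 ^ 2)) with b.
    - replace (B * 1 + sqrt (1 ^ 2 * 1 ^ 2 + b ^ 2 * 0 ^ 2)) with (1 + B); [field; lra|].
      replace (1 ^ 2 * 1 ^ 2 + b ^ 2 * 0 ^ 2) with 1 by ring. rewrite sqrt_1. ring.
    - replace (1 ^ 2 * 0 ^ 2 + b ^ 2 * 1 ^ 2) with (b ^ 2) by ring. rewrite sqrt_pow2; lra. }
  assert (EI : RInt f 0 (PI / 2) = (ln (1 + B) - ln b) / B)
    by (rewrite <- EF; apply is_RInt_unique, HF).
  assert (Hexf : ex_RInt f 0 (PI / 2)) by (exists (F (PI / 2) - F 0); exact HF).
  rewrite <- EI. split.
  - apply RInt_le; [lra|exact Hexf|apply agmf_ex_RInt; lra|].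
    intros t Ht. unfold f. rewrite <- (Rmult_1_l (agmf 1 b t)) at 2.
    apply Rmult_le_compat_r; [left; unfold agmf; apply Rinv_0_lt_compat, Hr0|].
    apply SIN_bound.
  - assert (C : RInt (fun _ => / B) 0 (PI / 2) = PI / 2 / B).
    { rewrite RInt_const. unfold scal; simpl. unfold mult; simpl. field. lra. }
    rewrite <- C.
    assert (HPl := RInt_plus f (fun _ => / B) 0 (PI / 2) Hexf (ex_RInt_const _ _ _)).
    unfold plus in HPl; simpl in HPl. rewrite <- HPl.
    apply RInt_le; [lra|apply agmf_ex_RInt; lra| |].
    + apply (ex_RInt_plus f (fun _ => / B)); [exact Hexf|apply ex_RInt_const].
    + intros t Ht. unfold f, agmf. specialize (Hr0 t). specialize (Hqs t).
      set (r := sqrt (1 ^ 2 * cos t ^ 2 + b ^ 2 * sin t ^ 2)) in *.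
      assert (Hs : 0 <= sin t <= 1) by (split; [apply sin_ge_0; lra|apply SIN_bound]).
      assert (Hc := cos_sq t).
      assert (Hle : (1 - sin t) * B <= r).
      { apply Rnot_lt_le. intros Hlt.
        assert (h1 : (1 - sin t) ^ 2 <= cos t ^ 2) by nra.
        assert (h2 : r ^ 2 < ((1 - sin t) * B) ^ 2) by nra.
        rewrite Hqs, !Rpow_mult_distr in h2. nra. }
      apply Rmult_le_reg_r with (r * B); [nra|].
      replace (/ r * (r * B)) with B by (field; lra).
      replace ((sin t * / r + / B) * (r * B)) with (sin t * B + r) by (field; lra). lra.
Qed.

(** * Theta constants along y, 2 y, 4 y, ... *)

Lemma INR_le_pow2 n : INR n <= 2 ^ n.
Proof.
  induction n as [|n IH]; [simpl; lra|]. rewrite S_INR. simpl.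
  assert (H := pow_R1_Rle 2 n ltac:(lra)). lra.
Qed.

Lemma is_lim_seq_sq u (l : R) : is_lim_seq u l -> is_lim_seq (fun n => u n ^ 2) (l ^ 2).
Proof.
  intros H. apply is_lim_seq_ext with (fun n => u n * u n); [intros n; ring|].
  replace (l ^ 2) with (l * l) by ring. apply is_lim_seq_mult'; exact H.
Qed.

Lemma is_lim_seq_exp_pow2 c : 0 < c -> is_lim_seq (fun n => exp (- (2 ^ n * c))) 0.
Proof.
  intros Hc. assert (Hx := exp_neg_bounds c Hc).
  apply is_lim_seq_le_le with (fun _ => 0) (fun n => exp (- c) ^ n).
  - intros n. split; [left; apply exp_pos|]. rewrite exp_pow. apply exp_le.
    assert (H := INR_le_pow2 n). nra.
  - apply is_lim_seq_const.
  - apply is_lim_seq_geom. rewrite Rabs_pos_eq; lra.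
Qed.

(** Only the terms with k^2 + b k = 0 survive as the nome tends to 0. *)
Lemma theta_lim e (b : Z) y s : 0 < y -> (forall k, 0 <= k * k + b * k)%Z ->
  has_sum (fun k => if Z.eq_dec (k * k + b * k) 0 then sg e k else 0) s ->
  is_lim_seq (fun n => theta e (2 ^ n * y) (IZR b * (2 ^ n * y))) s.
Proof.
  intros Hy Hb Hs.
  assert (Hp : forall n, 0 < 2 ^ n * y)
    by (intros n; apply Rmult_lt_0_compat; [apply pow_lt|]; lra).
  destruct (has_sum_abs _ _ (theta_has_sum e y (IZR b * y) Hy)) as [G HG].
  assert (E : forall Y k, gterm e Y (IZR b * Y) k = sg e k * exp (- (Y * IZR (k * k + b * k)))).
  { intros Y k. unfold gterm. rewrite plus_IZR, !mult_IZR. f_equal. f_equal. ring. }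
  refine (has_sum_tannery _ _ (fun k => Rabs (gterm e y (IZR b * y) k)) _ _ G _ HG _
    (fun n => theta_has_sum e _ _ (Hp n)) Hs).
  - intros n k. rewrite !E, !Rabs_mult, !Rabs_sg, !Rmult_1_l,
      !Rabs_pos_eq by (left; apply exp_pos).
    apply exp_le. assert (H := IZR_le _ _ (Hb k)). assert (H1 := pow_R1_Rle 2 n ltac:(lra)).
    set (m := IZR (k * k + b * k)) in *.
    assert (0 <= (2 ^ n - 1) * (y * m)); [|lra].
    apply Rmult_le_pos; [lra|apply Rmult_le_pos; lra].
  - intros k. destruct (Z.eq_dec (k * k + b * k) 0) as [Hk|Hk].
    + apply is_lim_seq_ext with (fun _ => sg e k); [|apply is_lim_seq_const].
      intros n. rewrite E, Hk, Rmult_0_r, Ropp_0, exp_0. ring.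
    + apply is_lim_seq_ext with
        (fun n => sg e k * exp (- (2 ^ n * (y * IZR (k * k + b * k))))).
      * intros n. rewrite E. f_equal. f_equal. ring.
      * replace (Finite 0) with (Finite (sg e k * 0)) by (f_equal; ring).
        apply is_lim_seq_mult'; [apply is_lim_seq_const|].
        apply is_lim_seq_exp_pow2. apply Rmult_lt_0_compat; [exact Hy|].
        apply IZR_lt. specialize (Hb k). lia.
Qed.

Lemma theta0_lim e y : 0 < y -> is_lim_seq (fun n => theta e (2 ^ n * y) 0) 1.
Proof.
  intros Hy.
  apply is_lim_seq_ext with (fun n => theta e (2 ^ n * y) (IZR 0 * (2 ^ n * y))).
  - intros n. f_equal. ring.
  - apply theta_lim; [exact Hy|intros; nia|].
    set (f := fun k => if Z.eq_dec (k * k + 0 * k) 0 then sg e k else 0).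
    replace 1 with (f 0%Z).
    + apply has_sum_single. intros k Hk. unfold f.
      destruct (Z.eq_dec (k * k + 0 * k) 0); [nia|reflexivity].
    + unfold f. simpl. unfold sg. rewrite Bool.andb_false_r. reflexivity.
Qed.

Lemma theta2_lim y : 0 < y -> is_lim_seq (fun n => theta false (2 ^ n * y) (2 ^ n * y)) 2.
Proof.
  intros Hy.
  apply is_lim_seq_ext with (fun n => theta false (2 ^ n * y) (IZR 1 * (2 ^ n * y))).
  - intros n. f_equal. ring.
  - apply theta_lim; [exact Hy|intros; nia|].
    set (f := fun k : Z => if Z.eq_dec k 0 then 1 else 0).
    set (g := fun k : Z => if Z.eq_dec k (-1) then 1 else 0).
    apply has_sum_ext with (fun k => f k + g k).
    + intros k. unfold f, g, sg. simpl andb. cbv iota.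
      destruct (Z.eq_dec (k * k + 1 * k) 0) as [H|H].
      * assert (D : (k = 0 \/ k = -1)%Z) by nia. destruct D as [-> | ->]; simpl; ring.
      * destruct (Z.eq_dec k 0); [subst; lia|]. destruct (Z.eq_dec k (-1)); [subst; lia|]. ring.
    + replace 2 with (f 0%Z + g (-1)%Z) by (unfold f, g; simpl; ring).
      apply has_sum_plus; apply has_sum_single; intros k Hk; unfold f, g.
      * destruct (Z.eq_dec k 0); [contradiction|reflexivity].
      * destruct (Z.eq_dec k (-1)); [contradiction|reflexivity].
Qed.

(** * The complete elliptic integral at the theta modulus *)

Lemma t_sq_pos y : 0 < y -> 0 < t2 y ^ 2 /\ 0 < t3 y ^ 2 /\ 0 < t4 y ^ 2.
Proof.
  intros Hy. destruct (t_pos y Hy) as [H2 [H3 H4]]. repeat split; apply pow_lt; assumption.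
Qed.

Lemma agmI_t34_double y : 0 < y ->
  agmI (t3 y ^ 2) (t4 y ^ 2) = agmI (t3 (2 * y) ^ 2) (t4 (2 * y) ^ 2).
Proof.
  intros Hy. destruct (t_sq_pos y Hy) as [_ [H3 H4]].
  rewrite agmI_gauss by assumption. f_equal.
  - rewrite t3_sq_double, t4_sq_double by exact Hy. field.
  - rewrite <- Rpow_mult_distr, sqrt_pow2, t3_t4_double; [reflexivity|exact Hy|].
    destruct (t_pos y Hy) as [_ [h3 h4]]. nra.
Qed.

(** The AGM steps y, 2 y, 4 y, ... carry both arguments to 1. *)
Lemma agmI_t34 y : 0 < y -> agmI (t3 y ^ 2) (t4 y ^ 2) = PI / 2.
Proof.
  intros Hy.
  assert (Hp : forall n, 0 < 2 ^ n * y)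
    by (intros n; apply Rmult_lt_0_compat; [apply pow_lt|]; lra).
  assert (HI : forall n, agmI (t3 y ^ 2) (t4 y ^ 2)
    = agmI (t3 (2 ^ n * y) ^ 2) (t4 (2 ^ n * y) ^ 2)).
  { induction n as [|n IH].
    - simpl. rewrite Rmult_1_l. reflexivity.
    - rewrite IH, agmI_t34_double by apply Hp. simpl. rewrite Rmult_assoc. reflexivity. }
  assert (HB : forall n, PI / 2 / t3 (2 ^ n * y) ^ 2 <= agmI (t3 y ^ 2) (t4 y ^ 2)
    <= PI / 2 / t4 (2 ^ n * y) ^ 2).
  { intros n. rewrite (HI n). destruct (t_sq_pos _ (Hp n)) as [_ [h3 h4]].
    assert (Hle : t4 (2 ^ n * y) ^ 2 <= t3 (2 ^ n * y) ^ 2).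
    { rewrite t3_sq_double, t4_sq_double by apply Hp.
      destruct (t_sq_pos (2 * (2 ^ n * y)) ltac:(specialize (Hp n); lra)) as [h _]. lra. }
    apply agmI_bounds; lra. }
  assert (L3 := theta0_lim false y Hy). assert (L4 := theta0_lim true y Hy).
  assert (L : is_lim_seq (fun _ => agmI (t3 y ^ 2) (t4 y ^ 2)) (PI / 2)).
  { apply is_lim_seq_le_le with (1 := HB).
    - replace (Finite (PI / 2)) with (Finite (PI / 2 / 1 ^ 2)) by (f_equal; field).
      apply is_lim_seq_div'; [apply is_lim_seq_const| |lra].
      apply is_lim_seq_sq; exact L3.
    - replace (Finite (PI / 2)) with (Finite (PI / 2 / 1 ^ 2)) by (f_equal; field).
      apply is_lim_seq_div'; [apply is_lim_seq_const| |lra].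
      apply is_lim_seq_sq; exact L4. }
  apply (is_lim_seq_eq _ _ _ (is_lim_seq_const _) L).
Qed.

Lemma agmI_t32_double y : 0 < y ->
  agmI (t3 (2 * y) ^ 2) (t2 (2 * y) ^ 2) = 2 * agmI (t3 y ^ 2) (t2 y ^ 2).
Proof.
  intros Hy. assert (H2y : 0 < 2 * y) by lra.
  destruct (t_sq_pos (2 * y) H2y) as [H2 [H3 _]].
  destruct (t_sq_pos y Hy) as [h2 [h3 _]].
  rewrite agmI_gauss by assumption.
  replace ((t3 (2 * y) ^ 2 + t2 (2 * y) ^ 2) / 2) with (/ 2 * t3 y ^ 2)
    by (rewrite t3_sq_double by exact Hy; field).
  replace (sqrt (t3 (2 * y) ^ 2 * t2 (2 * y) ^ 2)) with (/ 2 * t2 y ^ 2).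
  - rewrite agmI_scal by lra. field.
  - rewrite <- Rpow_mult_distr, sqrt_pow2.
    + rewrite t2_double by exact Hy. field.
    + destruct (t_pos _ H2y) as [a2 [a3 _]]. nra.
Qed.

Lemma is_lim_seq_inv_pow2 : is_lim_seq (fun n => / 2 ^ n) 0.
Proof.
  apply is_lim_seq_ext with (fun n => (/ 2) ^ n).
  - intros n. apply pow_inv.
  - apply is_lim_seq_geom. rewrite Rabs_pos_eq; lra.
Qed.

Lemma is_lim_seq_bounded_over_pow2 u (l : R) :
  is_lim_seq u l -> is_lim_seq (fun n => u n * / 2 ^ n) 0.
Proof.
  intros Hu. replace (Finite 0) with (Finite (l * 0)) by (f_equal; ring).
  apply is_lim_seq_mult'; [exact Hu|apply is_lim_seq_inv_pow2].
Qed.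

Lemma is_lim_seq_ln u (l : R) : 0 < l -> is_lim_seq u l ->
  is_lim_seq (fun n => ln (u n)) (ln l).
Proof.
  intros Hl Hu. apply (is_lim_seq_continuous ln); [|exact Hu].
  apply derivable_continuous_pt. exists (/ l). apply derivable_pt_lim_ln, Hl.
Qed.

Lemma is_lim_seq_sqrt u (l : R) : 0 < l -> is_lim_seq u l ->
  is_lim_seq (fun n => sqrt (u n)) (sqrt l).
Proof.
  intros Hl Hu. apply (is_lim_seq_continuous sqrt); [|exact Hu].
  apply continuity_pt_sqrt. lra.
Qed.

(** The value at 2^n y is 2^n times the value at y, while it is asymptotic to
    - log (t2^2 / t3^2) = 2^n y / 2 + O(1); division by 2^n removes the bounded
    part. *)
Lemma agmI_t32 y : 0 < y -> agmI (t3 y ^ 2) (t2 y ^ 2) = y / 2.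
Proof.
  intros Hy.
  assert (Hp : forall n, 0 < 2 ^ n * y)
    by (intros n; apply Rmult_lt_0_compat; [apply pow_lt|]; lra).
  assert (HI : forall n, agmI (t3 (2 ^ n * y) ^ 2) (t2 (2 ^ n * y) ^ 2)
    = 2 ^ n * agmI (t3 y ^ 2) (t2 y ^ 2)).
  { induction n as [|n IH].
    - simpl. rewrite !Rmult_1_l. reflexivity.
    - simpl (2 ^ S n). rewrite !Rmult_assoc, agmI_t32_double by apply Hp. rewrite IH. ring. }
  set (J := agmI (t3 y ^ 2) (t2 y ^ 2)) in *.
  set (a := fun n => t3 (2 ^ n * y)). set (c := fun n => theta false (2 ^ n * y) (2 ^ n * y)).
  set (b := fun n => t2 (2 ^ n * y) ^ 2 / t3 (2 ^ n * y) ^ 2).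
  set (B := fun n => sqrt (1 - b n ^ 2)).
  assert (La : is_lim_seq a 1) by apply (theta0_lim false y Hy).
  assert (Lc : is_lim_seq c 2) by apply (theta2_lim y Hy).
  assert (Ha : forall n, 0 < a n) by (intros n; apply t_pos, Hp).
  assert (Hc : forall n, 0 < c n) by (intros n; apply theta_false_pos, Hp).
  assert (Hb : forall n, 0 < b n < 1).
  { intros n. unfold b. destruct (t_pos _ (Hp n)) as [h2 [h3 h4]].
    assert (Q := jacobi_quartic _ (Hp n)).
    assert (0 < t4 (2 ^ n * y) ^ 4) by (apply pow_lt; exact h4).
    assert (t2 (2 ^ n * y) ^ 2 < t3 (2 ^ n * y) ^ 2) by nra.
    split; [apply Rdiv_lt_0_compat; apply pow_lt; assumption|].
    apply Rmult_lt_reg_r with (t3 (2 ^ n * y) ^ 2); [apply pow_lt; assumption|].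
    unfold Rdiv. rewrite Rmult_assoc, Rinv_l by (apply pow_nonzero; lra). lra. }
  assert (Hlnb : forall n, ln (b n) = - (2 ^ n * y / 2) + 2 * ln (c n) - 2 * ln (a n)).
  { intros n. unfold b. destruct (t_pos _ (Hp n)) as [h2 [h3 h4]].
    unfold Rdiv. rewrite ln_mult, ln_Rinv by (try apply Rinv_0_lt_compat; apply pow_lt; assumption).
    rewrite !ln_pow by assumption. simpl INR.
    replace (ln (t2 (2 ^ n * y))) with (- (2 ^ n * y / 4) + ln (c n)).
    - unfold a. field.
    - unfold t2. rewrite ln_mult, ln_exp by (try apply exp_pos; apply Hc). reflexivity. }
  assert (Lb : is_lim_seq b 0).
  { apply is_lim_seq_ext with (fun n => exp (- (2 ^ n * (y / 2))) * (c n * c n) / (a n * a n)).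
    - intros n. unfold b, t2. fold (a n) (c n). rewrite Rpow_mult_distr, exp_pow.
      replace (INR 2 * - (2 ^ n * y / 4)) with (- (2 ^ n * (y / 2))) by (simpl; field).
      assert (H := Ha n). field. lra.
    - replace (Finite 0) with (Finite (0 * (2 * 2) / (1 * 1))) by (f_equal; field).
      apply is_lim_seq_div'; [|apply is_lim_seq_mult'; exact La|lra].
      apply is_lim_seq_mult'; [apply is_lim_seq_exp_pow2; lra|apply is_lim_seq_mult'; exact Lc]. }
  assert (LB : is_lim_seq B 1).
  { replace (Finite 1) with (Finite (sqrt (1 - 0 ^ 2))) 
      by (f_equal; replace (1 - 0 ^ 2) with 1 by ring; exact sqrt_1).
    apply is_lim_seq_sqrt; [lra|]. apply is_lim_seq_minus'; [apply is_lim_seq_const|].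
    apply is_lim_seq_sq; exact Lb. }
  assert (HB : forall n, 0 < B n) by (intros n; apply sqrt_lt_R0; specialize (Hb n); nra).
  set (u := fun n => (ln (1 + B n) - ln (b n)) / B n).
  assert (HJ : forall n, u n * / (a n * a n) * / 2 ^ n <= J
     <= u n * / (a n * a n) * / 2 ^ n + PI / 2 / B n * / (a n * a n) * / 2 ^ n).
  { intros n. destruct (agmI_log_bounds (b n) (Hb n)) as [H1 H2]. fold (B n) in H1, H2.
    fold (u n) in H1, H2.
    assert (E : agmI (t3 (2 ^ n * y) ^ 2) (t2 (2 ^ n * y) ^ 2) = / (a n * a n) * agmI 1 (b n)).
    { replace (a n * a n) with (a n ^ 2) by ring.
      rewrite <- agmI_scal; [|apply pow_lt, Ha|lra|apply Hb].
      f_equal; [unfold a; ring|]. unfold b. fold (a n). assert (H := Ha n). field. lra. }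
    rewrite HI in E.
    assert (E2 : J = agmI 1 (b n) * / (a n * a n) * / 2 ^ n).
    { assert (H2n : 2 ^ n <> 0) by (apply pow_nonzero; lra).
      transitivity (2 ^ n * J * / 2 ^ n); [field; exact H2n|]. rewrite E. ring. }
    assert (P1 : 0 < / (a n * a n)) by (apply Rinv_0_lt_compat; specialize (Ha n); nra).
    assert (P2 : 0 < / 2 ^ n) by (apply Rinv_0_lt_compat, pow_lt; lra).
    rewrite E2, <- !Rmult_plus_distr_r. split; apply Rmult_le_compat_r; try lra;
      apply Rmult_le_compat_r; lra. }
  assert (Lu : is_lim_seq (fun n => u n * / (a n * a n) * / 2 ^ n) (y / 2)).
  { apply is_lim_seq_ext with (fun n =>
      (ln (1 + B n) * / 2 ^ n + y / 2 - 2 * (ln (c n) * / 2 ^ n) + 2 * (ln (a n) * / 2 ^ n))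
      / (B n * (a n * a n))).
    - intros n. unfold u. rewrite Hlnb. assert (h1 := HB n). assert (h2 := Ha n).
      assert (h3 : 2 ^ n <> 0) by (apply pow_nonzero; lra). field. repeat split; lra.
    - replace (Finite (y / 2)) with (Finite ((0 + y / 2 - 2 * 0 + 2 * 0) / (1 * (1 * 1)))) by (f_equal; field).
      apply is_lim_seq_div'; [| |lra].
      + apply is_lim_seq_plus'; [apply is_lim_seq_minus'; [apply is_lim_seq_plus'|]|].
        * apply (is_lim_seq_bounded_over_pow2 _ (ln (1 + 1))), is_lim_seq_ln; [lra|].
          apply is_lim_seq_plus'; [apply is_lim_seq_const|exact LB].
        * apply is_lim_seq_const.
        * apply is_lim_seq_mult'; [apply is_lim_seq_const|].
          apply (is_lim_seq_bounded_over_pow2 _ (ln 2)), is_lim_seq_ln; [lra|exact Lc].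
        * apply is_lim_seq_mult'; [apply is_lim_seq_const|].
          apply (is_lim_seq_bounded_over_pow2 _ (ln 1)), is_lim_seq_ln; [lra|exact La].
      + apply is_lim_seq_mult'; [exact LB|apply is_lim_seq_mult'; exact La]. }
  assert (Lv : is_lim_seq (fun n => u n * / (a n * a n) * / 2 ^ n
      + PI / 2 / B n * / (a n * a n) * / 2 ^ n) (y / 2)).
  { replace (Finite (y / 2)) with (Finite (y / 2 + 0)) by (f_equal; ring). apply is_lim_seq_plus'; [exact Lu|].
    apply (is_lim_seq_bounded_over_pow2 _ (PI / 2 / 1 * / (1 * 1))).
    apply is_lim_seq_ext with (fun n => PI / 2 / B n / (a n * a n)); [reflexivity|].
    apply is_lim_seq_div'; [|apply is_lim_seq_mult'; exact La|lra].
    apply is_lim_seq_div'; [apply is_lim_seq_const|exact LB|lra]. }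
  apply (is_lim_seq_eq (fun _ => J)); [apply is_lim_seq_const|].
  apply is_lim_seq_le_le with (1 := HJ); assumption.
Qed.

Definition kmod (y : R) : R := t2 y ^ 2 / t3 y ^ 2.

Lemma kmod_bounds y : 0 < y -> 0 < kmod y < 1.
Proof.
  intros Hy. unfold kmod. destruct (t_pos _ Hy) as [h2 [h3 h4]].
  assert (Q := jacobi_quartic _ Hy).
  assert (0 < t4 y ^ 4) by (apply pow_lt; exact h4).
  assert (t2 y ^ 2 < t3 y ^ 2) by nra.
  split; [apply Rdiv_lt_0_compat; apply pow_lt; assumption|].
  apply Rmult_lt_reg_r with (t3 y ^ 2); [apply pow_lt; assumption|].
  unfold Rdiv. rewrite Rmult_assoc, Rinv_l by (apply pow_nonzero; lra). lra.
Qed.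

Lemma kmod_compl y : 0 < y -> sqrt (1 - kmod y ^ 2) = t4 y ^ 2 / t3 y ^ 2.
Proof.
  intros Hy. destruct (t_sq_pos _ Hy) as [h2 [h3 h4]]. assert (Q := jacobi_quartic _ Hy).
  rewrite <- (sqrt_pow2 (t4 y ^ 2 / t3 y ^ 2)) by (apply Rdiv_le_0_compat; lra).
  f_equal. unfold kmod.
  assert (t3 y <> 0) by (intros E; rewrite E in h3; simpl in h3; lra).
  field_simplify_eq; [|assumption]. rewrite Q. ring.
Qed.

Lemma ellipticK_agmI k : 0 <= k < 1 -> ellipticK k = agmI 1 (sqrt (1 - k ^ 2)).
Proof.
  intros Hk. unfold ellipticK, agmI. apply RInt_ext. intros t _. unfold agmf.
  rewrite pow2_sqrt by nra. rewrite cos_sq. unfold Rdiv. rewrite Rmult_1_l.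
  f_equal. f_equal. ring.
Qed.

Lemma ellipticK_kmod y : 0 < y -> ellipticK (kmod y) = PI / 2 * t3 y ^ 2.
Proof.
  intros Hy. assert (Hk := kmod_bounds y Hy). destruct (t_sq_pos _ Hy) as [h2 [h3 h4]].
  rewrite ellipticK_agmI, kmod_compl, <- (agmI_t34 y Hy) by lra.
  replace (t4 y ^ 2) with (t3 y ^ 2 * (t4 y ^ 2 / t3 y ^ 2)) at 2
    by (field; intros E; rewrite E in h3; simpl in h3; lra).
  replace (agmI (t3 y ^ 2)) with (agmI (t3 y ^ 2 * 1)) by (f_equal; ring).
  rewrite agmI_scal; [|lra|lra|apply Rdiv_lt_0_compat; lra].
  field. intros E; rewrite E in h3; simpl in h3; lra.
Qed.

Lemma ellipticK_compl_kmod y : 0 < y -> ellipticK (sqrt (1 - kmod y ^ 2)) = y / 2 * t3 y ^ 2.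
Proof.
  intros Hy. assert (Hk := kmod_bounds y Hy). destruct (t_sq_pos _ Hy) as [h2 [h3 h4]].
  assert (H1 : 0 <= 1 - kmod y ^ 2) by nra.
  rewrite ellipticK_agmI.
  - rewrite pow2_sqrt by exact H1.
    replace (1 - (1 - kmod y ^ 2)) with (kmod y ^ 2) by ring. rewrite sqrt_pow2 by lra.
    rewrite <- (agmI_t32 y Hy).
    replace (t2 y ^ 2) with (t3 y ^ 2 * kmod y)
      by (unfold kmod; field; intros E; rewrite E in h3; simpl in h3; lra).
    replace (agmI (t3 y ^ 2)) with (agmI (t3 y ^ 2 * 1)) by (f_equal; ring).
    rewrite agmI_scal; [|lra|lra|lra].
    field. intros E; rewrite E in h3; simpl in h3; lra.
  - split; [apply sqrt_pos|]. rewrite <- sqrt_1 at 2. apply sqrt_lt_1; nra.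
Qed.

Lemma ellipticK_lt k1 k2 : 0 <= k1 -> k1 < k2 -> k2 < 1 -> ellipticK k1 < ellipticK k2.
Proof.
  intros H0 H1 H2. rewrite !ellipticK_agmI by lra.
  set (a := sqrt (1 - k1 ^ 2)). set (b := sqrt (1 - k2 ^ 2)).
  assert (Ha : 0 < a) by (apply sqrt_lt_R0; nra). assert (Hb : 0 < b) by (apply sqrt_lt_R0; nra).
  assert (Hab : b ^ 2 < a ^ 2) by (unfold a, b; rewrite !pow2_sqrt by nra; nra).
  assert (HP := PI_RGT_0).
  apply RInt_lt; [lra|intros; apply agmf_continuous; lra|intros; apply agmf_continuous; lra|].
  intros t Ht. unfold agmf.
  assert (Hs : 0 < sin t) by (apply sin_gt_0; lra).
  assert (Q := quad_pos (1 ^ 2) (b ^ 2) t ltac:(lra) ltac:(apply pow_lt; lra)).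
  assert (Hs2 : 0 < sin t ^ 2) by (apply pow_lt; exact Hs).
  apply Rinv_lt_contravar.
  - apply Rmult_lt_0_compat; apply sqrt_lt_R0; nra.
  - apply sqrt_lt_1_alt. nra.
Qed.

Lemma ellipticK_pos k : 0 <= k < 1 -> 0 < ellipticK k.
Proof.
  intros Hk. rewrite ellipticK_agmI by exact Hk.
  assert (Hb : 0 < sqrt (1 - k ^ 2)) by (apply sqrt_lt_R0; nra).
  assert (Hb1 : sqrt (1 - k ^ 2) <= 1) by (rewrite <- sqrt_1 at 2; apply sqrt_le_1_alt; nra).
  assert (H := agmI_bounds 1 (sqrt (1 - k ^ 2)) _ 1 Hb ltac:(lra) ltac:(lra)).
  assert (HP := PI_RGT_0). lra.
Qed.

Definition Kratio (k : R) : R := ellipticK (sqrt (1 - k ^ 2)) / ellipticK k.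

Lemma compl_bounds k : 0 < k < 1 -> 0 < sqrt (1 - k ^ 2) < 1.
Proof.
  intros Hk. split; [apply sqrt_lt_R0; nra|]. rewrite <- sqrt_1 at 2. apply sqrt_lt_1; nra.
Qed.

Lemma Kratio_lt k1 k2 : 0 < k1 -> k1 < k2 -> k2 < 1 -> Kratio k2 < Kratio k1.
Proof.
  intros H0 H1 H2. unfold Kratio.
  assert (A1 := compl_bounds k1 ltac:(lra)). assert (A2 := compl_bounds k2 ltac:(lra)).
  assert (h1 : ellipticK k1 < ellipticK k2) by (apply ellipticK_lt; lra).
  assert (h2 : ellipticK (sqrt (1 - k2 ^ 2)) < ellipticK (sqrt (1 - k1 ^ 2))).
  { apply ellipticK_lt; [lra|apply sqrt_lt_1; nra|lra]. }
  assert (p1 := ellipticK_pos k1 ltac:(lra)). assert (p2 := ellipticK_pos k2 ltac:(lra)).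
  assert (p3 := ellipticK_pos (sqrt (1 - k2 ^ 2)) ltac:(lra)).
  apply Rmult_lt_reg_r with (ellipticK k1 * ellipticK k2); [nra|].
  replace (ellipticK (sqrt (1 - k2 ^ 2)) / ellipticK k2 * (ellipticK k1 * ellipticK k2))
    with (ellipticK (sqrt (1 - k2 ^ 2)) * ellipticK k1) by (field; lra).
  replace (ellipticK (sqrt (1 - k1 ^ 2)) / ellipticK k1 * (ellipticK k1 * ellipticK k2))
    with (ellipticK (sqrt (1 - k1 ^ 2)) * ellipticK k2) by (field; lra).
  apply Rmult_gt_0_lt_compat; lra.
Qed.

Lemma Kratio_inj k1 k2 : 0 < k1 < 1 -> 0 < k2 < 1 -> Kratio k1 = Kratio k2 -> k1 = k2.
Proof.
  intros H1 H2 E. destruct (Rtotal_order k1 k2) as [H|[H|H]]; [|exact H|].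
  - assert (h := Kratio_lt k1 k2 ltac:(lra) H ltac:(lra)). lra.
  - assert (h := Kratio_lt k2 k1 ltac:(lra) H ltac:(lra)). lra.
Qed.

Lemma Kratio_pos k : 0 < k < 1 -> 0 < Kratio k.
Proof.
  intros H. assert (A1 := compl_bounds k H). apply Rdiv_lt_0_compat; apply ellipticK_pos; lra.
Qed.

Lemma Kratio_kmod y : 0 < y -> Kratio (kmod y) = y / PI.
Proof.
  intros Hy. unfold Kratio. rewrite ellipticK_kmod, ellipticK_compl_kmod by exact Hy.
  destruct (t_sq_pos _ Hy) as [h2 [h3 h4]]. assert (HP := PI_RGT_0).
  field. split; [lra|]. intros E; rewrite E in h3; simpl in h3; lra.
Qed.

Lemma singular_modulus_unique r k : 0 < k < 1 -> Kratio k = sqrt r -> singular_modulus r = k.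
Proof.
  intros Hk Hr.
  assert (H : 0 < singular_modulus r < 1 /\
    ellipticK (sqrt (1 - singular_modulus r ^ 2)) / ellipticK (singular_modulus r) = sqrt r).
  { unfold singular_modulus. apply epsilon_spec. exists k. split; [exact Hk|exact Hr]. }
  destruct H as [H1 H2]. apply Kratio_inj; [exact H1|exact Hk|].
  unfold Kratio at 1. rewrite H2, Hr. reflexivity.
Qed.

Theorem singular_modulus_kmod r : 0 < r -> singular_modulus r = kmod (PI * sqrt r).
Proof.
  intros Hr. assert (HP := PI_RGT_0). assert (Hs := sqrt_lt_R0 r Hr).
  assert (Hy : 0 < PI * sqrt r) by nra.
  apply singular_modulus_unique; [apply kmod_bounds, Hy|].
  rewrite Kratio_kmod by exact Hy. field. lra.
Qed.

Lemma inv_singular_modulus_spec x : 0 < x < 1 ->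
  0 < inv_singular_modulus x /\ singular_modulus (inv_singular_modulus x) = x.
Proof.
  intros Hx. unfold inv_singular_modulus. apply epsilon_spec.
  assert (H := Kratio_pos x Hx). exists (Kratio x ^ 2). split; [apply pow_lt, H|].
  apply singular_modulus_unique; [exact Hx|]. rewrite sqrt_pow2; lra.
Qed.

(** * The imaginary transformation *)

Lemma pi2_over_pos y : 0 < y -> 0 < PI ^ 2 / y.
Proof. intros Hy. apply Rdiv_lt_0_compat; [apply pow_lt, PI_RGT_0|exact Hy]. Qed.

(** Both moduli have the ratio K' / K equal to pi / y. *)
Lemma kmod_imaginary y : 0 < y -> kmod (PI ^ 2 / y) = sqrt (1 - kmod y ^ 2).
Proof.
  intros Hy. assert (HP := PI_RGT_0). assert (Hk := kmod_bounds y Hy).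
  apply Kratio_inj; [apply kmod_bounds, pi2_over_pos, Hy|apply compl_bounds, Hk|].
  rewrite Kratio_kmod by (apply pi2_over_pos, Hy). unfold Kratio.
  rewrite pow2_sqrt by nra. replace (1 - (1 - kmod y ^ 2)) with (kmod y ^ 2) by ring.
  rewrite sqrt_pow2 by lra. rewrite ellipticK_kmod, ellipticK_compl_kmod by exact Hy.
  destruct (t_sq_pos _ Hy) as [h2 [h3 h4]].
  field. repeat split; try lra. intros E; rewrite E in h3; simpl in h3; lra.
Qed.

Lemma t3_imaginary_sq y : 0 < y -> t3 (PI ^ 2 / y) ^ 2 = y / PI * t3 y ^ 2.
Proof.
  intros Hy. assert (HP := PI_RGT_0).
  assert (H := ellipticK_kmod _ (pi2_over_pos y Hy)).
  rewrite kmod_imaginary, ellipticK_compl_kmod in H by exact Hy.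
  apply Rmult_eq_reg_l with (PI / 2); [|lra]. rewrite <- H. field. lra.
Qed.

Lemma t2_imaginary_sq y : 0 < y -> t2 (PI ^ 2 / y) ^ 2 = y / PI * t4 y ^ 2.
Proof.
  intros Hy. assert (HP := PI_RGT_0).
  assert (H := kmod_imaginary y Hy). rewrite kmod_compl in H by exact Hy. unfold kmod in H.
  destruct (t_sq_pos _ Hy) as [_ [h3 _]].
  destruct (t_sq_pos _ (pi2_over_pos y Hy)) as [_ [g3 _]].
  replace (t2 (PI ^ 2 / y) ^ 2)
    with (t2 (PI ^ 2 / y) ^ 2 / t3 (PI ^ 2 / y) ^ 2 * t3 (PI ^ 2 / y) ^ 2)
    by (field; intros E; rewrite E in g3; simpl in g3; lra).
  rewrite H, t3_imaginary_sq by exact Hy. field.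
  split; [lra|intros E; rewrite E in h3; simpl in h3; lra].
Qed.

Lemma pi2_invol y : 0 < y -> PI ^ 2 / (PI ^ 2 / y) = y.
Proof. intros Hy. assert (HP := PI_RGT_0). field. lra. Qed.

Lemma t4_imaginary_sq y : 0 < y -> t4 (PI ^ 2 / y) ^ 2 = y / PI * t2 y ^ 2.
Proof.
  intros Hy. assert (HP := PI_RGT_0).
  assert (H := t2_imaginary_sq _ (pi2_over_pos y Hy)). rewrite pi2_invol in H by exact Hy.
  rewrite H. field. lra.
Qed.

Lemma sq_eq_sqrt u v c : 0 < u -> 0 < v -> 0 < c -> u ^ 2 = c * v ^ 2 -> u = sqrt c * v.
Proof.
  intros Hu Hv Hc H. rewrite <- (sqrt_pow2 u), H by lra.
  rewrite sqrt_mult, sqrt_pow2 by (try apply pow2_ge_0; lra). reflexivity.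
Qed.

(** On the imaginary axis of the upper half-plane y -> pi^2 / y is
    tau -> -1 / tau, under which theta constants have weight 1/2. *)
Definition imaginary_dual (t t' : R -> R) : Prop :=
  forall y, 0 < y -> t (PI ^ 2 / y) = sqrt (y / PI) * t' y.

Lemma t2_imaginary : imaginary_dual t2 t4.
Proof.
  intros y Hy. assert (HP := PI_RGT_0).
  apply sq_eq_sqrt; [apply t_pos, pi2_over_pos, Hy|apply t_pos, Hy|apply Rdiv_lt_0_compat; lra|].
  apply t2_imaginary_sq, Hy.
Qed.

Lemma t3_imaginary : imaginary_dual t3 t3.
Proof.
  intros y Hy. assert (HP := PI_RGT_0).
  apply sq_eq_sqrt; [apply t_pos, pi2_over_pos, Hy|apply t_pos, Hy|apply Rdiv_lt_0_compat; lra|].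
  apply t3_imaginary_sq, Hy.
Qed.

Lemma t4_imaginary : imaginary_dual t4 t2.
Proof.
  intros y Hy. assert (HP := PI_RGT_0).
  apply sq_eq_sqrt; [apply t_pos, pi2_over_pos, Hy|apply t_pos, Hy|apply Rdiv_lt_0_compat; lra|].
  apply t4_imaginary_sq, Hy.
Qed.

Lemma dual_at_fifth t t' y : imaginary_dual t t' -> 0 < y ->
  let Y := PI ^ 2 / (5 * y) in
  0 < Y /\ 0 < sqrt (y / PI) /\
  t Y = sqrt 5 * sqrt (y / PI) * t' (5 * y) /\ t (5 * Y) = sqrt (y / PI) * t' y.
Proof.
  intros H Hy Y. assert (HP := PI_RGT_0).
  split; [apply pi2_over_pos; lra|]. split; [apply sqrt_lt_R0, Rdiv_lt_0_compat; lra|].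
  split.
  - unfold Y. rewrite H by lra. f_equal. rewrite <- sqrt_mult by (try apply Rdiv_le_0_compat; lra).
    f_equal. field. lra.
  - replace (5 * Y) with (PI ^ 2 / y) by (unfold Y; field; lra). apply H, Hy.
Qed.

(** The sextic identity at Y = pi^2 / (5 y): the imaginary transformation takes
    Y to 5 y and 5 Y to y. *)
Lemma sextic_dual t t' : imaginary_dual t t' -> degree5_sextic t -> forall y, 0 < y ->
  (5 * t' (5 * y) ^ 2 - t' y ^ 2) ^ 6 * t' y ^ 3 * (t2 (5 * y) * t3 (5 * y) * t4 (5 * y))
  = 256 * t' (5 * y) ^ 3 * (t2 y * t3 y * t4 y) ^ 5.
Proof.
  intros Hd Hs y Hy.
  destruct (dual_at_fifth t t' y Hd Hy) as [HY [Hl [E E5]]].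
  destruct (dual_at_fifth t2 t4 y t2_imaginary Hy) as [_ [_ [E2 E25]]].
  destruct (dual_at_fifth t3 t3 y t3_imaginary Hy) as [_ [_ [E3 E35]]].
  destruct (dual_at_fifth t4 t2 y t4_imaginary Hy) as [_ [_ [E4 E45]]].
  set (Y := PI ^ 2 / (5 * y)) in *. set (l := sqrt (y / PI)) in *.
  specialize (Hs Y HY). rewrite E, E5, E2, E25, E3, E35, E4, E45 in Hs.
  assert (Hf : sqrt 5 ^ 2 = 5) by (apply pow2_sqrt; lra).
  assert (Hf0 : 0 < sqrt 5) by (apply sqrt_lt_R0; lra).
  set (f := sqrt 5) in *.
  apply Rmult_eq_reg_l with (f ^ 3 * l ^ 18).
  - transitivity (((f * l * t' (5 * y)) ^ 2 - (l * t' y) ^ 2) ^ 6 * (l * t' y) ^ 3 *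
      (f * l * t4 (5 * y) * (f * l * t3 (5 * y)) * (f * l * t2 (5 * y)))).
    + replace ((f * l * t' (5 * y)) ^ 2) with (f ^ 2 * l ^ 2 * t' (5 * y) ^ 2) by ring.
      rewrite Hf. ring.
    + rewrite Hs. ring.
  - apply Rgt_not_eq, Rmult_lt_0_compat; apply pow_lt; lra.
Qed.

Lemma pow6_inj a b : 0 < a -> 0 < b -> a ^ 6 = b ^ 6 -> a = b.
Proof.
  intros Ha Hb H.
  assert (L : forall u v, 0 < u -> u < v -> u ^ 6 < v ^ 6).
  { intros u v Hu Huv. assert (h1 : u ^ 3 < v ^ 3).
    { assert (u ^ 2 < v ^ 2) by nra. simpl in *. nra. }
    assert (0 < u ^ 3) by (apply pow_lt; exact Hu).
    replace (u ^ 6) with (u ^ 3 * u ^ 3) by ring. replace (v ^ 6) with (v ^ 3 * v ^ 3) by ring. nra. }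
  destruct (Rtotal_order a b) as [h|[h|h]]; [|exact h|].
  - specialize (L a b Ha h). lra.
  - specialize (L b a Hb h). lra.
Qed.

Lemma sextic_root t T p p5 D G :
  0 < t -> 0 < T -> 0 < p -> 0 < p5 -> 0 < D -> 0 < G ->
  D ^ 6 * T ^ 3 * p = 256 * t ^ 3 * p5 ^ 5 ->
  G ^ 6 * t ^ 3 * p5 = 256 * T ^ 3 * p ^ 5 ->
  D * T * p = G * t * p5.
Proof.
  intros Ht HT Hp Hp5 HD HG E1 E2.
  apply pow6_inj; [repeat apply Rmult_lt_0_compat; lra|repeat apply Rmult_lt_0_compat; lra|].
  apply Rmult_eq_reg_l with 256; [|lra].
  transitivity ((D ^ 6 * T ^ 3 * p) * (256 * T ^ 3 * p ^ 5)); [ring|].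
  rewrite E1, <- E2. ring.
Qed.

(** * Degree 5 relations between theta constants *)

(** The sextic identity divided by its dual equates the sixth powers of two
    positive numbers. *)
Lemma degree5_relation t d y : 0 < y ->
  (forall u, 0 < u -> 0 < t u) -> (forall u, 0 < u -> d (5 * u) ^ 2 < d u ^ 2) ->
  imaginary_dual d t -> degree5_sextic t -> degree5_sextic d ->
  t y ^ 2 - t (5 * y) ^ 2 <> 0 ->
  Rabs (t y ^ 2 - t (5 * y) ^ 2) * t (5 * y) * (t2 y * t3 y * t4 y)
  = (5 * t (5 * y) ^ 2 - t y ^ 2) * t y * (t2 (5 * y) * t3 (5 * y) * t4 (5 * y)).
Proof.
  intros Hy Ht Hd Hdt St Sd HD. assert (H5 : 0 < 5 * y) by lra.
  destruct (t_pos y Hy) as [a2 [a3 a4]]. destruct (t_pos _ H5) as [b2 [b3 b4]].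
  destruct (dual_at_fifth d t y Hdt Hy) as [HY [Hl [E E5]]].
  assert (HG := Hd _ HY). rewrite E, E5 in HG.
  assert (Hf : sqrt 5 ^ 2 = 5) by (apply pow2_sqrt; lra).
  rewrite !Rpow_mult_distr, Hf in HG. set (l := sqrt (y / PI)) in *.
  assert (Hl2 : 0 < l ^ 2) by (apply pow_lt; exact Hl).
  assert (HG' : 0 < 5 * t (5 * y) ^ 2 - t y ^ 2) by nra.
  assert (Hp : 0 < t2 y * t3 y * t4 y)
    by (apply Rmult_lt_0_compat; [apply Rmult_lt_0_compat|]; assumption).
  assert (Hp5 : 0 < t2 (5 * y) * t3 (5 * y) * t4 (5 * y))
    by (apply Rmult_lt_0_compat; [apply Rmult_lt_0_compat|]; assumption).
  apply sextic_root; auto; [apply Rabs_pos_lt, HD| |apply (sextic_dual d); assumption].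
  specialize (St y Hy).
  replace (Rabs (t y ^ 2 - t (5 * y) ^ 2) ^ 6) with ((t y ^ 2 - t (5 * y) ^ 2) ^ 6); [exact St|].
  rewrite RPow_abs, Rabs_pos_eq; [reflexivity|].
  replace ((t y ^ 2 - t (5 * y) ^ 2) ^ 6) with (((t y ^ 2 - t (5 * y) ^ 2) ^ 3) ^ 2) by ring.
  apply pow2_ge_0.
Qed.

Theorem degree5_t3 y : 0 < y ->
  (t3 y ^ 2 - t3 (5 * y) ^ 2) * (t2 y * t4 y)
  = (5 * t3 (5 * y) ^ 2 - t3 y ^ 2) * (t2 (5 * y) * t4 (5 * y)).
Proof.
  intros Hy. assert (HD := t3_sq_gt y Hy).
  assert (P : forall u, 0 < u -> 0 < t3 u) by (intros u Hu; apply t_pos, Hu).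
  assert (R := degree5_relation t3 t3 y Hy P t3_sq_gt t3_imaginary t3_sextic t3_sextic ltac:(lra)).
  rewrite Rabs_pos_eq in R by lra.
  assert (p1 := P y Hy). assert (p2 := P (5 * y) ltac:(lra)).
  apply Rmult_eq_reg_l with (t3 y * t3 (5 * y)); [lra|apply Rgt_not_eq; nra].
Qed.

Theorem degree5_t4 y : 0 < y ->
  (t4 (5 * y) ^ 2 - t4 y ^ 2) * (t2 y * t3 y)
  = (5 * t4 (5 * y) ^ 2 - t4 y ^ 2) * (t2 (5 * y) * t3 (5 * y)).
Proof.
  intros Hy. assert (HD := t4_sq_lt y Hy).
  assert (P : forall u, 0 < u -> 0 < t4 u) by (intros u Hu; apply t_pos, Hu).
  assert (R := degree5_relation t4 t2 y Hy P t2_sq_gt t2_imaginary t4_sextic t2_sextic ltac:(lra)).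
  rewrite Rabs_left in R by lra.
  assert (p1 := P y Hy). assert (p2 := P (5 * y) ltac:(lra)).
  apply Rmult_eq_reg_l with (t4 y * t4 (5 * y)); [lra|apply Rgt_not_eq; nra].
Qed.

(** * The Rogers-Ramanujan continued fraction *)

Lemma rr_denom_ge1 q m n : 0 < q -> 1 <= rr_denom q m n.
Proof.
  intros Hq. revert m. induction n as [|n IH]; intros m; simpl; [lra|].
  assert (0 < q ^ m / rr_denom q (S m) n); [|lra].
  apply Rdiv_lt_0_compat; [apply pow_lt, Hq|]. specialize (IH (S m)). lra.
Qed.

(** Any positive solution of the three-term recurrence gives the value, because
    each step of the fraction is a contraction with factor q. *)
Lemma rr_denom_lim q (F : nat -> R) : 0 < q < 1 -> (forall n, (1 <= n)%nat -> 0 < F n) ->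
  (forall n, (1 <= n)%nat -> F n = F (S n) + q ^ n * F (S (S n))) ->
  is_lim_seq (rr_denom q 1) (F 1%nat / F 2%nat).
Proof.
  intros Hq HF Hrec.
  assert (Hy : forall m, (1 <= m)%nat -> F m / F (S m) = 1 + q ^ m / (F (S m) / F (S (S m)))).
  { intros m Hm. rewrite (Hrec m Hm) at 1.
    assert (h1 := HF (S m) ltac:(lia)). assert (h2 := HF (S (S m)) ltac:(lia)).
    field. lra. }
  assert (Hy1 : forall m, (1 <= m)%nat -> 1 <= F m / F (S m)).
  { intros m Hm. rewrite (Hy m Hm).
    assert (0 < q ^ m / (F (S m) / F (S (S m)))); [|lra].
    apply Rdiv_lt_0_compat; [apply pow_lt; lra|apply Rdiv_lt_0_compat; apply HF; lia]. }
  assert (HB : forall n m, (1 <= m)%nat -> Rabs (rr_denom q m n - F m / F (S m)) <= q ^ n).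
  { induction n as [|n IH]; intros m Hm.
    - simpl. rewrite (Hy m Hm). specialize (Hy1 (S m) ltac:(lia)).
      set (v := F (S m) / F (S (S m))) in *.
      assert (Hp := pow_bounds q m Hq).
      replace (1 - (1 + q ^ m / v)) with (- (q ^ m / v)) by ring.
      rewrite Rabs_Ropp, Rabs_pos_eq by (apply Rdiv_le_0_compat; lra).
      apply Rmult_le_reg_r with v; [lra|]. unfold Rdiv. rewrite Rmult_assoc, Rinv_l by lra. nra.
    - simpl rr_denom. rewrite (Hy m Hm). specialize (IH (S m) ltac:(lia)).
      specialize (Hy1 (S m) ltac:(lia)). assert (Hd := rr_denom_ge1 q (S m) n ltac:(lra)).
      set (v := F (S m) / F (S (S m))) in *. set (d := rr_denom q (S m) n) in *.
      replace (1 + q ^ m / d - (1 + q ^ m / v)) with (- (q ^ m * / (d * v) * (d - v)))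
        by (field; lra).
      rewrite Rabs_Ropp, Rabs_mult. simpl. apply Rmult_le_compat; try apply Rabs_pos; [|exact IH].
      assert (Hqm : q ^ m <= q).
      { destruct m as [|m]; [lia|]. simpl. assert (H := pow_bounds q m Hq). nra. }
      assert (Hi : 0 < / (d * v) <= 1).
      { split; [apply Rinv_0_lt_compat; nra|]. rewrite <- Rinv_1. apply Rinv_le_contravar; nra. }
      assert (Hqm0 := pow_lt q m ltac:(lra)).
      rewrite Rabs_pos_eq by nra. nra. }
  apply is_lim_seq_spec. intros [eps He]. simpl.
  assert (L : is_lim_seq (fun n => q ^ n) 0) by (apply is_lim_seq_geom; rewrite Rabs_pos_eq; lra).
  apply is_lim_seq_spec in L. destruct (L (mkposreal eps He)) as [N HN]. exists N.
  intros n Hn. specialize (HN n Hn). simpl in HN. specialize (HB n 1%nat (le_n _)).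
  rewrite Rminus_0_r, Rabs_pos_eq in HN by (apply pow_le; lra). lra.
Qed.

Lemma has_sum_shift (f : nat -> R) s :
  f O = 0 -> has_sum (fun r => f (S r)) s -> has_sum f s.
Proof.
  intros H0 Hs. replace s with (f O + s) by (rewrite H0; ring).
  apply (has_sum_reindex (fun x : unit + nat => match x with inl _ => O | inr r => S r end)).
  - intros [[]|a] [[]|a']; congruence || lia.
  - intros [|r]; [exists (inl tt)|exists (inr r)]; reflexivity.
  - apply has_sum_disjoint; [|exact Hs].
    apply (has_sum_single (fun _ : unit => f O) tt). intros [] H. contradiction.
Qed.

Lemma has_sum_inj_summable {S T} (e : S -> T) (f : T -> R) s :
  (forall a a', e a = e a' -> a = a') -> has_sum f s -> exists t, has_sum (fun a => f (e a)) t.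
Proof.
  intros He Hs. destruct (has_sum_abs f s Hs) as [M HM].
  destruct (has_sum_nonneg_bounded (fun a => Rabs (f (e a))) M) as [t Ht].
  - intros; apply Rabs_pos.
  - intros l Hl. rewrite <- (lsum_map e (fun b => Rabs (f b))).
    apply has_sum_ge_lsum; [intros; apply Rabs_pos|exact HM|].
    apply FinFun.Injective_map_NoDup; [exact He|exact Hl].
  - apply (has_sum_dominated _ (fun a => Rabs (f (e a))) t); [intros; lra|exact Ht].
Qed.

Lemma has_sum_fold (f : Z -> R) s :
  has_sum f s -> has_sum (fun r => f (Z.of_nat r) + f (- Z.of_nat r - 1)%Z) s.
Proof.
  intros Hs.
  destruct (has_sum_inj_summable Z.of_nat f s) as [s1 H1]; [intros; lia|exact Hs|].
  destruct (has_sum_inj_summable (fun r => - Z.of_nat r - 1)%Z f s) as [s2 H2];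
    [intros; lia|exact Hs|].
  rewrite (has_sum_unique f _ _ Hs (has_sum_halves f _ _ H1 H2)).
  apply has_sum_plus; assumption.
Qed.

Lemma sg_true_nat r : sg true (Z.of_nat r) = (-1) ^ r.
Proof.
  induction r as [|r IH]; [reflexivity|].
  rewrite Nat2Z.inj_succ, <- Z.add_1_r, sg_add, IH, sg_1. simpl. ring.
Qed.

(** ** Rogers' functions *)

Section Rogers.
Variable y : R.
Hypothesis Hy : 0 < y.

Let q := exp (- y).
Let e (u : R) := exp (- (y * u)).

(** 1 / (q; q)_r and 1 / (q^k; q). *)
Definition Pinv (r : nat) : R := / fprod (exp (- y)) y r.
Definition Qinv (k : nat) : R := / qprod (exp (- y) ^ k) y.

Lemma e_add u v : e (u + v) = e u * e v.
Proof. unfold e. rewrite <- exp_plus. f_equal. ring. Qed.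

Lemma e_nat k : e (INR k) = q ^ k.
Proof. unfold e, q. rewrite exp_pow. f_equal. ring. Qed.

Lemma q_bounds : 0 < q < 1.
Proof. apply exp_neg_bounds, Hy. Qed.

Lemma q_pow_lt1 k : (1 <= k)%nat -> q ^ k < 1.
Proof.
  intros Hk. destruct k as [|k]; [lia|]. simpl. assert (H := q_bounds).
  assert (H1 := pow_bounds q k H). nra.
Qed.

Lemma Pinv_S r : (1 - q ^ S r) * Pinv (S r) = Pinv r.
Proof.
  unfold Pinv. simpl fprod. fold q. assert (H := q_bounds).
  assert (H1 := fprod_pos q y r Hy ltac:(lra)). assert (H2 := q_pow_lt1 (S r) ltac:(lia)).
  simpl in *. field. split; lra.
Qed.

Lemma Qinv_S k : (1 <= k)%nat -> (1 - q ^ k) * Qinv k = Qinv (S k).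
Proof.
  intros Hk. unfold Qinv. fold q. assert (H2 := q_pow_lt1 k Hk).
  assert (H3 := q_pow_lt1 (S k) ltac:(lia)).
  rewrite (qprod_head (q ^ k) y Hy) by (simpl in H3; fold q; lra). fold q.
  replace (q ^ k * q) with (q ^ S k) by (simpl; ring).
  assert (H4 := qprod_pos _ y Hy H3). field. split; lra.
Qed.

Lemma Qinv_bounds k : (1 <= k)%nat -> 0 < Qinv k <= Qinv 1.
Proof.
  intros Hk. assert (P : forall k, (1 <= k)%nat -> 0 < Qinv k).
  { intros j Hj. apply Rinv_0_lt_compat, qprod_pos; [exact Hy|apply q_pow_lt1, Hj]. }
  split; [apply P, Hk|]. induction Hk as [|k Hk IH]; [lra|].
  rewrite <- Qinv_S by exact Hk. assert (H1 := P k Hk).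
  assert (H2 := pow_bounds q k q_bounds). nra.
Qed.

Lemma Qinv_ge1 k : (1 <= k)%nat -> 1 <= Qinv k.
Proof.
  intros Hk. assert (H := fprod_ge_lim (q ^ k) y 0 Hy).
  assert (H1 := pow_bounds q k q_bounds). assert (H2 := q_pow_lt1 k Hk).
  specialize (H ltac:(lra)). unfold Qinv. fold q. rewrite <- Rinv_1.
  apply Rinv_le_contravar; [apply qprod_pos; [exact Hy|lra]|]. simpl in H. lra.
Qed.

Lemma Pinv_bounds r : 0 < Pinv r <= Qinv 1.
Proof.
  assert (H := q_bounds). unfold Pinv, Qinv. fold q. rewrite pow_1.
  assert (H1 := fprod_ge_lim q y r Hy ltac:(lra)). assert (H2 := qprod_pos q y Hy ltac:(lra)).
  split; [apply Rinv_0_lt_compat; lra|apply Rinv_le_contravar; lra].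
Qed.

Lemma PQ_const r : Pinv r * Qinv (S r) = Qinv 1.
Proof.
  induction r as [|r IH]; [unfold Pinv; simpl fprod; rewrite Rinv_1; ring|].
  rewrite <- IH, <- (Pinv_S r), <- (Qinv_S (S r)) by lia. ring.
Qed.

Definition lam (r : nat) : R := INR r * (5 * INR r + 1) / 2.

(** The r-th term of Rogers' function H_m (a) at a = q^n. *)
Definition Hterm (m n r : nat) : R :=
  (-1) ^ r * e (2 * INR n * INR r + lam r - INR m * INR r)
  * (1 - q ^ (m * (n + 2 * r))) * Pinv r * Qinv (n + r).

Definition Hsum (m n : nat) : R := tsum (Hterm m n).

Lemma Rabs_pow_neg1 r : Rabs ((-1) ^ r) = 1.
Proof. rewrite <- RPow_abs, Rabs_left by lra. replace (- -1) with 1 by ring. apply pow1. Qed.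

Lemma e_le u v : v <= u -> e u <= e v.
Proof. intros H. apply exp_le. nra. Qed.

Lemma INR_sq_ge r : INR r <= INR r * INR r.
Proof.
  destruct r as [|r]; [simpl; lra|]. rewrite S_INR. assert (H := pos_INR r). nra.
Qed.

Lemma geom_bound_summable (f : nat -> R) K :
  (forall r, Rabs (f r) <= K * q ^ r) -> exists s, has_sum f s.
Proof.
  intros H. assert (Hq := q_bounds). destruct (has_sum_geom q ltac:(lra)) as [G HG].
  apply (has_sum_dominated f (fun r => K * q ^ r) (K * G) H). apply has_sum_scal, HG.
Qed.

Lemma PQ_bound n r c t : (1 <= n)%nat -> Rabs c <= 1 ->
  Rabs ((-1) ^ r * e t * c * Pinv r * Qinv (n + r)) <= Qinv 1 * Qinv 1 * e t.
Proof.
  intros Hn Hc. rewrite !Rabs_mult, Rabs_pow_neg1.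
  destruct (Pinv_bounds r) as [p1 p2]. destruct (Qinv_bounds (n + r) ltac:(lia)) as [k1 k2].
  rewrite (Rabs_pos_eq (Pinv r)), (Rabs_pos_eq (Qinv (n + r))) by lra.
  assert (He : 0 < e t) by apply exp_pos. rewrite (Rabs_pos_eq (e t)) by lra.
  assert (Hc0 := Rabs_pos c).
  replace (1 * e t * Rabs c * Pinv r * Qinv (n + r))
    with (e t * (Rabs c * (Pinv r * Qinv (n + r)))) by ring.
  rewrite (Rmult_comm _ (e t)). apply Rmult_le_compat_l; [lra|].
  rewrite <- (Rmult_1_l (Qinv 1 * Qinv 1)).
  apply Rmult_le_compat; [lra|nra|lra|]. apply Rmult_le_compat; lra.
Qed.

Lemma one_minus_pow_bounds k : Rabs (1 - q ^ k) <= 1.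
Proof.
  assert (H := pow_bounds q k q_bounds). rewrite Rabs_pos_eq; lra.
Qed.

Lemma Hterm_summable m n : (m <= 2)%nat -> (1 <= n)%nat -> exists s, has_sum (Hterm m n) s.
Proof.
  intros Hm Hn. apply (geom_bound_summable _ (Qinv 1 * Qinv 1)). intros r.
  eapply Rle_trans; [apply PQ_bound; [exact Hn|apply one_minus_pow_bounds]|].
  destruct (Qinv_bounds 1 (le_n _)) as [k1 _].
  apply Rmult_le_compat_l; [nra|]. rewrite <- e_nat. apply e_le. unfold lam.
  assert (h1 : INR m <= 2) by (apply (le_INR m 2), Hm).
  assert (h2 : 1 <= INR n) by (apply (le_INR 1 n), Hn).
  assert (h3 := INR_sq_ge r). assert (h4 := pos_INR r).
  assert (0 <= (2 * INR n - INR m) * INR r) by (apply Rmult_le_pos; lra). nra.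
Qed.

Lemma Hsum_has_sum m n : (m <= 2)%nat -> (1 <= n)%nat -> has_sum (Hterm m n) (Hsum m n).
Proof. intros Hm Hn. apply tsum_has_sum, Hterm_summable; assumption. Qed.

Lemma lam_S r : lam (S r) = lam r + 5 * INR r + 3.
Proof. unfold lam. rewrite S_INR. field. Qed.

(** Rogers' relation between H_(m+1) (a), H_m (a) and H_(2-m) (a q): the
    difference of the r-th terms is split into a multiple of 1 - a q^r and a
    multiple of 1 - q^r, which shorten the q-factorials; in the second part, B,
    the index is then shifted by one. *)
Lemma Hsum_rel m m' n : (m + m' = 2)%nat -> (1 <= m')%nat -> (1 <= n)%nat ->
  Hsum (S m) n - Hsum m n = q ^ (m * n) * Hsum m' (S n).
Proof.
  intros Hmm Hm' Hn.
  set (A := fun r => (-1) ^ r * e (2 * INR n * INR r + lam r + INR m * (INR r + INR n)) * 1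
     * Pinv r * Qinv (n + S r)).
  set (B := fun r => (-1) ^ r * e (2 * INR n * INR r + lam r - INR (S m) * INR r) * (1 - q ^ r)
     * Pinv r * Qinv (n + r)).
  assert (HmR : INR m <= 1) by (apply (le_INR m 1); lia).
  assert (HmS : INR (S m) <= 2) by (rewrite S_INR; lra).
  assert (Hm0 := pos_INR m). assert (HnR : 1 <= INR n) by (apply (le_INR 1 n), Hn).
  destruct (Qinv_bounds 1 (le_n _)) as [k1 _].
  assert (SA : exists s, has_sum A s).
  { apply (geom_bound_summable _ (Qinv 1 * Qinv 1)). intros r. unfold A.
    replace (n + S r)%nat with (S n + r)%nat by lia.
    eapply Rle_trans; [apply PQ_bound; [lia|rewrite Rabs_R1; lra]|].
    apply Rmult_le_compat_l; [nra|]. rewrite <- e_nat. apply e_le. unfold lam.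
    assert (h3 := INR_sq_ge r). assert (h4 := pos_INR r).
    assert (0 <= INR m * (INR r + INR n)) by (apply Rmult_le_pos; lra).
    assert (0 <= INR n * INR r) by (apply Rmult_le_pos; lra). nra. }
  assert (SB : exists s, has_sum B s).
  { apply (geom_bound_summable _ (Qinv 1 * Qinv 1)). intros r. unfold B.
    eapply Rle_trans; [apply PQ_bound; [lia|apply one_minus_pow_bounds]|].
    apply Rmult_le_compat_l; [nra|]. rewrite <- e_nat. apply e_le. unfold lam.
    assert (h3 := INR_sq_ge r). assert (h4 := pos_INR r).
    assert (0 <= (2 * INR n - INR (S m)) * INR r) by (apply Rmult_le_pos; lra). nra. }
  destruct SA as [sA SA]. destruct SB as [sB SB].
  assert (SB' : has_sum (fun r => B (S r)) sB).
  { destruct (has_sum_inj_summable S B sB) as [t Ht]; [intros; lia|exact SB|].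
    assert (E := has_sum_shift B t). rewrite (has_sum_unique B sB t SB); [exact Ht|].
    apply E; [|exact Ht]. unfold B. simpl. ring. }
  transitivity (sA + sB).
  - apply (has_sum_unique (fun r => Hterm (S m) n r - Hterm m n r)).
    + apply has_sum_minus; apply Hsum_has_sum; lia.
    + apply has_sum_ext with (2 := has_sum_plus _ _ _ _ SA SB). intros r.
      unfold A, B, Hterm. replace (n + S r)%nat with (S (n + r)) by lia.
      rewrite <- Qinv_S by lia.
      replace (2 * INR n * INR r + lam r + INR m * (INR r + INR n))
        with ((2 * INR n * INR r + lam r - INR (S m) * INR r) + INR (r + m * (n + 2 * r)))
        by (rewrite S_INR, plus_INR, mult_INR, plus_INR, mult_INR; simpl; ring).
      replace (2 * INR n * INR r + lam r - INR m * INR r)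
        with ((2 * INR n * INR r + lam r - INR (S m) * INR r) + INR r)
        by (rewrite S_INR; ring).
      rewrite !e_add, !e_nat.
      replace (S m * (n + 2 * r))%nat with (m * (n + 2 * r) + (n + r) + r)%nat by lia.
      rewrite !pow_add. ring.
  - apply (has_sum_unique (fun r => A r + B (S r))); [apply has_sum_plus; assumption|].
    apply has_sum_ext with (2 := has_sum_scal (q ^ (m * n)) _ _ (Hsum_has_sum m' (S n) ltac:(lia) ltac:(lia))).
    intros r. unfold A, B, Hterm. replace (S n + r)%nat with (n + S r)%nat by lia.
    rewrite <- (Pinv_S r).
    assert (Em : INR m' = 2 - INR m).
    { replace 2 with (INR (m + m')) by (rewrite Hmm; simpl; ring). rewrite plus_INR. ring. }
    replace (2 * INR n * INR r + lam r + INR m * (INR r + INR n))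
      with ((2 * INR (S n) * INR r + lam r - INR m' * INR r) + INR (m * n))
      by (rewrite Em, S_INR, mult_INR; ring).
    replace (2 * INR n * INR (S r) + lam (S r) - INR (S m) * INR (S r))
      with ((2 * INR (S n) * INR r + lam r - INR m' * INR r) + INR (m * n + m' * (S n + 2 * r))).
    2:{ rewrite lam_S, plus_INR, !mult_INR, plus_INR, mult_INR, !S_INR, Em. simpl INR. ring. }
    rewrite !e_add, !e_nat, !pow_add. simpl ((-1) ^ S r). ring.
Qed.

Lemma Hsum_1 n : (1 <= n)%nat -> Hsum 1 n = Hsum 2 (S n).
Proof.
  intros Hn. assert (H := Hsum_rel 0 2 n eq_refl ltac:(lia) Hn).
  replace (Hsum 0 n) with 0 in H; [simpl in H; lra|].
  symmetry. apply tsum_eq. apply has_sum_ext with (2 := has_sum_zero). intros r.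
  unfold Hterm. simpl. ring.
Qed.

Lemma Hsum_rec n : (1 <= n)%nat -> Hsum 2 n = Hsum 2 (S n) + q ^ n * Hsum 2 (S (S n)).
Proof.
  intros Hn. assert (H := Hsum_rel 1 1 n eq_refl ltac:(lia) Hn).
  rewrite (Hsum_1 n), (Hsum_1 (S n)), Nat.mul_1_l in H by lia. lra.
Qed.

(** The term r = 0 stays above 1 - q^n, while the others carry a factor q^n. *)
Lemma Hsum_eventually_pos : exists N, forall n, (N <= n)%nat -> 0 < Hsum 2 n.
Proof.
  assert (Hq := q_bounds). destruct (has_sum_geom q ltac:(lra)) as [G HG].
  assert (HG0 : 0 <= G).
  { apply (has_sum_ge_lsum (fun n => q ^ n) G nil); [intros; apply pow_le; lra|exact HG|constructor]. }
  destruct (Qinv_bounds 1 (le_n _)) as [k1 _]. set (K := Qinv 1 * Qinv 1).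
  assert (HK : 0 < K) by (unfold K; nra).
  assert (B : forall n, (1 <= n)%nat -> 1 - q ^ n * (1 + K * G) <= Hsum 2 n).
  { intros n Hn. assert (HnR : 1 <= INR n) by (apply (le_INR 1 n), Hn).
    assert (S2 := Hsum_has_sum 2 n (le_n _) Hn).
    set (f0 := fun r => match r with O => Hterm 2 n O | S _ => 0 end).
    assert (S0 : has_sum f0 (f0 O)) by (apply has_sum_single; intros [|b]; [congruence|reflexivity]).
    assert (T := has_sum_tail (fun r => Hterm 2 n r - f0 r) (fun r => q ^ n * (K * q ^ r))
      (Hsum 2 n - f0 O) (q ^ n * (K * G)) nil).
    assert (Hn2 : q ^ (2 * (n + 2 * 0)) <= q ^ n).
    { replace (2 * (n + 2 * 0))%nat with (n + n)%nat by lia. rewrite pow_add.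
      assert (H := pow_bounds q n Hq). nra. }
    assert (T' : Rabs ((Hsum 2 n - f0 O) - 0) <= q ^ n * (K * G) - 0).
    { apply T; [|apply has_sum_minus; [exact S2|exact S0]|
        apply has_sum_scal, has_sum_scal, HG|constructor].
      intros r. destruct r as [|r].
      - unfold f0. rewrite Rminus_diag, Rabs_R0. assert (H := pow_bounds q n Hq).
        simpl. rewrite Rmult_1_r. nra.
      - unfold f0. rewrite Rminus_0_r. unfold Hterm.
        eapply Rle_trans; [apply PQ_bound; [exact Hn|apply one_minus_pow_bounds]|].
        fold K. replace (q ^ n * (K * q ^ S r)) with (K * (q ^ n * q ^ S r)) by ring.
        apply Rmult_le_compat_l; [lra|]. rewrite <- pow_add, <- e_nat. apply e_le.
        unfold lam. rewrite plus_INR, S_INR. assert (h3 := INR_sq_ge r). assert (h4 := pos_INR r).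
        assert (0 <= INR n * INR r) by (apply Rmult_le_pos; lra). simpl INR. nra. }
    rewrite !Rminus_0_r in T'. apply Rabs_le_between in T'.
    assert (H0 : 1 - q ^ n <= f0 O).
    { unfold f0, Hterm, lam. simpl INR.
      replace (2 * INR n * 0 + 0 * (5 * 0 + 1) / 2 - (1 + 1) * 0) with 0 by field.
      unfold e. rewrite Rmult_0_r, Ropp_0, exp_0. unfold Pinv. simpl fprod. rewrite Rinv_1.
      assert (H := Qinv_ge1 (n + 0) ltac:(lia)). assert (H5 := pow_bounds q (2 * (n + 2 * 0)) Hq).
      simpl ((-1) ^ 0). nra. }
    lra. }
  assert (L : is_lim_seq (fun n => q ^ n) 0) by (apply is_lim_seq_geom; rewrite Rabs_pos_eq; lra).
  assert (HC : 0 < 1 + K * G) by nra.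
  assert (Hi : 0 < / (1 + K * G)) by (apply Rinv_0_lt_compat, HC).
  apply is_lim_seq_spec in L. destruct (L (mkposreal _ Hi)) as [N HN]. simpl in HN.
  exists (S N). intros n Hn. specialize (HN n ltac:(lia)). specialize (B n ltac:(lia)).
  rewrite Rminus_0_r, Rabs_pos_eq in HN by (apply pow_le; lra).
  assert (q ^ n * (1 + K * G) < 1); [|lra].
  apply Rmult_lt_reg_r with (/ (1 + K * G)); [exact Hi|].
  rewrite Rmult_assoc, Rinv_r by lra. lra.
Qed.

(** The recurrence has positive coefficients, so positivity descends. *)
Lemma Hsum_pos n : (1 <= n)%nat -> 0 < Hsum 2 n.
Proof.
  destruct Hsum_eventually_pos as [N HN]. assert (Hq := q_bounds).
  assert (D : forall d n, (1 <= n)%nat -> (N <= n + d)%nat -> 0 < Hsum 2 n).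
  { intros d. induction d as [d IH] using lt_wf_ind. intros k Hk Hd.
    destruct d as [|d]; [apply HN; lia|].
    rewrite Hsum_rec by exact Hk. assert (Hp := pow_lt q k ltac:(lra)).
    assert (h1 : 0 < Hsum 2 (S k)) by (apply (IH d); lia).
    assert (h2 : 0 < Hsum 2 (S (S k))).
    { destruct d as [|d]; [apply HN; lia|apply (IH d); lia]. }
    nra. }
  intros Hn. apply (D N n Hn). lia.
Qed.

(** At a = q the quotients of q-factorials cancel, leaving a theta series
    folded at n = -1/2. *)
Lemma Hsum_at_q m : (m <= 2)%nat ->
  Hsum m 1 = Qinv 1 * theta true (5 * y / 2) ((5 - 2 * INR m) * y / 2).
Proof.
  intros Hm. apply tsum_eq.
  apply has_sum_ext with (2 := has_sum_scal (Qinv 1) _ _ (has_sum_fold _ _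
    (theta_has_sum true (5 * y / 2) ((5 - 2 * INR m) * y / 2) ltac:(lra)))).
  intros r. unfold Hterm. rewrite <- (PQ_const r). unfold gterm, Z.sub.
  rewrite sg_add, !sg_opp, sg_1, sg_true_nat, plus_IZR, !opp_IZR, <- INR_IZR_INZ.
  rewrite <- (e_nat (m * (1 + 2 * r))). unfold esign.
  replace (exp (- (5 * y / 2 * INR r ^ 2 + (5 - 2 * INR m) * y / 2 * INR r)))
    with (e (lam r + (2 - INR m) * INR r)) by (unfold e, lam; f_equal; field).
  replace (exp (- (5 * y / 2 * (- INR r + - (1)) ^ 2 + (5 - 2 * INR m) * y / 2 * (- INR r + - (1)))))
    with (e (lam r + (2 - INR m) * INR r) * e (INR (m * (1 + 2 * r)))).
  2:{ rewrite <- e_add. unfold e, lam. rewrite mult_INR, plus_INR, mult_INR. simpl INR.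
      f_equal. field. }
  replace (2 * INR 1 * INR r + lam r - INR m * INR r) with (lam r + (2 - INR m) * INR r)
    by (simpl INR; ring).
  simpl (1 + r)%nat. ring.
Qed.

End Rogers.

(** The products (q, q^4, q^5; q^5) and (q^2, q^3, q^5; q^5). *)
Definition rr_num (y : R) : R := theta true (5 * y / 2) (3 * y / 2).
Definition rr_den (y : R) : R := theta true (5 * y / 2) (y / 2).

Lemma rr_num_pos y : 0 < y -> 0 < rr_num y.
Proof. intros Hy. apply theta_true_pos; [lra|rewrite Rabs_pos_eq; lra]. Qed.

Lemma rr_den_pos y : 0 < y -> 0 < rr_den y.
Proof. intros Hy. apply theta_true_pos; [lra|rewrite Rabs_pos_eq; lra]. Qed.

Theorem rogers_ramanujan_theta y : 0 < y ->
  rogers_ramanujan (exp (- y)) = exp (- (y / 5)) * rr_num y / rr_den y.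
Proof.
  intros Hy. assert (HN := rr_num_pos y Hy). assert (HD := rr_den_pos y Hy).
  assert (L := rr_denom_lim (exp (- y)) (Hsum y 2) (exp_neg_bounds y Hy)
    (Hsum_pos y Hy) (Hsum_rec y Hy)).
  destruct (Qinv_bounds y Hy 1 (le_n _)) as [Hk _].
  rewrite <- (Hsum_1 y Hy 1), !Hsum_at_q in L by (exact Hy || lia).
  replace ((5 - 2 * INR 2) * y / 2) with (y / 2) in L by (simpl INR; field).
  replace ((5 - 2 * INR 1) * y / 2) with (3 * y / 2) in L by (simpl INR; field).
  fold (rr_num y) (rr_den y) in L.
  unfold rogers_ramanujan.
  rewrite (is_lim_seq_unique _ (Finite (exp (- (y / 5)) * rr_num y / rr_den y))); [reflexivity|].
  unfold rr_convergent.
  apply is_lim_seq_ext with (fun n => exp (- (y / 5)) / rr_denom (exp (- y)) 1 n).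
  - intros n. unfold Rpower. rewrite ln_exp. f_equal. f_equal. field.
  - replace (exp (- (y / 5)) * rr_num y / rr_den y)
      with (exp (- (y / 5)) / (Qinv y 1 * rr_den y / (Qinv y 1 * rr_num y))) by (field; lra).
    apply is_lim_seq_div'; [apply is_lim_seq_const|exact L|].
    apply Rgt_not_eq, Rdiv_lt_0_compat; nra.
Qed.

(** * The quintuple product *)

Lemma qprod_section3 c y : 0 < y -> c < 1 ->
  qprod c y = qprod c (3 * y) * qprod (c * exp (- y)) (3 * y)
    * qprod (c * exp (- y) ^ 2) (3 * y).
Proof.
  intros Hy Hc. assert (Hx := exp_neg_bounds y Hy).
  assert (Hx2 := pow_bounds _ 2 Hx).
  apply (is_lim_seq_eq (fun n => fprod c y (3 * n))).
  - apply is_lim_seq_mul_index; [lia|apply qprod_lim; assumption].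
  - apply is_lim_seq_ext with (fun n => fprod c (3 * y) n * fprod (c * exp (- y)) (3 * y) n
      * fprod (c * exp (- y) ^ 2) (3 * y) n).
    + assert (E : exp (- (3 * y)) = exp (- y) ^ 3)
        by (rewrite <- exp_mult_pow; f_equal; simpl; ring).
      induction n as [|n IH]; [simpl; ring|].
      replace (3 * S n)%nat with (3 + 3 * n)%nat by lia. simpl fprod.
      simpl Nat.add. change (n + (n + (n + 0)))%nat with (3 * n)%nat.
      rewrite <- IH, E, <- !pow_mult. simpl. ring.
    + do 2 (apply is_lim_seq_mult'; [|apply qprod_lim; [lra|apply mult_lt_1; lra]]).
      apply qprod_lim; lra.
Qed.

(** Euler's pentagonal number theorem: the triple product of base q^3 contains
    the three residue classes modulo 3 of (q; q). *)
Lemma euler_pentagonal y : 0 < y -> theta true (3 * y / 2) (y / 2) = qprod (exp (- y)) y.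
Proof.
  intros Hy. assert (Hx := exp_neg_bounds y Hy).
  rewrite triple_product by (try right; try rewrite Rabs_pos_eq; lra).
  rewrite (qprod_section3 (exp (- y)) y) by lra. unfold esign.
  replace (2 * (3 * y / 2)) with (3 * y) by field.
  replace (- (-1 * exp (- (3 * y / 2 + y / 2)))) with (exp (- y) * exp (- y)).
  2:{ rewrite <- exp_plus. replace (- y + - y) with (- (3 * y / 2 + y / 2)) by field. ring. }
  replace (- (-1 * exp (- (3 * y / 2 - y / 2)))) with (exp (- y)).
  2:{ replace (3 * y / 2 - y / 2) with y by field. ring. }
  replace (exp (- (3 * y))) with (exp (- y) * exp (- y) ^ 2).
  2:{ rewrite <- (exp_mult_pow 2), <- exp_plus. f_equal. simpl. ring. }
  ring.
Qed.

(** The terms of index n and - 1 - n cancel. *)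
Lemma theta_true_zero A : 0 < A -> theta true A A = 0.
Proof.
  intros HA. assert (H := theta_shift true A (- A) 1 HA).
  rewrite theta_opp in H by exact HA.
  replace (- A + 2 * A * 1) with A in H by ring.
  replace (A * 1 ^ 2 + - A * 1) with 0 in H by ring.
  rewrite exp_0, sg_1 in H. simpl in H. lra.
Qed.

Definition split3 (p : Z * Z + Z * Z + Z * Z) : Z * Z :=
  match p with
  | inl (inl (j, n)) => (3 * j + 2 * (n - j), n - j)
  | inl (inr (j, n)) => (3 * j - 1 + 2 * (n - j), n - j)
  | inr (j, n) => (3 * j + 1 + 2 * (n - j), n - j)
  end%Z.

Lemma split3_inj p p' : split3 p = split3 p' -> p = p'.
Proof.
  destruct p as [[[a b]|[a b]]|[a b]], p' as [[[a' b']|[a' b']]|[a' b']];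
    cbn [split3]; intros H;
    assert (H1 := f_equal fst H); assert (H2 := f_equal snd H); cbn [fst snd] in H1, H2;
    try (exfalso; lia); assert (a = a') by lia; assert (b = b') by lia; congruence.
Qed.

Lemma split3_surj m : exists p, split3 p = m.
Proof.
  destruct m as [m n]. set (t := (m - 2 * n)%Z).
  assert (Ht := Z.div_mod t 3 ltac:(lia)). assert (Hr := Z.mod_pos_bound t 3 ltac:(lia)).
  set (c := (t / 3)%Z) in *. set (r := (t mod 3)%Z) in *.
  assert (D : (r = 0 \/ r = 1 \/ r = 2)%Z) by lia.
  destruct D as [D|[D|D]].
  - exists (inl (inl (c, n + c)%Z)). cbn [split3]. f_equal; lia.
  - exists (inr (c, n + c)%Z). cbn [split3]. f_equal; lia.
  - exists (inl (inr (c + 1, n + (c + 1))%Z)). cbn [split3]. f_equal; lia.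
Qed.

Lemma sg_triple e j : sg e (3 * j) = sg e j.
Proof.
  replace (3 * j)%Z with (2 * j + j)%Z by lia. rewrite sg_add, sg_double. ring.
Qed.

Lemma sg_negb e n : sg (negb e) n = sg e n * sg true n.
Proof. unfold sg. destruct e; simpl; destruct (Z.odd n); ring. Qed.

(** Sorting the product of the two theta series by m - 2 n modulo 3: the inner
    sums are the pentagonal series twice and a series that vanishes. *)
Theorem quintuple_product e A b : 0 < A ->
  theta e A b * theta true (2 * A) (2 * A - 2 * b)
  = (theta (negb e) (3 * A) (3 * b - 2 * A)
     + esign e * exp (- (A - b)) * theta (negb e) (3 * A) (3 * b - 4 * A))
    * theta true (6 * A) (2 * A).
Proof.
  intros HA. assert (HA2 : 0 < 2 * A) by lra. assert (HA3 : 0 < 3 * A) by lra.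
  assert (HA6 : 0 < 6 * A) by lra.
  assert (H := has_sum_prod _ _ _ _ (theta_has_sum e A b HA)
    (theta_has_sum true (2 * A) (2 * A - 2 * b) HA2)).
  apply (has_sum_unique _ _ _ H). clear H.
  set (T0 := theta (negb e) (3 * A) (3 * b - 2 * A)).
  set (T1 := theta (negb e) (3 * A) (3 * b - 4 * A)).
  set (T2 := theta (negb e) (3 * A) (3 * b)).
  set (P := theta true (6 * A) (2 * A)).
  assert (HP' : has_sum (gterm true (6 * A) (- (2 * A))) P)
    by (unfold P; rewrite <- theta_opp by exact HA6; apply theta_has_sum, HA6).
  assert (HZ : has_sum (gterm true (6 * A) (6 * A)) 0)
    by (rewrite <- (theta_true_zero (6 * A) HA6); apply theta_has_sum, HA6).
  replace ((T0 + esign e * exp (- (A - b)) * T1) * P)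
    with (T0 * P + esign e * exp (- (A - b)) * (T1 * P) + esign e * exp (- (A + b)) * (T2 * 0))
    by ring.
  apply (has_sum_reindex split3); [apply split3_inj|apply split3_surj|].
  assert (K : forall c d j n m B1 B2, sg e m = c * sg e j ->
    A * IZR m ^ 2 + b * IZR m + (2 * A * IZR (n - j) ^ 2 + (2 * A - 2 * b) * IZR (n - j))
     = d + (3 * A * IZR j ^ 2 + B1 * IZR j) + (6 * A * IZR n ^ 2 + B2 * IZR n) ->
    c * exp (- d) * (gterm (negb e) (3 * A) B1 j * gterm true (6 * A) B2 n)
    = gterm e A b m * gterm true (2 * A) (2 * A - 2 * b) (n - j)).
  { intros c d j n m B1 B2 E1 E2. unfold gterm. rewrite sg_negb, E1.
    unfold Z.sub. rewrite (sg_add true), sg_opp.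
    transitivity (c * sg e j * sg true j * sg true n * (exp (- d) *
      exp (- (3 * A * IZR j ^ 2 + B1 * IZR j)) * exp (- (6 * A * IZR n ^ 2 + B2 * IZR n)))); [ring|].
    transitivity (c * sg e j * sg true j * sg true n * (exp (- (A * IZR m ^ 2 + b * IZR m)) *
      exp (- (2 * A * IZR (n + - j) ^ 2 + (2 * A - 2 * b) * IZR (n + - j))))); [|ring].
    rewrite <- !exp_plus. f_equal. f_equal. unfold Z.sub in E2. lra. }
  assert (Sm : sg e (-1) = esign e) by (rewrite <- sg_1; apply (sg_opp e 1)).
  apply has_sum_disjoint; [apply has_sum_disjoint|].
  - replace (T0 * P) with (1 * exp (- 0) * (T0 * P)) by (rewrite Ropp_0, exp_0; ring).
    apply has_sum_ext with (2 := has_sum_scal _ _ _ (has_sum_prod _ _ _ _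
      (theta_has_sum (negb e) (3 * A) (3 * b - 2 * A) HA3) (theta_has_sum true (6 * A) (2 * A) HA6))).
    intros [j n]. cbn [fst snd split3]. apply K.
    + rewrite sg_add, sg_double, sg_triple. ring.
    + rewrite plus_IZR, !mult_IZR, minus_IZR. ring.
  - apply has_sum_ext with (2 := has_sum_scal _ _ _ (has_sum_prod _ _ _ _
      (theta_has_sum (negb e) (3 * A) (3 * b - 4 * A) HA3) HP')).
    intros [j n]. cbn [fst snd split3]. apply K.
    + replace (3 * j - 1 + 2 * (n - j))%Z with (3 * j + 2 * (n - j) + (-1))%Z by lia.
      rewrite !sg_add, sg_double, sg_triple, Sm. ring.
    + rewrite plus_IZR, minus_IZR, !mult_IZR, minus_IZR. ring.
  - apply has_sum_ext with (2 := has_sum_scal _ _ _ (has_sum_prod _ _ _ _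
      (theta_has_sum (negb e) (3 * A) (3 * b) HA3) HZ)).
    intros [j n]. cbn [fst snd split3]. apply K.
    + rewrite !sg_add, sg_double, sg_triple, sg_1. ring.
    + rewrite !plus_IZR, !mult_IZR, minus_IZR. ring.
Qed.

(** * The 5-dissection of the pentagonal series *)

(** The Euler product (q; q). *)
Definition f1 (y : R) : R := qprod (exp (- y)) y.

(** Sorted by exponents modulo 5, (u; u) = dis0 - u (q^5; q^5) - u^2 dis2 where
    u^5 = q. *)
Definition dis0 (y : R) : R :=
  theta true (15 * y / 2) (y / 2) + exp (- y) * theta true (15 * y / 2) (11 * y / 2).
Definition dis2 (y : R) : R :=
  theta true (15 * y / 2) (7 * y / 2) - exp (- y) * theta true (15 * y / 2) (13 * y / 2).

Lemma pentagonal10 y : 0 < y -> theta true (15 * y) (5 * y) = f1 (10 * y).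
Proof.
  intros Hy. unfold f1. rewrite <- euler_pentagonal by lra. f_equal; field.
Qed.

Section Level10.
Variable y : R.
Hypothesis Hy : 0 < y.

Let x := exp (- y).
Let X (c : R) := qprod c (5 * y).
Let Z' (c : R) := qprod c (10 * y).

Lemma x_pow k : exp (- (INR k * y)) = x ^ k.
Proof. apply exp_mult_pow. Qed.

Lemma x_pow_lt1 k : (1 <= k)%nat -> 0 < x ^ k < 1.
Proof.
  intros Hk. split; [apply pow_lt, exp_pos|]. unfold x. rewrite <- exp_mult_pow, <- exp_0.
  apply exp_increasing. assert (h : 1 <= INR k) by (apply (le_INR 1 k), Hk). nra.
Qed.

Lemma X_split k : (1 <= k)%nat -> X (x ^ k) = Z' (x ^ k) * Z' (x ^ (k + 5)).
Proof.
  intros Hk. assert (H := x_pow_lt1 k Hk). unfold X, Z'.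
  rewrite (qprod_section2 (x ^ k) (5 * y)) by lra. rewrite exp_neg5. fold x.
  rewrite <- pow_add. f_equal; f_equal; ring.
Qed.

Lemma X_square k : (1 <= k)%nat -> X (x ^ k) * X (- x ^ k) = Z' (x ^ (2 * k)).
Proof.
  intros Hk. assert (H := x_pow_lt1 k Hk). unfold X, Z'.
  rewrite qprod_square by lra. f_equal; [rewrite <- pow_mult; f_equal; lia|ring].
Qed.

Lemma theta5_product e b k l : INR k * y = 5 * y / 2 + b -> INR l * y = 5 * y / 2 - b ->
  (1 <= k)%nat -> (1 <= l)%nat ->
  theta e (5 * y / 2) b = f1 (5 * y) * X (- (esign e * x ^ k)) * X (- (esign e * x ^ l)).
Proof.
  intros Hk Hl Hk1 Hl1.
  assert (h1 : 1 <= INR k) by (apply (le_INR 1), Hk1).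
  assert (h2 : 1 <= INR l) by (apply (le_INR 1), Hl1).
  rewrite triple_product; [|lra|right; apply Rabs_def1; nra].
  rewrite <- Hk, <- Hl, !x_pow. unfold f1, X.
  replace (2 * (5 * y / 2)) with (5 * y) by field. reflexivity.
Qed.

Lemma theta10_product b k l : INR k * y = 5 * y + b -> INR l * y = 5 * y - b ->
  (1 <= k)%nat -> (1 <= l)%nat ->
  theta true (5 * y) b = f1 (10 * y) * Z' (x ^ k) * Z' (x ^ l).
Proof.
  intros Hk Hl Hk1 Hl1.
  assert (h1 : 1 <= INR k) by (apply (le_INR 1), Hk1).
  assert (h2 : 1 <= INR l) by (apply (le_INR 1), Hl1).
  rewrite triple_product; [|lra|right; apply Rabs_def1; nra].
  rewrite <- Hk, <- Hl, !x_pow. unfold f1, Z', esign.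
  replace (2 * (5 * y)) with (10 * y) by ring.
  replace (- (-1 * x ^ k)) with (x ^ k) by ring. replace (- (-1 * x ^ l)) with (x ^ l) by ring.
  reflexivity.
Qed.

Lemma f1_pos t : 0 < t -> 0 < f1 t.
Proof. intros Ht. assert (H := exp_neg_bounds t Ht). apply qprod_pos; lra. Qed.

Lemma rr_num_product : rr_num y = f1 (5 * y) * X (x ^ 4) * X (x ^ 1).
Proof.
  unfold rr_num. rewrite (theta5_product true (3 * y / 2) 4 1); try lia; try (simpl INR; field).
  unfold esign. replace (- (-1 * x ^ 4)) with (x ^ 4) by ring.
  replace (- (-1 * x ^ 1)) with (x ^ 1) by ring. reflexivity.
Qed.

Lemma rr_den_product : rr_den y = f1 (5 * y) * X (x ^ 3) * X (x ^ 2).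
Proof.
  unfold rr_den. rewrite (theta5_product true (y / 2) 3 2); try lia; try (simpl INR; field).
  unfold esign. replace (- (-1 * x ^ 3)) with (x ^ 3) by ring.
  replace (- (-1 * x ^ 2)) with (x ^ 2) by ring. reflexivity.
Qed.

(** The quintuple product with base q^5 at a power of q makes dis0 a product of
    residue classes modulo 10, which recombine modulo 5. *)
Lemma dis0_product : dis0 y * rr_num y = f1 (5 * y) * rr_den y.
Proof.
  assert (H := quintuple_product false (5 * y / 2) (3 * y / 2) ltac:(lra)).
  replace (2 * (5 * y / 2)) with (5 * y) in H by field.
  replace (5 * y - 2 * (3 * y / 2)) with (2 * y) in H by field.
  replace (3 * (5 * y / 2)) with (15 * y / 2) in H by field.
  replace (6 * (5 * y / 2)) with (15 * y) in H by field.
  replace (3 * (3 * y / 2) - 5 * y) with (- (y / 2)) in H by field.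
  replace (3 * (3 * y / 2) - 4 * (5 * y / 2)) with (- (11 * y / 2)) in H by field.
  replace (5 * y / 2 - 3 * y / 2) with y in H by field.
  simpl negb in H. change (esign false) with 1 in H. rewrite Rmult_1_l in H.
  rewrite !theta_opp in H by lra. fold (dis0 y) in H.
  rewrite pentagonal10 in H by exact Hy.
  rewrite (theta5_product false (3 * y / 2) 4 1) in H; try lia; try (simpl INR; field).
  rewrite (theta10_product (2 * y) 7 3) in H; try lia; try (simpl INR; field).
  change (esign false) with 1 in H. rewrite !Rmult_1_l in H.
  assert (F10 := f1_pos (10 * y) ltac:(lra)).
  apply Rmult_eq_reg_r with (f1 (10 * y)); [|lra].
  transitivity (dis0 y * f1 (10 * y) * rr_num y); [ring|]. rewrite <- H.
  rewrite rr_num_product, rr_den_product.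
  assert (S1 := X_square 1 ltac:(lia)). assert (S4 := X_square 4 ltac:(lia)).
  assert (Z2 := X_split 2 ltac:(lia)). assert (Z3 := X_split 3 ltac:(lia)).
  simpl Nat.mul in *. simpl Nat.add in *. rewrite Z2, Z3.
  transitivity (f1 (5 * y) * f1 (5 * y) * f1 (10 * y) * Z' (x ^ 7) * Z' (x ^ 3)
    * (X (x ^ 4) * X (- x ^ 4)) * (X (x ^ 1) * X (- x ^ 1))); [ring|].
  rewrite S1, S4. ring.
Qed.

Lemma dis2_product : dis2 y * rr_den y = f1 (5 * y) * rr_num y.
Proof.
  assert (H := quintuple_product false (5 * y / 2) (y / 2) ltac:(lra)).
  replace (2 * (5 * y / 2)) with (5 * y) in H by field.
  replace (5 * y - 2 * (y / 2)) with (4 * y) in H by field.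
  replace (3 * (5 * y / 2)) with (15 * y / 2) in H by field.
  replace (6 * (5 * y / 2)) with (15 * y) in H by field.
  replace (3 * (y / 2) - 5 * y) with (- (7 * y / 2)) in H by field.
  replace (3 * (y / 2) - 4 * (5 * y / 2)) with (- (17 * y / 2)) in H by field.
  replace (5 * y / 2 - y / 2) with (2 * y) in H by field.
  simpl negb in H. change (esign false) with 1 in H. rewrite Rmult_1_l in H.
  rewrite !theta_opp in H by lra.
  assert (E : theta true (15 * y / 2) (17 * y / 2) = - exp y * theta true (15 * y / 2) (13 * y / 2)).
  { assert (HA : 0 < 15 * y / 2) by lra.
    assert (Hs := theta_shift true (15 * y / 2) (- (13 * y / 2)) 1 HA).
    replace (- (13 * y / 2) + 2 * (15 * y / 2) * 1) with (17 * y / 2) in Hs by field.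
    replace (15 * y / 2 * 1 ^ 2 + - (13 * y / 2) * 1) with y in Hs by field.
    rewrite Hs, theta_opp, sg_1 by exact HA. unfold esign. ring. }
  rewrite E in H.
  replace (theta true (15 * y / 2) (7 * y / 2)
    + exp (- (2 * y)) * (- exp y * theta true (15 * y / 2) (13 * y / 2))) with (dis2 y) in H.
  2:{ unfold dis2. replace (exp (- y)) with (exp (- (2 * y)) * exp y); [ring|].
      rewrite <- exp_plus. f_equal. ring. }
  rewrite pentagonal10 in H by exact Hy.
  rewrite (theta5_product false (y / 2) 3 2) in H; try lia; try (simpl INR; field).
  rewrite (theta10_product (4 * y) 9 1) in H; try lia; try (simpl INR; field).
  change (esign false) with 1 in H. rewrite !Rmult_1_l in H.
  assert (F10 := f1_pos (10 * y) ltac:(lra)).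
  apply Rmult_eq_reg_r with (f1 (10 * y)); [|lra].
  transitivity (dis2 y * f1 (10 * y) * rr_den y); [ring|]. rewrite <- H.
  rewrite rr_num_product, rr_den_product.
  assert (S2 := X_square 2 ltac:(lia)). assert (S3 := X_square 3 ltac:(lia)).
  assert (Z1 := X_split 1 ltac:(lia)). assert (Z4 := X_split 4 ltac:(lia)).
  simpl Nat.mul in *. simpl Nat.add in *. rewrite Z1, Z4.
  transitivity (f1 (5 * y) * f1 (5 * y) * f1 (10 * y) * Z' (x ^ 9) * Z' (x ^ 1)
    * (X (x ^ 3) * X (- x ^ 3)) * (X (x ^ 2) * X (- x ^ 2))); [ring|].
  rewrite S2, S3. ring.
Qed.

End Level10.

(** * The pentagonal series at a complex argument *)

Open Scope C_scope.

Fixpoint binom2 (n : nat) : nat :=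
  match n with O => O | S m => (binom2 m + m)%nat end.

Lemma binom2_spec n : (2 * binom2 n + n = n * n)%nat.
Proof. induction n as [|n IH]; simpl; [reflexivity|nia]. Qed.

(** The pentagonal number n (3 n - 1) / 2; adding n gives n (3 n + 1) / 2. *)
Definition pent (n : nat) : nat := (3 * binom2 n + n)%nat.

Fixpoint Cprod (v : C) (n : nat) : C :=
  match n with O => 1 | S m => Cprod v m * (1 - v ^ S m) end.

Definition Csign (n : nat) : C := RtoC ((-1) ^ n)%R.

Lemma Csign_S n : Csign (S n) = - Csign n.
Proof. unfold Csign. simpl. rewrite RtoC_mult. ring. Qed.

Fixpoint pentsum (v : C) (n : nat) : C :=
  match n with
  | O => 1
  | S m => pentsum v m + Csign n * (v ^ pent n + v ^ (pent n + n))
  end.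

Definition shanks_term (v : C) (n s : nat) : C :=
  Csign s * Cprod v n / Cprod v s * v ^ (s * n + binom2 (S s)).

Fixpoint Csum (f : nat -> C) (n : nat) : C :=
  match n with O => f O | S m => Csum f m + f n end.

Lemma Cpow_lt1_neq v n : Cmod v < 1 -> 1 - v ^ S n <> 0.
Proof.
  intros Hv E. assert (E2 : v ^ S n = 1).
  { replace (v ^ S n) with (1 - (1 - v ^ S n)) by ring. rewrite E. ring. }
  assert (H : Cmod (v ^ S n) = 1%R) by (rewrite E2; apply Cmod_1).
  rewrite Cmod_pow in H. assert (h := Cmod_ge_0 v).
  assert (Cmod v ^ S n <= Cmod v)%R; [|lra].
  simpl. assert (Cmod v ^ n <= 1)%R; [|nra].
  rewrite <- (pow1 n). apply pow_incr. lra.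
Qed.

Lemma Cprod_neq0 v n : Cmod v < 1 -> Cprod v n <> 0.
Proof.
  intros Hv. induction n as [|n IH]; simpl; [intros E; injection E; lra|].
  apply Cmult_neq_0; [exact IH|exact (Cpow_lt1_neq v n Hv)].
Qed.

(** Passing from n to n + 1 changes the s-th term by the difference of two
    consecutive values of the right-hand side. *)
Lemma shanks_telescope v n M : Cmod v < 1 ->
  Csum (shanks_term v (S n)) M - Csum (shanks_term v n) M
  = - Csign M * Cprod v n / Cprod v M * v ^ (M * S n + binom2 (S M) + S n).
Proof.
  intros Hv. induction M as [|M IH].
  - simpl Csum. unfold shanks_term. simpl Cprod. simpl Nat.mul. simpl Nat.add.
    simpl. field.
  - simpl Csum.
    replace (Csum (shanks_term v (S n)) M + shanks_term v (S n) (S M)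
      - (Csum (shanks_term v n) M + shanks_term v n (S M)))
      with ((Csum (shanks_term v (S n)) M - Csum (shanks_term v n) M)
        + (shanks_term v (S n) (S M) - shanks_term v n (S M))) by ring.
    rewrite IH. unfold shanks_term. rewrite Csign_S.
    change (Cprod v (S n)) with (Cprod v n * (1 - v ^ S n)).
    change (Cprod v (S M)) with (Cprod v M * (1 - v ^ S M)).
    assert (h1 := Cprod_neq0 v M Hv). assert (h2 := Cpow_lt1_neq v M Hv).
    replace (M * S n + binom2 (S M) + S n)%nat with (S M * n + binom2 (S M) + S M)%nat by nia.
    replace (S M * S n + binom2 (S (S M)))%nat with (S M * n + binom2 (S M) + S M + S M)%nat
      by (simpl binom2; nia).
    replace (S M * n + binom2 (S (S M)))%nat with (S M * n + binom2 (S M) + S M)%nat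
      by (simpl binom2; nia).
    replace (S M * n + binom2 (S M) + S M + S M + S n)%nat
      with (S M * n + binom2 (S M) + S M + S M + S n)%nat by lia.
    rewrite !(Cpow_add_r v).
    set (W := v ^ (S M * n)). set (B := v ^ binom2 (S M)). set (m := v ^ S M) in *.
    set (k := v ^ S n). field. split; assumption.
Qed.

(** Shanks' finite form of the pentagonal number theorem. It is an identity of
    rational functions, hence available at complex v. *)
Lemma shanks v n : Cmod v < 1 -> Csum (shanks_term v n) n = pentsum v n.
Proof.
  intros Hv. induction n as [|n IH].
  - unfold shanks_term, Csign. simpl. field.
  - simpl Csum. assert (T := shanks_telescope v n n Hv). rewrite IH in T.
    replace (Csum (shanks_term v (S n)) n)
      with (pentsum v n + - Csign n * Cprod v n / Cprod v n * v ^ (n * S n + binom2 (S n) + S n))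
      by (rewrite <- T; ring).
    cbn [pentsum]. unfold shanks_term. rewrite Csign_S.
    assert (b := binom2_spec n). assert (b1 : binom2 (S n) = (binom2 n + n)%nat) by reflexivity.
    replace (n * S n + binom2 (S n) + S n)%nat with (pent (S n)) by (unfold pent; nia).
    replace (S n * S n + binom2 (S (S n)))%nat with (pent (S n) + S n)%nat
      by (unfold pent; simpl binom2; nia).
    assert (h1 := Cprod_neq0 v n Hv). assert (h2 := Cprod_neq0 v (S n) Hv).
    field. split; assumption.
Qed.

Fixpoint Rprod (t : R) (n : nat) : R :=
  match n with O => 1 | S m => Rprod t m * (1 + t ^ S m) end%R.

Lemma Cprod_upper v n : (Cmod (Cprod v n) <= Rprod (Cmod v) n)%R.
Proof.
  induction n as [|n IH]; cbn [Cprod Rprod]; [rewrite Cmod_1; lra|].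
  rewrite Cmod_mult. apply Rmult_le_compat; try apply Cmod_ge_0; [exact IH|].
  unfold Cminus. eapply Rle_trans; [apply Cmod_triangle|].
  rewrite Cmod_1, Cmod_opp, Cmod_pow. lra.
Qed.

Lemma Cprod_lower v y n : 0 < y -> Cmod v = exp (- y) ->
  (fprod (exp (- y)) y n <= Cmod (Cprod v n))%R.
Proof.
  intros Hy Hv. assert (Hx := exp_neg_bounds y Hy).
  induction n as [|n IH]; cbn [Cprod fprod]; [rewrite Cmod_1; lra|].
  rewrite Cmod_mult.
  assert (Hp := pow_bounds (exp (- y)) (S n) Hx).
  assert (H : (1 - exp (- y) * exp (- y) ^ n <= Cmod (1 - v ^ S n))%R).
  { assert (T := Cmod_triangle (1 - v ^ S n) (v ^ S n)).
    replace (1 - v ^ S n + v ^ S n) with (RtoC 1) in T by ring.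
    rewrite Cmod_1, Cmod_pow, Hv in T. simpl in *. lra. }
  apply Rmult_le_compat; try assumption.
  - left. apply fprod_pos; lra.
  - simpl in Hp. lra.
Qed.

Lemma Rprod_fprod y n : Rprod (exp (- y)) n = fprod (- exp (- y)) y n.
Proof. induction n as [|n IH]; simpl; [reflexivity|rewrite IH; ring]. Qed.

Lemma Cmod_Csign n : Cmod (Csign n) = 1%R.
Proof. unfold Csign. rewrite Cmod_R. apply Rabs_pow_neg1. Qed.

Lemma Cmod_Csum_tail f g n : (forall s, (1 <= s)%nat -> Cmod (f s) <= g s)%R ->
  (Cmod (Csum f n - f O) <= lsum g (seq 1 n))%R.
Proof.
  intros H. induction n as [|n IH].
  - simpl. replace (f O - f O) with (RtoC 0) by ring. rewrite Cmod_0. lra.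
  - rewrite seq_S, lsum_app. simpl Csum. simpl lsum.
    replace (Csum f n + f (S n) - f O) with ((Csum f n - f O) + f (S n)) by ring.
    eapply Rle_trans; [apply Cmod_triangle|]. specialize (H (S n) ltac:(lia)). lra.
Qed.

Definition Clim (u : nat -> C) (l : C) : Prop :=
  is_lim_seq (fun n => Cmod (u n - l)) 0%R.

(** In Shanks' identity the term s = 0 is the product and every other one has
    a factor v^(n + s). *)
Lemma pentsum_minus_Cprod_lim y v : (0 < y)%R -> Cmod v = exp (- y) ->
  is_lim_seq (fun n => Cmod (pentsum v n - Cprod v n)) 0%R.
Proof.
  intros Hy Hv. assert (Hx := exp_neg_bounds y Hy). set (q := exp (- y)) in *.
  assert (Hv1 : (Cmod v < 1)%R) by lra.
  destruct (has_sum_geom q ltac:(lra)) as [G HG].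
  set (K := exp (- - q * / (1 - q))). set (L := (/ qprod q y)%R).
  assert (HE := qprod_pos q y Hy ltac:(lra)).
  assert (HL : (0 < L)%R) by (apply Rinv_0_lt_compat, HE).
  assert (HK : forall n, (Cmod (Cprod v n) <= K)%R).
  { intros n. eapply Rle_trans; [apply Cprod_upper|]. rewrite Hv. unfold q.
    rewrite Rprod_fprod. fold q. eapply Rle_trans; [apply fprod_upper; lra|].
    apply exp_le, Rmult_le_compat_l; [lra|]. apply geomsum_le; exact Hx. }
  assert (HLn : forall n, (/ Cmod (Cprod v n) <= L)%R).
  { intros n. apply Rinv_le_contravar; [exact HE|].
    eapply Rle_trans; [|apply (Cprod_lower v y n Hy Hv)]. apply fprod_ge_lim; [exact Hy|unfold q in *; lra]. }
  apply is_lim_seq_le_le with (fun _ => 0%R) (fun n => K * L * G * q ^ n)%R.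
  - intros n. split; [apply Cmod_ge_0|].
    rewrite <- shanks by exact Hv1.
    replace (Cprod v n) with (shanks_term v n 0).
    2:{ unfold shanks_term, Csign. simpl. field. }
    apply Rle_trans with (lsum (fun s => K * L * q ^ n * q ^ s)%R (seq 1 n)).
    + apply Cmod_Csum_tail. intros s Hs. unfold shanks_term.
      assert (hs := Cprod_neq0 v s Hv1).
      unfold Cdiv. rewrite !Cmod_mult, Cmod_Csign, Cmod_inv, Cmod_pow, Hv by exact hs. fold q.
      rewrite Rmult_1_l, (Rmult_assoc (K * L)), <- pow_add.
      assert (hi : (0 < / Cmod (Cprod v s))%R) by (apply Rinv_0_lt_compat, Cmod_gt_0, hs).
      assert (hn := Cmod_ge_0 (Cprod v n)).
      apply Rmult_le_compat; [apply Rmult_le_pos; lra|apply pow_le; lra| |].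
      * apply Rmult_le_compat; try lra; [apply HK|apply HLn].
      * assert (b1 : binom2 (S s) = (binom2 s + s)%nat) by reflexivity.
        replace (s * n + binom2 (S s))%nat with ((n + s) + ((s - 1) * n + binom2 s))%nat by nia.
        rewrite pow_add. assert (P1 := pow_bounds q (n + s) Hx).
        assert (P2 := pow_bounds q ((s - 1) * n + binom2 s) Hx). nra.
    + rewrite lsum_scal.
      assert (HS : (lsum (fun s => q ^ s) (seq 1 n) <= G)%R).
      { apply has_sum_ge_lsum; [intros; apply pow_le; lra|exact HG|apply seq_NoDup]. }
      assert (Hqn := pow_bounds q n Hx). assert (HK0 : (0 < K)%R) by apply exp_pos.
      replace (K * L * G * q ^ n)%R with (K * L * q ^ n * G)%R by ring.
      apply Rmult_le_compat_l; [|exact HS]. apply Rmult_le_pos; [apply Rmult_le_pos|]; lra.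
  - apply is_lim_seq_const.
  - replace (Finite 0) with (Finite (K * L * G * 0)) by (f_equal; ring).
    apply is_lim_seq_mult'; [apply is_lim_seq_const|].
    apply is_lim_seq_geom. rewrite Rabs_pos_eq; lra.
Qed.

(** * Multiplying over the fifth roots of unity *)

Definition is_zeta5 (z : C) : Prop := 1 + z + z ^ 2 + z ^ 3 + z ^ 4 = 0.

(** The root of z^2 - 2 c z + 1 with c = cos (2 pi / 5) = (sqrt 5 - 1) / 4. *)
Lemma zeta5_exists : exists z, is_zeta5 z.
Proof.
  set (c := ((sqrt 5 - 1) / 4)%R).
  assert (H5 : (sqrt 5 * sqrt 5 = 5)%R) by (apply sqrt_sqrt; lra).
  assert (H5b : (2 < sqrt 5 < 3)%R).
  { assert (h := sqrt_pos 5). split; nra. }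
  assert (Hc : (4 * c * c + 2 * c - 1 = 0)%R) by (unfold c; lra).
  assert (Hs : (sqrt (1 - c * c) * sqrt (1 - c * c) = 1 - c * c)%R).
  { apply sqrt_sqrt. unfold c. nra. }
  set (s := sqrt (1 - c * c)) in *.
  exists (c, s). unfold is_zeta5.
  assert (E : (c, s) ^ 2 = 2 * RtoC c * (c, s) - 1).
  { unfold Cpow, Cmult, Cminus, Cplus, Copp, RtoC. simpl. f_equal; lra. }
  set (z := (c, s)) in *.
  assert (Hc' : 4 * RtoC c * RtoC c + 2 * RtoC c - 1 = 0).
  { rewrite <- RtoC_mult, <- RtoC_mult, <- RtoC_mult, <- RtoC_plus, <- RtoC_minus, Hc. reflexivity. }
  transitivity ((z ^ 2 - (2 * RtoC c * z - 1)) * (z ^ 2 + (1 + 2 * RtoC c) * z + 1)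
    + z ^ 2 * (4 * RtoC c * RtoC c + 2 * RtoC c - 1)); [ring|].
  rewrite E, Hc'. ring.
Qed.

Lemma zeta5_pow5 z : is_zeta5 z -> z ^ 5 = 1.
Proof.
  intros H. unfold is_zeta5 in H.
  transitivity ((z - 1) * (1 + z + z ^ 2 + z ^ 3 + z ^ 4) + 1); [ring|]. rewrite H. ring.
Qed.

Lemma Cmod_zeta5 w : w ^ 5 = 1 -> Cmod w = 1%R.
Proof.
  intros H. assert (E : (Cmod w ^ 5 = 1)%R) by (rewrite <- Cmod_pow, H; apply Cmod_1).
  assert (h := Cmod_ge_0 w). destruct (Rtotal_order (Cmod w) 1) as [L|[L|L]]; [|exact L|].
  - assert (h4 : (Cmod w ^ 4 <= 1)%R) by (rewrite <- (pow1 4); apply pow_incr; lra).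
    change (Cmod w ^ 5)%R with (Cmod w * Cmod w ^ 4)%R in E. nra.
  - assert (1 < Cmod w ^ 5)%R; [|lra]. apply Rlt_pow_R1; [exact L|lia].
Qed.

Lemma zeta5_elim z : is_zeta5 z -> z ^ 4 = - (1 + z + z ^ 2 + z ^ 3).
Proof. intros H. unfold is_zeta5 in H. transitivity (z ^ 4 - 0); [ring|]. rewrite <- H. ring. Qed.

Lemma norm_linear z x : is_zeta5 z ->
  (1 - x) * (1 - z * x) * (1 - z ^ 2 * x) * (1 - z ^ 3 * x) * (1 - z ^ 4 * x) = 1 - x ^ 5.
Proof. intros H. assert (E := zeta5_elim z H). ring [E]. Qed.

(** The norm from Q(zeta_5), on elements without zeta^3 and zeta^4 components. *)
Lemma norm_quadratic z a b c : is_zeta5 z ->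
  (a + b + c) * (a + z * b + z ^ 2 * c) * (a + z ^ 2 * b + z ^ 4 * c)
    * (a + z ^ 3 * b + z ^ 6 * c) * (a + z ^ 4 * b + z ^ 8 * c)
  = a ^ 5 + b ^ 5 + c ^ 5 - 5 * a * b ^ 3 * c + 5 * a ^ 2 * b * c ^ 2.
Proof. intros H. assert (E := zeta5_elim z H). ring [E]. Qed.

Lemma Clim_mult u v l m : Clim u l -> Clim v m -> Clim (fun n => u n * v n) (l * m).
Proof.
  unfold Clim. intros Hu Hv.
  apply is_lim_seq_le_le with (fun _ => 0%R) (fun n =>
    Cmod (u n - l) * (Cmod m + Cmod (v n - m)) + Cmod l * Cmod (v n - m))%R.
  - intros n. split; [apply Cmod_ge_0|].
    replace (u n * v n - l * m) with ((u n - l) * (m + (v n - m)) + l * (v n - m)) by ring.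
    eapply Rle_trans; [apply Cmod_triangle|]. rewrite !Cmod_mult.
    apply Rplus_le_compat_r, Rmult_le_compat_l; [apply Cmod_ge_0|apply Cmod_triangle].
  - apply is_lim_seq_const.
  - replace (Finite 0) with (Finite (0 * (Cmod m + 0) + Cmod l * 0)) by (f_equal; ring).
    apply is_lim_seq_plus'; apply is_lim_seq_mult'; try assumption;
      try apply is_lim_seq_plus'; try assumption; apply is_lim_seq_const.
Qed.

Lemma Clim_plus u v l m : Clim u l -> Clim v m -> Clim (fun n => u n + v n) (l + m).
Proof.
  unfold Clim. intros Hu Hv.
  apply is_lim_seq_le_le with (fun _ => 0%R) (fun n => Cmod (u n - l) + Cmod (v n - m))%R.
  - intros n. split; [apply Cmod_ge_0|].
    replace (u n + v n - (l + m)) with ((u n - l) + (v n - m)) by ring. apply Cmod_triangle.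
  - apply is_lim_seq_const.
  - replace (Finite 0) with (Finite (0 + 0)) by (f_equal; ring).
    apply is_lim_seq_plus'; assumption.
Qed.

Lemma Clim_const l : Clim (fun _ => l) l.
Proof.
  apply is_lim_seq_ext with (fun _ => 0%R); [|apply is_lim_seq_const].
  intros n. replace (l - l) with (RtoC 0) by ring. symmetry; apply Cmod_0.
Qed.

Lemma Clim_RtoC u (l : R) : is_lim_seq u l -> Clim (fun n => RtoC (u n)) (RtoC l).
Proof.
  intros H. apply is_lim_seq_ext with (fun n => Rabs (u n - l)).
  - intros n. rewrite <- RtoC_minus, Cmod_R. reflexivity.
  - replace (Finite 0) with (Finite (Rabs 0)) by (f_equal; apply Rabs_R0).
    apply (is_lim_seq_abs _ (0%R)). replace (Finite 0) with (Finite (l - l)) by (f_equal; ring).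
    apply is_lim_seq_minus'; [exact H|apply is_lim_seq_const].
Qed.

Lemma Clim_unique u l m : Clim u l -> Clim u m -> l = m.
Proof.
  unfold Clim. intros Hl Hm.
  assert (H : is_lim_seq (fun _ : nat => Cmod (l - m)) 0%R).
  { apply is_lim_seq_le_le with (fun _ => 0%R) (fun n => Cmod (u n - l) + Cmod (u n - m))%R.
    - intros n. split; [apply Cmod_ge_0|].
      replace (l - m) with (- (u n - l) + (u n - m)) by ring.
      eapply Rle_trans; [apply Cmod_triangle|]. rewrite Cmod_opp. lra.
    - apply is_lim_seq_const.
    - replace (Finite 0) with (Finite (0 + 0)) by (f_equal; ring).
      apply is_lim_seq_plus'; assumption. }
  assert (E : Cmod (l - m) = 0%R) by (apply (is_lim_seq_eq _ _ _ (is_lim_seq_const _) H)).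
  apply Cmod_eq_0 in E. replace l with ((l - m) + m) by ring. rewrite E. ring.
Qed.

Lemma Clim_ext u v l : (forall n, u n = v n) -> Clim u l -> Clim v l.
Proof. intros E. apply is_lim_seq_ext. intros n. rewrite E. reflexivity. Qed.

Close Scope C_scope.

Section Fifth.
Variable y : R.
Hypothesis Hy : 0 < y.

Let t := exp (- (y / 5)).
Let A := 15 * y / 2.

Lemma t_pow n u : INR n * y = 5 * u -> t ^ n = exp (- u).
Proof.
  intros H. unfold t. rewrite exp_pow. f_equal. nra.
Qed.

Definition dterm0 (m : Z) : R := gterm true A (y / 2) m + t ^ 5 * gterm true A (- (11 * y / 2)) m.
Definition dterm1 (m : Z) : R := - t * gterm true A (- (5 * y / 2)) m.
Definition dterm2 (m : Z) : R :=
  - t ^ 2 * gterm true A (7 * y / 2) m + t ^ 7 * gterm true A (13 * y / 2) m.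

Lemma A_pos : 0 < A.
Proof. unfold A. lra. Qed.

Lemma t_pow5 : t ^ 5 = exp (- y).
Proof. apply t_pow. simpl. ring. Qed.

Lemma dterm0_sum : has_sum dterm0 (dis0 y).
Proof.
  unfold dterm0, dis0. fold A. rewrite <- t_pow5. apply has_sum_plus; [apply theta_has_sum, A_pos|].
  rewrite <- (theta_opp true A (11 * y / 2)) by apply A_pos.
  apply has_sum_scal, theta_has_sum, A_pos.
Qed.

Lemma dterm1_sum : has_sum dterm1 (- t * f1 (5 * y)).
Proof.
  unfold dterm1, f1. rewrite <- euler_pentagonal by lra.
  replace (3 * (5 * y) / 2) with A by (unfold A; field).
  rewrite <- (theta_opp true A (5 * y / 2)) by apply A_pos.
  apply has_sum_scal, theta_has_sum, A_pos.
Qed.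

Lemma dterm2_sum : has_sum dterm2 (- t ^ 2 * dis2 y).
Proof.
  unfold dterm2, dis2. fold A. rewrite <- t_pow5.
  replace (- t ^ 2 * (theta true A (7 * y / 2) - t ^ 5 * theta true A (13 * y / 2)))
    with (- t ^ 2 * theta true A (7 * y / 2) + t ^ 7 * theta true A (13 * y / 2)) by ring.
  apply has_sum_plus; apply has_sum_scal, theta_has_sum, A_pos.
Qed.

Lemma lsum_zrange_S (f : Z -> R) n :
  lsum f (zrange (S n)) = lsum f (zrange n) + (f (Z.of_nat (S n)) + f (- Z.of_nat (S n))%Z).
Proof.
  rewrite (lsum_perm f (zrange (S n)) (Z.of_nat (S n) :: (- Z.of_nat (S n))%Z :: zrange n)).
  - unfold lsum. cbn [fold_right]. ring.
  - apply NoDup_Permutation.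
    + apply zrange_NoDup.
    + constructor; [|constructor; [|apply zrange_NoDup]].
      * cbn [In]. rewrite in_zrange. lia.
      * rewrite in_zrange. lia.
    + intros z. cbn [In]. rewrite !in_zrange. lia.
Qed.

Lemma gterm_pos B k (n m : nat) :
  INR k * y = 5 * (A * INR n ^ 2 + B * INR n) + INR m * y ->
  t ^ m * gterm true A B (Z.of_nat n) = (-1) ^ n * t ^ k.
Proof.
  intros H. unfold gterm. rewrite sg_true_nat, <- INR_IZR_INZ.
  rewrite (t_pow k ((A * INR n ^ 2 + B * INR n) + INR m * y / 5)) by lra.
  rewrite (t_pow m (INR m * y / 5)) by field.
  rewrite (Ropp_plus_distr (A * INR n ^ 2 + B * INR n)), exp_plus. ring.
Qed.

Lemma gterm_neg B k (n m : nat) :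
  INR k * y = 5 * (A * INR n ^ 2 - B * INR n) + INR m * y ->
  t ^ m * gterm true A B (- Z.of_nat n) = (-1) ^ n * t ^ k.
Proof.
  intros H. rewrite <- (gterm_pos (- B) k n m) by lra. f_equal. unfold gterm.
  rewrite sg_opp, opp_IZR. f_equal. f_equal. ring.
Qed.

Open Scope C_scope.

Lemma Cpow_fifth w j r : w ^ 5 = 1 -> w ^ (5 * j + r) = w ^ r.
Proof. intros H. rewrite Cpow_add_r, Cpow_mult_r, H, Cpow_1_l. ring. Qed.

Lemma binom2_INR n : (INR n * INR n = 2 * INR (binom2 n) + INR n)%R.
Proof. rewrite <- mult_INR, <- binom2_spec, plus_INR, mult_INR. reflexivity. Qed.

Ltac exponent n :=
  assert (Hb := binom2_INR n);
  rewrite ?plus_INR, ?mult_INR;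
  set (b := INR (binom2 n)) in *; set (m := INR n) in *;
  rewrite ?INR_IZR_INZ; simpl Z.of_nat; unfold A;
  replace (m ^ 2)%R with (2 * b + m)%R by (rewrite <- Hb; ring); field.

Lemma dterm0_pair n :
  (dterm0 (Z.of_nat n) + dterm0 (- Z.of_nat n)
  = (-1) ^ n * (t ^ (75 * binom2 n + 40 * n) + t ^ (75 * binom2 n + 10 * n + 5)
     + t ^ (75 * binom2 n + 35 * n) + t ^ (75 * binom2 n + 65 * n + 5)))%R.
Proof.
  rewrite !Rmult_plus_distr_l.
  rewrite <- (gterm_pos (y / 2) (75 * binom2 n + 40 * n) n 0) by exponent n.
  rewrite <- (gterm_pos (- (11 * y / 2)) (75 * binom2 n + 10 * n + 5) n 5) by exponent n.
  rewrite <- (gterm_neg (y / 2) (75 * binom2 n + 35 * n) n 0) by exponent n.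
  rewrite <- (gterm_neg (- (11 * y / 2)) (75 * binom2 n + 65 * n + 5) n 5) by exponent n.
  unfold dterm0. ring.
Qed.

Lemma dterm1_pair n :
  (dterm1 (Z.of_nat n) + dterm1 (- Z.of_nat n)
  = (-1) ^ n * - (t ^ (75 * binom2 n + 25 * n + 1) + t ^ (75 * binom2 n + 50 * n + 1)))%R.
Proof.
  rewrite Ropp_plus_distr, Rmult_plus_distr_l, !Ropp_mult_distr_r_reverse.
  rewrite <- (gterm_pos (- (5 * y / 2)) (75 * binom2 n + 25 * n + 1) n 1) by exponent n.
  rewrite <- (gterm_neg (- (5 * y / 2)) (75 * binom2 n + 50 * n + 1) n 1) by exponent n.
  unfold dterm1. ring.
Qed.

Lemma dterm2_pair n :
  (dterm2 (Z.of_nat n) + dterm2 (- Z.of_nat n)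
  = (-1) ^ n * (- (t ^ (75 * binom2 n + 55 * n + 2) + t ^ (75 * binom2 n + 20 * n + 2))
     + (t ^ (75 * binom2 n + 70 * n + 7) + t ^ (75 * binom2 n + 5 * n + 7))))%R.
Proof.
  rewrite Ropp_plus_distr, !Rmult_plus_distr_l, !Ropp_mult_distr_r_reverse.
  rewrite <- (gterm_pos (7 * y / 2) (75 * binom2 n + 55 * n + 2) n 2) by exponent n.
  rewrite <- (gterm_neg (7 * y / 2) (75 * binom2 n + 20 * n + 2) n 2) by exponent n.
  rewrite <- (gterm_pos (13 * y / 2) (75 * binom2 n + 70 * n + 7) n 7) by exponent n.
  rewrite <- (gterm_neg (13 * y / 2) (75 * binom2 n + 5 * n + 7) n 7) by exponent n.
  unfold dterm2. ring.
Qed.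

Lemma Csign_5 n r : Csign (5 * n + r) = Csign n * Csign r.
Proof.
  unfold Csign. rewrite <- RtoC_mult. f_equal. rewrite pow_add, pow_mult.
  replace ((-1) ^ 5)%R with (-1)%R by ring. reflexivity.
Qed.

Lemma wt_pow w j r k : w ^ 5 = 1 -> k = (5 * j + r)%nat ->
  (w * t) ^ k = w ^ r * RtoC (t ^ k)%R.
Proof.
  intros Hw ->. rewrite Cpow_mult_l, Cpow_fifth, RtoC_pow by exact Hw. reflexivity.
Qed.

(** The pentagonal numbers k (3 k + 1) / 2 sorted by k modulo 5. *)
Lemma pentsum_dissection w M : w ^ 5 = 1 ->
  pentsum (w * t) (5 * M + 2) =
  RtoC (lsum dterm0 (zrange M)) + w * RtoC (lsum dterm1 (zrange M))
  + w ^ 2 * RtoC (lsum dterm2 (zrange M)).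
Proof.
  intros Hw. induction M as [|M IH].
  - assert (E : forall B, gterm true A B 0 = 1%R).
    { intros B. unfold gterm, sg. simpl. replace (- (A * (0 * (0 * 1)) + B * 0))%R with 0%R by ring.
      rewrite exp_0. ring. }
    unfold zrange. simpl seq. simpl map. simpl lsum. unfold dterm0, dterm1, dterm2.
    rewrite !E, !Rmult_1_r, !Rplus_0_r. cbn [pentsum Nat.mul Nat.add]. unfold pent. simpl binom2.
    unfold Csign. simpl Nat.mul. simpl Nat.add.
    rewrite !RtoC_plus, !RtoC_opp, !RtoC_pow.
    replace ((w * t) ^ 7) with (w ^ 5 * w ^ 2 * RtoC t ^ 7) by ring.
    replace ((w * t) ^ 5) with (w ^ 5 * RtoC t ^ 5) by ring.
    rewrite Hw. ring.
  - rewrite !lsum_zrange_S, !RtoC_plus.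
    replace (5 * S M + 2)%nat with (S (S (S (S (S (5 * M + 2))))))%nat by lia.
    cbn [pentsum]. rewrite IH. clear IH.
    rewrite <- !RtoC_plus, dterm0_pair, dterm1_pair, dterm2_pair, !RtoC_plus.
    set (P0 := lsum dterm0 (zrange M)). set (P1 := lsum dterm1 (zrange M)).
    set (P2 := lsum dterm2 (zrange M)).
    (* with n = M + 1 the new indices are 5 n - 2, ..., 5 n + 2 and their opposites *)
    set (n := S M). assert (b := binom2_spec n).
    replace (S (5 * M + 2)) with (5 * n - 2)%nat by lia.
    replace (S (5 * n - 2)) with (5 * n - 1)%nat by lia.
    replace (S (5 * n - 1)) with (5 * n)%nat by lia.
    replace (S (5 * n)) with (5 * n + 1)%nat by lia.
    replace (S (5 * n + 1)) with (5 * n + 2)%nat by lia.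
    assert (p1 : pent (5 * n - 2) = (75 * binom2 n + 5 * n + 7)%nat).
    { unfold pent. assert (h := binom2_spec (5 * n - 2)). nia. }
    assert (p2 : pent (5 * n - 1) = (75 * binom2 n + 20 * n + 2)%nat).
    { unfold pent. assert (h := binom2_spec (5 * n - 1)). nia. }
    assert (p3 : pent (5 * n) = (75 * binom2 n + 35 * n)%nat).
    { unfold pent. assert (h := binom2_spec (5 * n)). nia. }
    assert (p4 : pent (5 * n + 1) = (75 * binom2 n + 50 * n + 1)%nat).
    { unfold pent. assert (h := binom2_spec (5 * n + 1)). nia. }
    assert (p5 : pent (5 * n + 2) = (75 * binom2 n + 65 * n + 5)%nat).
    { unfold pent. assert (h := binom2_spec (5 * n + 2)). nia. }
    assert (s1 : Csign (5 * n - 2) = Csign n).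
    { replace (5 * n - 2)%nat with (5 * M + 3)%nat by lia. rewrite Csign_5. unfold n.
      rewrite !Csign_S. change (Csign 0) with (RtoC 1). ring. }
    assert (s2 : Csign (5 * n - 1) = - Csign n).
    { replace (5 * n - 1)%nat with (S (5 * n - 2)) by lia. rewrite Csign_S, s1. reflexivity. }
    assert (s3 : Csign (5 * n) = Csign n).
    { rewrite <- (Nat.add_0_r (5 * n)), Csign_5. unfold Csign at 2. simpl. ring. }
    assert (s4 : Csign (5 * n + 1) = - Csign n).
    { rewrite Nat.add_1_r, Csign_S, s3. reflexivity. }
    assert (s5 : Csign (5 * n + 2) = Csign n).
    { replace (5 * n + 2)%nat with (S (5 * n + 1)) by lia. rewrite Csign_S, s4. ring. }
    rewrite p1, p2, p3, p4, p5, s1, s2, s3, s4, s5.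
    replace (75 * binom2 n + 5 * n + 7 + (5 * n - 2))%nat with (75 * binom2 n + 10 * n + 5)%nat by lia.
    replace (75 * binom2 n + 20 * n + 2 + (5 * n - 1))%nat with (75 * binom2 n + 25 * n + 1)%nat by lia.
    replace (75 * binom2 n + 35 * n + 5 * n)%nat with (75 * binom2 n + 40 * n)%nat by lia.
    replace (75 * binom2 n + 50 * n + 1 + (5 * n + 1))%nat with (75 * binom2 n + 55 * n + 2)%nat by lia.
    replace (75 * binom2 n + 65 * n + 5 + (5 * n + 2))%nat with (75 * binom2 n + 70 * n + 7)%nat by lia.
    rewrite (wt_pow w (15 * binom2 n + n + 1) 2 (75 * binom2 n + 5 * n + 7)) by (exact Hw || lia).
    rewrite (wt_pow w (15 * binom2 n + 2 * n + 1) 0 (75 * binom2 n + 10 * n + 5)) by (exact Hw || lia).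
    rewrite (wt_pow w (15 * binom2 n + 4 * n) 2 (75 * binom2 n + 20 * n + 2)) by (exact Hw || lia).
    rewrite (wt_pow w (15 * binom2 n + 5 * n) 1 (75 * binom2 n + 25 * n + 1)) by (exact Hw || lia).
    rewrite (wt_pow w (15 * binom2 n + 7 * n) 0 (75 * binom2 n + 35 * n)) by (exact Hw || lia).
    rewrite (wt_pow w (15 * binom2 n + 8 * n) 0 (75 * binom2 n + 40 * n)) by (exact Hw || lia).
    rewrite (wt_pow w (15 * binom2 n + 10 * n) 1 (75 * binom2 n + 50 * n + 1)) by (exact Hw || lia).
    rewrite (wt_pow w (15 * binom2 n + 11 * n) 2 (75 * binom2 n + 55 * n + 2)) by (exact Hw || lia).
    rewrite (wt_pow w (15 * binom2 n + 13 * n + 1) 0 (75 * binom2 n + 65 * n + 5)) by (exact Hw || lia).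
    rewrite (wt_pow w (15 * binom2 n + 14 * n + 1) 2 (75 * binom2 n + 70 * n + 7)) by (exact Hw || lia).
    rewrite !RtoC_mult, !RtoC_plus, !RtoC_opp, !RtoC_plus. unfold Csign.
    set (e := RtoC ((-1) ^ n)%R). ring.
Qed.

(** Each factor index r contributes 1 - t^(5 r), or (1 - t^r)^5 when 5 divides r. *)
Lemma Cprod_norm z M : is_zeta5 z ->
  Cprod t (5 * M + 2) * Cprod (z * t) (5 * M + 2) * Cprod (z ^ 2 * t) (5 * M + 2)
    * Cprod (z ^ 3 * t) (5 * M + 2) * Cprod (z ^ 4 * t) (5 * M + 2)
    * RtoC (fprod (exp (- y) ^ 5) (5 * y) M)
  = RtoC (fprod (exp (- y)) y (5 * M + 2)) * RtoC (fprod (exp (- y)) y M) ^ 5.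
Proof.
  intros Hz. assert (H5 := zeta5_pow5 z Hz).
  assert (N : forall r j k, (r = 5 * j + k)%nat -> (1 <= k < 5)%nat ->
    (1 - t ^ r) * (1 - (z * t) ^ r) * (1 - (z ^ 2 * t) ^ r) * (1 - (z ^ 3 * t) ^ r)
      * (1 - (z ^ 4 * t) ^ r) = 1 - (RtoC t ^ 5) ^ r).
  { intros r j k -> Hk. set (x := RtoC t ^ (5 * j + k)).
    assert (Ez : forall i, (z ^ i * t) ^ (5 * j + k) = (z ^ k) ^ i * x).
    { intros i. unfold x. rewrite Cpow_mult_l. f_equal.
      rewrite <- !Cpow_mult_r. replace (i * (5 * j + k))%nat with (5 * (i * j) + k * i)%nat by ring.
      apply Cpow_fifth, H5. }
    assert (E1 := Ez 1%nat). rewrite !Cpow_1_r in E1.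
    rewrite E1, !Ez. replace ((RtoC t ^ 5) ^ (5 * j + k)) with (x ^ 5).
    2:{ unfold x. rewrite <- !Cpow_mult_r. f_equal. lia. }
    apply norm_linear. unfold is_zeta5 in *.
    assert (D : (k = 1 \/ k = 2 \/ k = 3 \/ k = 4)%nat) by lia.
    assert (E4 := zeta5_elim z Hz).
    destruct D as [-> |[-> |[-> | ->]]]; ring [E4]. }
  assert (N5 : forall r j, (r = 5 * j)%nat ->
    (1 - t ^ r) * (1 - (z * t) ^ r) * (1 - (z ^ 2 * t) ^ r) * (1 - (z ^ 3 * t) ^ r)
      * (1 - (z ^ 4 * t) ^ r) = (1 - (RtoC t ^ 5) ^ j) ^ 5).
  { intros r j ->.
    assert (Ez : forall i, (z ^ i * t) ^ (5 * j) = (RtoC t ^ 5) ^ j).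
    { intros i. rewrite !Cpow_mult_r. f_equal. rewrite Cpow_mult_l, <- Cpow_mult_r.
      replace (i * 5)%nat with (5 * i)%nat by lia. rewrite Cpow_mult_r, H5, Cpow_1_l. ring. }
    assert (E1 := Ez 1%nat). rewrite !Cpow_1_r in E1. rewrite E1, !Ez, Cpow_mult_r. ring. }
  assert (Ex : RtoC t ^ 5 = RtoC (exp (- y))) by (rewrite <- RtoC_pow, t_pow5; reflexivity).
  rewrite Ex in N, N5. set (x := exp (- y)) in *.
  assert (Fq : forall c u n, RtoC (fprod c u (S n)) = RtoC (fprod c u n) * (1 - RtoC c * RtoC (exp (- u)) ^ n)).
  { intros c u n. simpl fprod. rewrite RtoC_mult, RtoC_minus, RtoC_mult, RtoC_pow. reflexivity. }
  assert (F5 : RtoC (exp (- (5 * y))) = RtoC x ^ 5) by (rewrite exp_neg5, RtoC_pow; reflexivity).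
  induction M as [|M IH].
  - simpl Nat.mul. simpl Nat.add. rewrite !Fq. cbn [fprod Cprod].
    assert (n1 := N 1%nat 0%nat 1%nat eq_refl ltac:(lia)).
    assert (n2 := N 2%nat 0%nat 2%nat eq_refl ltac:(lia)).
    transitivity (((1 - t ^ 1) * (1 - (z * t) ^ 1) * (1 - (z ^ 2 * t) ^ 1) * (1 - (z ^ 3 * t) ^ 1)
      * (1 - (z ^ 4 * t) ^ 1)) * ((1 - t ^ 2) * (1 - (z * t) ^ 2) * (1 - (z ^ 2 * t) ^ 2)
      * (1 - (z ^ 3 * t) ^ 2) * (1 - (z ^ 4 * t) ^ 2))); [ring|].
    rewrite n1, n2. fold x. ring.
  - replace (5 * S M + 2)%nat with (S (S (S (S (S (5 * M + 2))))))%nat by lia.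
    rewrite !Fq. cbn [Cprod]. set (K := (5 * M + 2)%nat) in *.
    assert (n1 := N (S K) M 3%nat ltac:(lia) ltac:(lia)).
    assert (n2 := N (S (S K)) M 4%nat ltac:(lia) ltac:(lia)).
    assert (n3 := N5 (S (S (S K))) (S M) ltac:(lia)).
    assert (n4 := N (S (S (S (S K)))) (S M) 1%nat ltac:(lia) ltac:(lia)).
    assert (n5 := N (S (S (S (S (S K))))) (S M) 2%nat ltac:(lia) ltac:(lia)).
    rewrite F5. fold x.
    set (A0 := Cprod t K) in *. set (A1 := Cprod (z * t) K) in *.
    set (A2 := Cprod (z ^ 2 * t) K) in *. set (A3 := Cprod (z ^ 3 * t) K) in *.
    set (A4 := Cprod (z ^ 4 * t) K) in *.
    set (X1 := (1 - t ^ S K) * _ * _ * _ * _) in n1.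
    set (X2 := (1 - t ^ S (S K)) * _ * _ * _ * _) in n2.
    set (X3 := (1 - t ^ S (S (S K))) * _ * _ * _ * _) in n3.
    set (X4 := (1 - t ^ S (S (S (S K)))) * _ * _ * _ * _) in n4.
    set (X5 := (1 - t ^ S (S (S (S (S K))))) * _ * _ * _ * _) in n5.
    transitivity ((A0 * A1 * A2 * A3 * A4 * RtoC (fprod (x ^ 5) (5 * y) M))
      * X1 * X2 * X3 * X4 * X5 * (1 - RtoC (x ^ 5) * (RtoC x ^ 5) ^ M)).
    { unfold X1, X2, X3, X4, X5.
      repeat match goal with |- context [Cminus ?a (Cpow ?v ?k)] =>
        let g := fresh in set (g := Cminus a (Cpow v k)) end. ring. }
    rewrite IH, n1, n2, n3, n4, n5, RtoC_pow.
    replace ((RtoC x ^ 5) ^ M) with ((RtoC x ^ M) ^ 5)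
      by (rewrite <- !Cpow_mult_r; f_equal; lia).
    rewrite !(Cpow_S (RtoC x)). set (xM := RtoC x ^ M).
    assert (EK : RtoC x ^ K = RtoC x * RtoC x * xM ^ 5).
    { unfold K, xM. rewrite Nat.add_comm, Cpow_add_r, (Nat.mul_comm 5), Cpow_mult_r. ring. }
    rewrite EK. ring.
Qed.

End Fifth.

Lemma Cprod_lim y w : 0 < y -> (w ^ 5 = 1)%C ->
  Clim (fun M => Cprod (w * exp (- (y / 5)))%C (5 * M + 2))
    (RtoC (dis0 y) + w * RtoC (- exp (- (y / 5)) * f1 (5 * y))
     + w ^ 2 * RtoC (- exp (- (y / 5)) ^ 2 * dis2 y))%C.
Proof.
  intros Hy Hw. set (t := exp (- (y / 5))).
  assert (Hv : Cmod (w * t)%C = exp (- (y / 5))).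
  { rewrite Cmod_mult, (Cmod_zeta5 w Hw), Cmod_R, Rabs_pos_eq by (left; apply exp_pos).
    unfold t. ring. }
  assert (L := pentsum_minus_Cprod_lim (y / 5) (w * t)%C ltac:(lra) Hv).
  set (l := (RtoC (dis0 y) + w * RtoC (- t * f1 (5 * y)) + w ^ 2 * RtoC (- t ^ 2 * dis2 y))%C).
  replace l with (l + 0)%C by ring.
  apply Clim_ext with (fun M => pentsum (w * t)%C (5 * M + 2)
    + (Cprod (w * t)%C (5 * M + 2) - pentsum (w * t)%C (5 * M + 2)))%C; [intros; ring|].
  apply Clim_plus.
  - apply Clim_ext with (fun M => RtoC (lsum (dterm0 y) (zrange M))
      + w * RtoC (lsum (dterm1 y) (zrange M)) + w ^ 2 * RtoC (lsum (dterm2 y) (zrange M)))%C.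
    + intros M. symmetry. apply pentsum_dissection; assumption.
    + unfold l. apply Clim_plus; [apply Clim_plus|].
      * apply Clim_RtoC, has_sum_zrange, dterm0_sum, Hy.
      * apply Clim_mult; [apply Clim_const|]. apply Clim_RtoC, has_sum_zrange, dterm1_sum, Hy.
      * apply Clim_mult; [apply Clim_const|]. apply Clim_RtoC, has_sum_zrange, dterm2_sum, Hy.
  - unfold Clim.
    apply is_lim_seq_ext with (fun M => Cmod (pentsum (w * t)%C (5 * M + 2) - Cprod (w * t)%C (5 * M + 2))%C).
    + intros M. rewrite <- Cmod_opp. f_equal. ring.
    + apply (is_lim_seq_subseq _ _ (fun M => (5 * M + 2)%nat)) with (2 := L).
      apply eventually_subseq. intros n. lia.
Qed.

(** The finite products over the five values of u converge both to the norm of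
    the dissected series and to the eta quotient of [Cprod_norm]. *)
Lemma norm_of_dissection y : 0 < y ->
  let t := exp (- (y / 5)) in
  let a := dis0 y in let b := - t * f1 (5 * y) in let c := - t ^ 2 * dis2 y in
  (a ^ 5 + b ^ 5 + c ^ 5 - 5 * a * b ^ 3 * c + 5 * a ^ 2 * b * c ^ 2) * f1 (5 * y) = f1 y ^ 6.
Proof.
  intros Hy t a b c. destruct zeta5_exists as [z Hz]. assert (H5 := zeta5_pow5 z Hz).
  assert (Hx := exp_neg_bounds y Hy).
  assert (L : forall i, Clim (fun M => Cprod (z ^ i * t)%C (5 * M + 2))
    (RtoC a + z ^ i * RtoC b + (z ^ i) ^ 2 * RtoC c)%C).
  { intros i. apply Cprod_lim; [exact Hy|].
    rewrite <- Cpow_mult_r, Nat.mul_comm, Cpow_mult_r, H5, Cpow_1_l. reflexivity. }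
  assert (Lf : Clim (fun M => RtoC (fprod (exp (- y) ^ 5) (5 * y) M)) (RtoC (f1 (5 * y)))).
  { apply Clim_RtoC. unfold f1. rewrite exp_neg5. apply qprod_lim; [lra|].
    apply x_pow_lt1; [exact Hy|lia]. }
  assert (Lq : is_lim_seq (fprod (exp (- y)) y) (f1 y)) by (apply qprod_lim; lra).
  assert (Lq5 : Clim (fun M => RtoC (fprod (exp (- y)) y (5 * M + 2))) (RtoC (f1 y))).
  { apply Clim_RtoC. apply (is_lim_seq_subseq _ _ (fun M => (5 * M + 2)%nat)) with (2 := Lq).
    apply eventually_subseq. intros n. lia. }
  assert (Lq' := Clim_RtoC _ _ Lq).
  assert (E : ((RtoC a + RtoC b + RtoC c) * (RtoC a + z * RtoC b + z ^ 2 * RtoC c)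
    * (RtoC a + z ^ 2 * RtoC b + z ^ 4 * RtoC c) * (RtoC a + z ^ 3 * RtoC b + z ^ 6 * RtoC c)
    * (RtoC a + z ^ 4 * RtoC b + z ^ 8 * RtoC c) * RtoC (f1 (5 * y)))%C
    = (RtoC (f1 y) * RtoC (f1 y) ^ 5)%C).
  { apply (Clim_unique (fun M => RtoC (fprod (exp (- y)) y (5 * M + 2))
      * (RtoC (fprod (exp (- y)) y M) * (RtoC (fprod (exp (- y)) y M)
      * (RtoC (fprod (exp (- y)) y M) * (RtoC (fprod (exp (- y)) y M)
      * RtoC (fprod (exp (- y)) y M))))))%C).
    - assert (P := Clim_mult _ _ _ _ (Clim_mult _ _ _ _ (Clim_mult _ _ _ _ (Clim_mult _ _ _ _
        (Clim_mult _ _ _ _ (L 0%nat) (L 1%nat)) (L 2%nat)) (L 3%nat)) (L 4%nat)) Lf).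
      match type of P with Clim ?u ?l => match goal with |- Clim ?v ?m =>
        replace m with l by ring; apply (Clim_ext u v); [|exact P] end end.
      intros M. cbv beta.
      replace (z ^ 0 * t)%C with (RtoC t) by (simpl; ring).
      replace (z ^ 1 * t)%C with (z * t)%C by (simpl; ring).
      etransitivity; [exact (Cprod_norm y z M Hz)|]. ring.
    - replace (RtoC (f1 y) * RtoC (f1 y) ^ 5)%C with
        (RtoC (f1 y) * (RtoC (f1 y) * (RtoC (f1 y) * (RtoC (f1 y) * (RtoC (f1 y) * RtoC (f1 y))))))%C
        by ring.
      repeat (apply Clim_mult; [assumption|]). assumption. }
  rewrite norm_quadratic in E by exact Hz.
  clear L. clearbody a b c. apply RtoC_inj.
  repeat (rewrite RtoC_mult || rewrite RtoC_plus || rewrite RtoC_minus || rewrite RtoC_pow).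
  transitivity (RtoC (f1 y) * RtoC (f1 y) ^ 5)%C; [|ring]. rewrite <- E. ring.
Qed.

(** With u = q^(1/5) the dissection is (q^5; q^5) (u / R - u - u R), whose norm is
    q (q^5; q^5)^5 (R^(-5) - 11 - R^5). *)
Theorem rr_quintic y : 0 < y ->
  / rogers_ramanujan (exp (- y)) ^ 5 - 11 - rogers_ramanujan (exp (- y)) ^ 5
  = exp y * f1 y ^ 6 / f1 (5 * y) ^ 6.
Proof.
  intros Hy. rewrite rogers_ramanujan_theta by exact Hy.
  assert (N := norm_of_dissection y Hy). cbv zeta in N.
  assert (HN := rr_num_pos y Hy). assert (HD := rr_den_pos y Hy).
  assert (HF := f1_pos (5 * y) ltac:(lra)). assert (Ht := exp_pos (- (y / 5))).
  assert (D0 := dis0_product y Hy). assert (D2 := dis2_product y Hy).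
  assert (E5 : exp y * exp (- (y / 5)) ^ 5 = 1).
  { rewrite exp_pow, <- exp_plus, <- exp_0. f_equal. simpl. field. }
  set (t := exp (- (y / 5))) in *. set (n := rr_num y) in *. set (d := rr_den y) in *.
  set (F := f1 (5 * y)) in *.
  replace (dis0 y) with (F * d / n) in N by (rewrite <- D0; field; lra).
  replace (dis2 y) with (F * n / d) in N by (rewrite <- D2; field; lra).
  rewrite <- N. replace (exp y) with (/ t ^ 5).
  - field. repeat split; lra.
  - apply Rmult_eq_reg_r with (t ^ 5); [|apply pow_nonzero; lra]. rewrite E5. field. lra.
Qed.

(** * The class invariant a_r *)

Lemma sqrt_25 r : 0 <= r -> sqrt (25 * r) = 5 * sqrt r.
Proof.
  intros Hr. rewrite sqrt_mult by lra. f_equal.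
  replace 25 with (5 ^ 2) by ring. apply sqrt_pow2. lra.
Qed.

(** Here t2 t3 t4 = 2 q^(1/4) (q^2; q^2)^3, and t4 is (q; q)^2 / (q^2; q^2). *)
Lemma t4_eta y : 0 < y -> t4 y ^ 4 * (t2 y * t3 y) = 2 * exp (- (y / 4)) * f1 y ^ 6.
Proof.
  intros Hy. assert (Hx := exp_neg_bounds y Hy).
  assert (E : f1 y = qN y * qE y).
  { unfold f1, qN, qE. rewrite (qprod_section2 (exp (- y)) y) by lra. f_equal. f_equal. ring. }
  assert (H := t234_product y Hy). rewrite E.
  transitivity (t4 y ^ 3 * (t2 y * t3 y * t4 y)); [ring|].
  rewrite H, t4_product by exact Hy. ring.
Qed.

Section Invariant.
Variable y : R.
Hypothesis Hy : 0 < y.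

Let H5 : 0 < 5 * y.
Proof. lra. Qed.

(** With k and l the moduli at y and 5 y: the square roots of l / k
    and l' / k', and the multiplier K (k) / K (l). *)
Definition rho : R := t2 (5 * y) * t3 y / (t3 (5 * y) * t2 y).
Definition sigma : R := t4 (5 * y) * t3 y / (t3 (5 * y) * t4 y).
Definition mult : R := t3 y ^ 2 / t3 (5 * y) ^ 2.

Lemma rho_pos : 0 < rho.
Proof.
  destruct (t_pos y Hy) as [a2 [a3 a4]]. destruct (t_pos _ H5) as [b2 [b3 b4]].
  unfold rho. apply Rdiv_lt_0_compat; nra.
Qed.

Lemma sigma_pos : 0 < sigma.
Proof.
  destruct (t_pos y Hy) as [a2 [a3 a4]]. destruct (t_pos _ H5) as [b2 [b3 b4]].
  unfold sigma. apply Rdiv_lt_0_compat; nra.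
Qed.

Lemma kmod5 : kmod (5 * y) = kmod y * rho ^ 2.
Proof.
  destruct (t_pos y Hy) as [a2 [a3 a4]]. destruct (t_pos _ H5) as [b2 [b3 b4]].
  unfold kmod, rho. field. repeat split; lra.
Qed.

Lemma rho_lt1 : rho < 1.
Proof.
  assert (Hk := kmod_bounds y Hy). assert (Hl := kmod_bounds _ H5). assert (HP := PI_RGT_0).
  assert (Hr := rho_pos).
  assert (L : kmod (5 * y) < kmod y).
  { destruct (Rtotal_order (kmod (5 * y)) (kmod y)) as [h|[h|h]]; [exact h| |]; exfalso.
    - assert (E := f_equal Kratio h). rewrite !Kratio_kmod in E by lra.
      apply (f_equal (fun u => u * PI)) in E. unfold Rdiv in E.
      rewrite !Rmult_assoc, Rinv_l in E by lra. lra.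
    - assert (E := Kratio_lt _ _ (proj1 Hk) h (proj2 Hl)). rewrite !Kratio_kmod in E by lra.
      apply (Rmult_lt_compat_r PI) in E; [|lra]. unfold Rdiv in E.
      rewrite !Rmult_assoc, Rinv_l in E by lra. lra. }
  rewrite kmod5 in L. apply Rnot_le_lt. intros h. assert (1 <= rho ^ 2) by nra. nra.
Qed.

Lemma rel_mult_rho_sigma : mult * (mult - 1) = (5 - mult) * (rho * sigma).
Proof.
  destruct (t_pos y Hy) as [a2 [a3 a4]]. destruct (t_pos _ H5) as [b2 [b3 b4]].
  assert (R := degree5_t3 y Hy). unfold mult, rho, sigma.
  apply Rmult_eq_reg_r with (t3 (5 * y) ^ 4 * t2 y * t4 y / t3 y ^ 2).
  - transitivity ((t3 y ^ 2 - t3 (5 * y) ^ 2) * (t2 y * t4 y)); [field; repeat split; lra|].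
    rewrite R. field. repeat split; lra.
  - apply Rgt_not_eq. apply Rdiv_lt_0_compat; [|apply pow_lt; lra].
    apply Rmult_lt_0_compat; [apply Rmult_lt_0_compat; [apply pow_lt|]|]; lra.
Qed.

Lemma rel_mult_sigma_rho : mult * (mult - rho) = sigma ^ 2 * (mult - 5 * rho).
Proof.
  destruct (t_pos y Hy) as [a2 [a3 a4]]. destruct (t_pos _ H5) as [b2 [b3 b4]].
  assert (R := degree5_t4 y Hy). unfold mult, rho, sigma.
  apply Rmult_eq_reg_r with (t3 (5 * y) ^ 4 * t2 y * t4 y ^ 2 / t3 y ^ 3).
  - apply Rminus_diag_uniq.
    transitivity ((5 * t4 (5 * y) ^ 2 - t4 y ^ 2) * (t2 (5 * y) * t3 (5 * y))
      - (t4 (5 * y) ^ 2 - t4 y ^ 2) * (t2 y * t3 y)); [field; repeat split; lra|].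
    rewrite R. ring.
  - apply Rgt_not_eq. apply Rdiv_lt_0_compat; [|apply pow_lt; lra].
    apply Rmult_lt_0_compat; [apply Rmult_lt_0_compat; [apply pow_lt|]|apply pow_lt]; lra.
Qed.

Lemma mult_eq : mult = rho + sigma - rho * sigma.
Proof.
  assert (R1 := rel_mult_rho_sigma). assert (R2 := rel_mult_sigma_rho).
  assert (Hs := sigma_pos).
  assert (Hm : 0 < mult).
  { destruct (t_sq_pos y Hy) as [_ [a _]]. destruct (t_sq_pos _ H5) as [_ [b _]].
    apply Rdiv_lt_0_compat; assumption. }
  apply Rmult_eq_reg_l with (mult * (1 + sigma)); [|apply Rgt_not_eq; nra].
  (* the two quadratics in the multiplier share their last coefficient up to sigma *)
  apply Rminus_diag_uniq.
  transitivity ((mult * (mult - rho) - sigma ^ 2 * (mult - 5 * rho))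
    + sigma * (mult * (mult - 1) - (5 - mult) * (rho * sigma))); [ring|].
  rewrite R1, R2. ring.
Qed.

(** The first quadratic with the multiplier eliminated. *)
Lemma rho_sigma_quadratic : (1 - rho) * (sigma ^ 2 - rho) = (1 + rho) ^ 2 * sigma.
Proof. assert (R := rel_mult_rho_sigma). rewrite mult_eq in R. nra. Qed.

Lemma sigma_fourth :
  (sigma ^ 4 + rho ^ 2) * (1 - rho) ^ 2 = (1 + rho ^ 2) * (1 + 6 * rho + rho ^ 2) * sigma ^ 2.
Proof.
  assert (Q := rho_sigma_quadratic).
  apply Rminus_diag_uniq.
  transitivity (((1 - rho) * (sigma ^ 2 - rho)) ^ 2 - ((1 + rho) ^ 2 * sigma) ^ 2); [ring|].
  rewrite Q. ring.
Qed.

Lemma kmod_sigma : kmod y ^ 2 * rho ^ 4 + (1 - kmod y ^ 2) * sigma ^ 4 = 1.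
Proof.
  destruct (t_pos y Hy) as [a2 [a3 a4]]. destruct (t_pos _ H5) as [b2 [b3 b4]].
  assert (Q := jacobi_quartic y Hy). assert (Q5 := jacobi_quartic _ H5).
  replace (1 - kmod y ^ 2) with (t4 y ^ 4 / t3 y ^ 4).
  - unfold kmod, rho, sigma. field_simplify_eq; [lra|repeat split; lra].
  - unfold kmod. field_simplify_eq; [lra|lra].
Qed.

(** The modular equation of degree 5, squared to avoid sqrt rho: k^2 is a
    rational function of rho and sigma^4 by [kmod_sigma], and sigma occurs only
    through sigma^2 + rho^2 / sigma^2, which [sigma_fourth] eliminates. *)
Lemma modular_squared :
  kmod y ^ 2 * ((1 - rho) * (1 + 6 * rho + rho ^ 2)) ^ 2
  = 16 * rho * (1 - kmod y ^ 2 * rho ^ 2) ^ 2.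
Proof.
  assert (F := sigma_fourth). assert (K := kmod_sigma).
  assert (Hr := rho_pos). assert (Hr1 := rho_lt1). assert (Hs := sigma_pos).
  assert (Q := rho_sigma_quadratic). assert (Hk := kmod_bounds y Hy).
  set (r := rho) in *. set (s := sigma) in *. set (u := kmod y ^ 2) in *.
  assert (Hu : 0 < u < 1) by (unfold u; split; [apply pow_lt|]; nra).
  assert (Hr4 : r ^ 4 < 1) by (assert (r ^ 2 < 1) by nra; simpl in *; nra).
  assert (Hs4 : 1 < s ^ 4).
  { assert (0 < r ^ 4) by (apply pow_lt; lra).
    apply Rnot_le_lt. intros h. nra. }
  assert (E1 : u * (s ^ 4 - r ^ 4) = s ^ 4 - 1) by lra.
  assert (E2 : (1 - u * r ^ 2) * (s ^ 4 - r ^ 4) = (1 - r ^ 2) * (r ^ 2 + s ^ 4)).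
  { transitivity (s ^ 4 - r ^ 4 - r ^ 2 * (u * (s ^ 4 - r ^ 4))); [ring|]. rewrite E1. ring. }
  apply Rmult_eq_reg_r with ((s ^ 4 - r ^ 4) ^ 2 * (1 - r) ^ 2).
  - set (c := 1 + 6 * r + r ^ 2) in *.
    transitivity ((u * (s ^ 4 - r ^ 4)) * (s ^ 4 - r ^ 4) * c ^ 2 * (1 - r) ^ 4); [ring|].
    rewrite E1.
    transitivity (16 * r * ((1 - u * r ^ 2) * (s ^ 4 - r ^ 4)) ^ 2 * (1 - r) ^ 2); [|ring].
    rewrite E2.
    transitivity ((((s ^ 4 + r ^ 2) * (1 - r) ^ 2) ^ 2 - (1 + r ^ 2) ^ 2 * s ^ 4 * (1 - r) ^ 4) * c ^ 2);
      [ring|].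
    transitivity (16 * r * (1 + r) ^ 2 * ((s ^ 4 + r ^ 2) * (1 - r) ^ 2) ^ 2); [|ring].
    rewrite F. unfold c. ring.
  - apply Rgt_not_eq, Rmult_lt_0_compat; apply pow_lt; lra.
Qed.

(** Both sides are positive as 0 < rho < 1, which fixes the square root. *)
Lemma modular_equation :
  let T := sqrt rho in
  kmod y * ((1 - T ^ 2) * (1 + 6 * T ^ 2 + T ^ 4)) = 4 * T * (1 - kmod y ^ 2 * T ^ 4).
Proof.
  intros T. assert (Hr := rho_pos). assert (Hr1 := rho_lt1). assert (Hk := kmod_bounds y Hy).
  assert (HT : 0 < T) by (apply sqrt_lt_R0; exact Hr).
  assert (HT2 : T ^ 2 = rho) by (apply pow2_sqrt; lra).
  assert (M := modular_squared).
  replace (T ^ 4) with (rho ^ 2) by (rewrite <- HT2; ring). rewrite HT2.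
  assert (hk2 : 0 < kmod y ^ 2 < 1) by (split; [apply pow_lt|]; nra).
  assert (hr2 : 0 < rho ^ 2 < 1) by (split; [apply pow_lt|]; nra).
  apply Rsqr_inj.
  - apply Rmult_le_pos; [lra|]. apply Rmult_le_pos; lra.
  - apply Rmult_le_pos; [lra|]. nra.
  - rewrite !Rsqr_pow2, Rpow_mult_distr, M.
    transitivity (16 * T ^ 2 * (1 - kmod y ^ 2 * rho ^ 2) ^ 2); [rewrite HT2|]; ring.
Qed.

End Invariant.

(** * Uniqueness of the root of the modular equation *)

(** The equation says that T (1 - x^2 T^4) / p (T) = x / 4. The numerator of the
    derivative in T is linear in x^2; it is positive at x = 0, and (1 - T^2)^5 at
    x = 1. *)
Lemma modular_injective x T1 T2 : 0 < x < 1 -> 0 < T1 < 1 -> 0 < T2 < 1 ->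
  x * ((1 - T1 ^ 2) * (1 + 6 * T1 ^ 2 + T1 ^ 4)) = 4 * T1 * (1 - x ^ 2 * T1 ^ 4) ->
  x * ((1 - T2 ^ 2) * (1 + 6 * T2 ^ 2 + T2 ^ 4)) = 4 * T2 * (1 - x ^ 2 * T2 ^ 4) ->
  T1 = T2.
Proof.
  intros Hx.
  set (p := fun T : R => (1 - T ^ 2) * (1 + 6 * T ^ 2 + T ^ 4)).
  set (g := fun T : R => T * (1 - x ^ 2 * T ^ 4) / p T).
  set (dg := fun T : R =>
    ((1 - x ^ 2) * (1 - 5 * T ^ 2 + 15 * T ^ 4 + 5 * T ^ 6) + x ^ 2 * (1 - T ^ 2) ^ 5) / p T ^ 2).
  assert (Hp : forall T, 0 < T < 1 -> 0 < p T).
  { intros T HT. unfold p. assert (0 < T ^ 2) by (apply pow_lt; lra).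
    assert (0 < T ^ 4) by (apply pow_lt; lra). apply Rmult_lt_0_compat; nra. }
  assert (Hg : forall T, 0 < T < 1 -> is_derive g T (dg T)).
  { intros T HT. specialize (Hp T HT). unfold g, dg. unfold p in *. auto_derive.
    - simpl in *. lra.
    - field. split; intros E; rewrite E in Hp; lra. }
  assert (Hdg : forall T, 0 < T < 1 -> 0 < dg T).
  { intros T HT. unfold dg. apply Rdiv_lt_0_compat; [|apply pow_lt, Hp, HT].
    assert (h2 : 0 < T ^ 2 < 1) by (split; [apply pow_lt|]; nra).
    replace (T ^ 4) with ((T ^ 2) ^ 2) by ring. replace (T ^ 6) with ((T ^ 2) ^ 3) by ring.
    set (S := T ^ 2) in *. assert (hx2 : 0 < x ^ 2 < 1) by (split; [apply pow_lt|]; nra).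
    assert (h3 : 0 < S ^ 3) by (apply pow_lt; lra).
    assert (0 < 1 - 5 * S + 15 * S ^ 2 + 5 * S ^ 3) by nra.
    assert (0 < (1 - S) ^ 5) by (apply pow_lt; lra).
    apply Rplus_lt_0_compat; apply Rmult_lt_0_compat; lra. }
  assert (Hmono : forall u v, 0 < u -> u < v -> v < 1 -> g u < g v).
  { intros u v Hu Huv Hv.
    destruct (MVT_gen g u v dg) as [c [Hc E]].
    - intros z Hz. rewrite Rmin_left, Rmax_right in Hz by lra. apply Hg. lra.
    - intros z Hz. rewrite Rmin_left, Rmax_right in Hz by lra.
      apply continuity_pt_filterlim, (ex_derive_continuous g). exists (dg z). apply Hg. lra.
    - rewrite Rmin_left, Rmax_right in Hc by lra. specialize (Hdg c ltac:(lra)). nra. }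
  assert (HE : forall T, 0 < T < 1 -> x * p T = 4 * T * (1 - x ^ 2 * T ^ 4) -> g T = x / 4).
  { intros T HT E. specialize (Hp T HT). unfold g. field_simplify_eq; [lra|lra]. }
  intros H1 H2 E1 E2. specialize (HE T1 H1 E1) as G1. specialize (HE T2 H2 E2) as G2.
  destruct (Rtotal_order T1 T2) as [h|[h|h]]; [|exact h|].
  - specialize (Hmono T1 T2 ltac:(lra) h ltac:(lra)). lra.
  - specialize (Hmono T2 T1 ltac:(lra) h ltac:(lra)). lra.
Qed.

Lemma Rpower_sixth_pow6 u : 0 < u -> Rpower u (1 / 6) ^ 6 = u.
Proof.
  intros Hu. rewrite <- Rpower_pow by apply exp_pos. rewrite Rpower_mult.
  replace (1 / 6 * INR 6) with 1 by (simpl; field). apply Rpower_1, Hu.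
Qed.

Lemma Rpower_half_sq u : 0 < u -> Rpower u (1 / 2) ^ 2 = u.
Proof.
  intros Hu. rewrite <- Rpower_pow by apply exp_pos. rewrite Rpower_mult.
  replace (1 / 2 * INR 2) with 1 by (simpl; field). apply Rpower_1, Hu.
Qed.

(** The parametrisation by L solves the modular equation: it is Cardano's
    formula for the cubic P^3 + 8 P = 4 (1 / w - w) in P = 1 / T - T. *)
Lemma parametrisation w L x : 0 < w < 1 -> 0 < L ->
  w = sqrt (L * (18 + L) / (6 * (64 + 3 * L))) -> 
  let M := (18 + L) / (64 + 3 * L) in
  0 < x ->
  Rpower w (1 / 2) / Rpower x (1 / 2) =
    1 / 2 * sqrt (4 + 2 / 3 *
      (Rpower L (1 / 6) / Rpower M (1 / 6)
       - 4 * (Rpower M (1 / 6) / Rpower L (1 / 6))) ^ 2)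
    + 1 / 2 * sqrt (2 / 3) *
      (Rpower L (1 / 6) / Rpower M (1 / 6)
       - 4 * (Rpower M (1 / 6) / Rpower L (1 / 6))) ->
  exists T, 0 < T < 1 /\ w = x * T ^ 2 /\
    x * ((1 - T ^ 2) * (1 + 6 * T ^ 2 + T ^ 4)) = 4 * T * (1 - x ^ 2 * T ^ 4).
Proof.
  intros Hw HL Ew M Hx ET.
  assert (HM : 0 < M) by (apply Rdiv_lt_0_compat; lra).
  assert (EM : M * (64 + 3 * L) = 18 + L) by (unfold M; field; lra).
  assert (Hw2 : 6 * w ^ 2 = L * M).
  { rewrite Ew, pow2_sqrt by (apply Rdiv_le_0_compat; nra). unfold M. field. lra. }
  set (T := Rpower w (1 / 2) / Rpower x (1 / 2)) in *.
  assert (Hwx : w = x * T ^ 2).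
  { assert (h1 := Rpower_half_sq w ltac:(lra)). assert (h2 := Rpower_half_sq x Hx).
    assert (h3 : 0 < Rpower x (1 / 2)) by apply exp_pos.
    rewrite <- h1 at 1. rewrite <- h2 at 1. unfold T. field. lra. }
  assert (HT0 : 0 < T) by (apply Rdiv_lt_0_compat; apply exp_pos).
  set (s := Rpower L (1 / 6) / Rpower M (1 / 6)) in *.
  assert (Hs : 0 < s) by (apply Rdiv_lt_0_compat; apply exp_pos).
  assert (Hs6 : s ^ 6 * M = L).
  { assert (h1 := Rpower_sixth_pow6 L HL). assert (h2 := Rpower_sixth_pow6 M HM).
    assert (h3 : 0 < Rpower M (1 / 6)) by apply exp_pos.
    unfold s. rewrite <- h2 at 2. rewrite <- h1 at 2. field. lra. }
  replace (Rpower M (1 / 6) / Rpower L (1 / 6)) with (/ s) in ET.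
  2:{ unfold s. field. split; apply Rgt_not_eq, exp_pos. }
  set (c := sqrt (2 / 3)) in *. set (D := s - 4 * / s) in *.
  assert (Hc2 : c ^ 2 = 2 / 3) by (apply pow2_sqrt; lra).
  assert (Hc : 0 < c) by (apply sqrt_lt_R0; lra).
  assert (HTq : T ^ 2 - c * D * T - 1 = 0).
  { assert (hq : sqrt (4 + 2 / 3 * D ^ 2) ^ 2 = 4 + 2 / 3 * D ^ 2).
    { apply pow2_sqrt. assert (h := pow2_ge_0 D). lra. }
    set (v := sqrt (4 + 2 / 3 * D ^ 2)) in *.
    assert (Ev : v = 2 * T - c * D) by lra. rewrite Ev in hq.
    replace ((2 * T - c * D) ^ 2) with (4 * T ^ 2 - 4 * (c * D) * T + c ^ 2 * D ^ 2) in hq by ring.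
    rewrite Hc2 in hq. lra. }
  set (P := / T - T).
  assert (HP : P = - (c * D)).
  { unfold P. apply Rmult_eq_reg_r with T; [|lra]. rewrite Rmult_minus_distr_r, Rinv_l by lra. lra. }
  (* c s^3 M = 2 w, as both are positive square roots of 4 L M / 6 *)
  assert (Hcs : c * s ^ 3 * M = 2 * w).
  { apply Rsqr_inj; [|lra|].
    - apply Rmult_le_pos; [|lra]. apply Rmult_le_pos; [lra|]. left; apply pow_lt, Hs.
    - rewrite !Rsqr_pow2.
      transitivity (c ^ 2 * (s ^ 6 * M) * M); [ring|]. rewrite Hc2, Hs6. lra. }
  assert (Hcubic : P ^ 3 + 8 * P = 4 * (/ w - w)).
  { assert (E1 : P ^ 3 + 8 * P = c * (2 / 3) * (64 / s ^ 3 - s ^ 3)).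
    { rewrite HP. unfold D.
      transitivity (c * c ^ 2 * (4 / s - s) ^ 3 + 8 * c * (4 / s - s)); [field; lra|].
      rewrite Hc2. field. lra. }
    assert (E2 : c * s ^ 3 = 2 * w / M) by (rewrite <- Hcs; field; lra).
    assert (E3 : c / s ^ 3 = M / (3 * w)).
    { assert (hs3 : 0 < s ^ 3) by (apply pow_lt, Hs).
      apply Rmult_eq_reg_r with (c * s ^ 3); [|apply Rgt_not_eq; nra].
      rewrite E2 at 2. transitivity (c ^ 2); [field; lra|]. rewrite Hc2. field. lra. }
    rewrite E1.
    transitivity (2 / 3 * (64 * (c / s ^ 3) - c * s ^ 3)); [field; lra|].
    rewrite E2, E3.
    apply Rmult_eq_reg_r with (w * 9 * M); [|apply Rgt_not_eq; nra].
    transitivity (128 * M * M - 12 * w ^ 2); [field; lra|].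
    transitivity (36 * M - 36 * w ^ 2 * M); [|field; lra].
    replace (36 * w ^ 2 * M) with (6 * (6 * w ^ 2) * M) by ring.
    replace (12 * w ^ 2) with (2 * (6 * w ^ 2)) by ring. rewrite Hw2. nra. }
  assert (HP0 : 0 < P).
  { assert (h : 0 < / w - w).
    { assert (1 < / w) by (rewrite <- Rinv_1; apply Rinv_lt_contravar; lra). lra. }
    apply Rnot_le_lt. intros hn. assert (0 <= P ^ 2) by apply pow2_ge_0. nra. }
  assert (HT1 : T < 1).
  { apply Rnot_le_lt. intros h. assert (/ T <= 1) by (rewrite <- Rinv_1; apply Rinv_le_contravar; lra).
    unfold P in HP0. lra. }
  exists T. split; [lra|]. split; [exact Hwx|].
  rewrite Hwx in Hcubic. unfold P in Hcubic.
  apply Rmult_eq_reg_r with (/ (x * T ^ 3)).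
  - transitivity ((/ T - T) ^ 3 + 8 * (/ T - T)); [field; lra|]. rewrite Hcubic. field. lra.
  - apply Rinv_neq_0_compat, Rgt_not_eq, Rmult_lt_0_compat; [lra|apply pow_lt; lra].
Qed.

Theorem mainTheorem3 (w L x : R) :
  0 < w < 1 ->
  0 < L ->
  w = sqrt (L * (18 + L) / (6 * (64 + 3 * L))) ->
  let M := (18 + L) / (64 + 3 * L) in
  0 < x ->
  Rpower w (1 / 2) / Rpower x (1 / 2) =
    1 / 2 * sqrt (4 + 2 / 3 *
      (Rpower L (1 / 6) / Rpower M (1 / 6)
       - 4 * (Rpower M (1 / 6) / Rpower L (1 / 6))) ^ 2)
    + 1 / 2 * sqrt (2 / 3) *
      (Rpower L (1 / 6) / Rpower M (1 / 6)
       - 4 * (Rpower M (1 / 6) / Rpower L (1 / 6))) ->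
  0 < x < 1 ->
  let r := inv_singular_modulus x in
  let w' := sqrt (sqrt (1 - x ^ 2) * sqrt (1 - w ^ 4 / x ^ 2)) in
  x ^ 4 - 6 * x ^ 3 * w - 20 * x * w ^ 3 + 15 * w ^ 2 * x ^ 2 - 6 * x * w
    + 15 * w ^ 4 + w ^ 2 <> 0 ->
  / rogers_ramanujan (exp (- PI * sqrt (inv_singular_modulus x))) ^ 5 - 11
    - rogers_ramanujan (exp (- PI * sqrt (inv_singular_modulus x))) ^ 5
  = a_ r
  /\
  a_ r =
    (16 * x ^ 6 - 26 * x ^ 4 - w * x ^ 3 + 10 * x ^ 2 + w * x)
    / (x ^ 4 - 6 * x ^ 3 * w - 20 * x * w ^ 3 + 15 * w ^ 2 * x ^ 2 - 6 * x * w
       + 15 * w ^ 4 + w ^ 2)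
    * (w / x + w' / sqrt (1 - x ^ 2) - w * w' / (x * sqrt (1 - x ^ 2))) ^ 3.
Proof.
  intros Hw HL Ew M Hx ET Hx1 r w' Hden.
  destruct (parametrisation w L x Hw HL Ew Hx ET) as [T [HT [Hwx HTeq]]].
  clear Ew ET M L HL.
  destruct (inv_singular_modulus_spec x Hx1) as [Hr Hrx]. fold r in Hr, Hrx |- *.
  assert (HP := PI_RGT_0). assert (Hsr := sqrt_lt_R0 r Hr).
  set (y := PI * sqrt r). assert (Hy : 0 < y) by (unfold y; nra). assert (H5 : 0 < 5 * y) by lra.
  assert (Ek : singular_modulus r = kmod y) by (apply singular_modulus_kmod, Hr).
  assert (El : singular_modulus (25 * r) = kmod (5 * y)).
  { rewrite singular_modulus_kmod by lra. rewrite sqrt_25 by lra. f_equal. unfold y. ring. }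
  assert (Hkx : kmod y = x) by (rewrite <- Ek; exact Hrx).
  destruct (t_pos y Hy) as [a2 [a3 a4]]. destruct (t_pos _ H5) as [b2 [b3 b4]].
  assert (Ekl : sqrt (kmod y / kmod (5 * y)) = t2 y * t3 (5 * y) / (t3 y * t2 (5 * y))).
  { rewrite <- (sqrt_pow2 (t2 y * t3 (5 * y) / (t3 y * t2 (5 * y)))).
    - f_equal. unfold kmod. field. repeat split; lra.
    - left. apply Rdiv_lt_0_compat; nra. }
  assert (Ea : a_ r = (t4 y ^ 2 / t3 y ^ 2 / (t4 (5 * y) ^ 2 / t3 (5 * y) ^ 2)) ^ 2
    * (t2 y * t3 (5 * y) / (t3 y * t2 (5 * y)))
    * / (PI / 2 * t3 (5 * y) ^ 2 / (PI / 2 * t3 y ^ 2)) ^ 3).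
  { unfold a_, compl_singular_modulus, multiplier5. rewrite El, Ek, Ekl.
    rewrite !kmod_compl, !ellipticK_kmod by assumption. reflexivity. }
  split.
  - replace (- PI * sqrt r) with (- y) by (unfold y; ring).
    rewrite rr_quintic by exact Hy. rewrite Ea.
    assert (E1 := t4_eta y Hy). assert (E5 := t4_eta _ H5).
    assert (F1 := f1_pos y Hy). assert (F5 := f1_pos _ H5).
    transitivity ((t4 y ^ 4 * (t2 y * t3 y)) / (t4 (5 * y) ^ 4 * (t2 (5 * y) * t3 (5 * y)))).
    + rewrite E1, E5. rewrite exp5_quarter. assert (Hz := exp_pos (- (y / 4))).
      replace (exp y) with (/ exp (- (y / 4)) ^ 4).
      * field. split; lra.
      * rewrite <- exp4_quarter, exp_Ropp, Rinv_inv. reflexivity.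
    + field. repeat split; lra.
  - assert (Hrho := rho_pos y Hy). assert (Hrho1 := rho_lt1 y Hy).
    assert (Hsig := sigma_pos y Hy). assert (Hm := mult_eq y Hy).
    assert (Hmod := modular_equation y Hy). cbv zeta in Hmod. rewrite Hkx in Hmod.
    assert (HT0 : 0 < sqrt (rho y) < 1).
    { split; [apply sqrt_lt_R0, Hrho|]. rewrite <- sqrt_1. apply sqrt_lt_1; lra. }
    assert (ET : T = sqrt (rho y)) by (apply (modular_injective x); assumption).
    assert (Hwr : w = x * rho y).
    { rewrite Hwx, ET, pow2_sqrt by lra. reflexivity. }
    assert (Hms := modular_squared y Hy). rewrite Hkx in Hms.
    assert (Hks := kmod_sigma y Hy). rewrite Hkx in Hks.
    assert (Hx2 : 0 < 1 - x ^ 2) by nra.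
    assert (Ekc : sqrt (1 - x ^ 2) = t4 y ^ 2 / t3 y ^ 2) by (rewrite <- Hkx; apply kmod_compl, Hy).
    set (k' := sqrt (1 - x ^ 2)) in *.
    assert (Hk' : 0 < k') by (apply sqrt_lt_R0, Hx2).
    assert (Hk'2 : k' ^ 2 = 1 - x ^ 2) by (apply pow2_sqrt; lra).
    assert (Ew' : w' = k' * sigma y).
    { unfold w'.
      replace (1 - w ^ 4 / x ^ 2) with (k' ^ 2 * sigma y ^ 4).
      - replace (k' ^ 2 * sigma y ^ 4) with ((k' * sigma y ^ 2) ^ 2) by ring.
        rewrite sqrt_pow2 by (apply Rmult_le_pos; [lra|apply pow2_ge_0]).
        replace (k' * (k' * sigma y ^ 2)) with ((k' * sigma y) ^ 2) by ring.
        apply sqrt_pow2. nra.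
      - rewrite Hk'2, Hwr. transitivity (1 - x ^ 2 * rho y ^ 4); [lra|field; lra]. }
    replace (w / x + w' / k' - w * w' / (x * k')) with (mult y).
    2:{ rewrite Hm, Ew', Hwr. field. lra. }
    assert (Ea2 : a_ r = / (rho y * sigma y ^ 4) * mult y ^ 3).
    { rewrite Ea. unfold rho, sigma, mult. field. repeat split; lra. }
    rewrite Ea2. f_equal.
    rewrite Hwr in Hden |- *. set (p := rho y) in *. set (s := sigma y) in *.
    assert (Hs4 : 0 < s ^ 4) by (apply pow_lt; lra).
    apply Rmult_eq_reg_r with (p * s ^ 4 *
      (x ^ 4 - 6 * x ^ 3 * (x * p) - 20 * x * (x * p) ^ 3 + 15 * (x * p) ^ 2 * x ^ 2 - 6 * x * (x * p)
       + 15 * (x * p) ^ 4 + (x * p) ^ 2)).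
    2:{ apply Rmult_integral_contrapositive_currified; [apply Rgt_not_eq; nra|exact Hden]. }
    transitivity (x ^ 4 - 6 * x ^ 3 * (x * p) - 20 * x * (x * p) ^ 3 + 15 * (x * p) ^ 2 * x ^ 2
      - 6 * x * (x * p) + 15 * (x * p) ^ 4 + (x * p) ^ 2); [field; lra|].
    transitivity ((16 * x ^ 6 - 26 * x ^ 4 - x * p * x ^ 3 + 10 * x ^ 2 + x * p * x) * (p * s ^ 4));
      [|field; exact Hden].
    (* the numerator carries the factor 1 - x^2 that turns s^4 into 1 - x^2 p^4 *)
    transitivity (x ^ 2 * (10 + p - 16 * x ^ 2) * p * ((1 - x ^ 2) * s ^ 4)); [|ring].
    replace ((1 - x ^ 2) * s ^ 4) with (1 - x ^ 2 * p ^ 4) by lra.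
    apply Rminus_diag_uniq.
    transitivity (x ^ 2 * (x ^ 2 * ((1 - p) * (1 + 6 * p + p ^ 2)) ^ 2
      - 16 * p * (1 - x ^ 2 * p ^ 2) ^ 2)); [ring|].
    rewrite Hms. ring.
Qed.
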